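(* The linear map $$\mathcal F(U_n)_q\to\mathrm{End}(\mathbb C[\mathbb C^n]_{q,\alpha}),\qquad f\mapsto T_f,$$ is a morphism of $U_q\mathfrak{su}_{n,1}$-modules.
   Context: **Notation.** Fix an integer $n\ge1$, $q\in(0,1)$ and a real number $\alpha>0$. $(a;q)_m=\prod_{j=0}^{m-1}(1-aq^j)$. For $\underline i,\underline j\in\mathbb Z_{\ge0}^n$: $\underline i\times\underline j=(i_1j_1,\dots,i_nj_n)$; $P(n)=\{\underline k\in\mathbb Z^n_{\ge0}: k_1\ge\dots\ge k_n\}$; $\mathbf z^{\underline i}=z_n^{i_n}\cdots z_1^{i_1}$, $\mathbf z^{*\underline i}=z_1^{*i_1}\cdots z_n^{*i_n}$. **Quantum group.** $U_q\mathfrak{sl}_{n+1}$ is the unital algebra with generators $E_i,F_i,K_i^{\pm1}$ ($1\le i\le n$) and the standard Drinfeld–Jimbo relations: the $K_i$ commute and are invertible, $K_iE_j=q^{a_{ij}}E_jK_i$, $K_iF_j=q^{-a_{ij}}F_jK_i$, $E_iF_j-F_jE_i=\delta_{ij}\frac{K_i-K_i^{-1}}{q-q^{-1}}$, $E_i^2E_j-(q+q^{-1})E_iE_jE_i+E_jE_i^2=0$ and the same for $F$ when $|i-j|=1$, $[E_i,E_j]=[F_i,F_j]=0$ when $|i-j|\ne1$; $(a_{ij})$ is the Cartan matrix of type $A_n$. Hopf structure: $\Delta E_i=E_i\otimes1+K_i\otimes E_i$, $\Delta F_i=F_i\otimes K_i^{-1}+1\otimes F_i$, $\Delta K_i=K_i\otimes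 K_i$, $S(E_i)=-K_i^{-1}E_i$, $S(F_i)=-F_iK_i$, $S(K_i)=K_i^{-1}$, $\varepsilon(E_i)=\varepsilon(F_i)=0$, $\varepsilon(K_i)=1$. $U_q\mathfrak{su}_{n,1}$ is this Hopf algebra with the involution $E_n^*=-K_nF_n$, $F_n^*=-E_nK_n^{-1}$, $E_j^*=K_jF_j$, $F_j^*=E_jK_j^{-1}$ ($j\ne n$), $(K_j^{\pm1})^*=K_j^{\pm1}$. A unital $*$-algebra $F$ is a module algebra over a $*$-Hopf algebra $A$ if it is an $A$-module, multiplication $F\otimes F\to F$ is an $A$-morphism, $\xi(1)=\varepsilon(\xi)1$, and $(\xi(f))^*=S(\xi)^*(f^* )$. **Algebras.** $\mathcal P(\mathbb C^n)_q$ is the unital $*$-algebra with generators $z_1,\dots,z_n$ and relations $z_iz_j=qz_jz_i$ ($i<j$), $z_i^*z_j=qz_jz_i^*$ ($i\ne j$), $z_j^*z_j=q^2z_jz_j^*+(1-q^2)(1-\sum_{k>j}z_kz_k^* )$. $\mathbb C[\mathbb C^n]_q$ is the subalgebra generated by $z_1,\dots,z_n$; the monomials $\mathbf z^{\underline m}$ are its basis. $\mathcal F(U_n)_q$ is obtained from $\mathcal P(\mathbb C^n)_q$ by adding a generator $f_0$ with $f_0^*=f_0^2=f_0$, $z_i^*f_0=f_0z_i=0$; $\mathcal D(U_n)_q=\mathcal F(U_n)_qf_0\mathcal F(U_n)_q$ is the ideal of finite functions, and $\mathcal F(U_n)_q=\mathcal P(\mathbb C^n)_q+\mathcal D(U_n)_q$.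 $\mathcal F(U_n)_q$ acts faithfully on the space $H$ with basis $\mathbf z^{\underline m}e_0$, where $z_i^*e_0=0$ and $f_0$ is the projection onto $\mathbb Ce_0$; under this action $\mathcal D(U_n)_q$ is the algebra of operators with finitely many nonzero matrix entries. **Module structure.** $\mathcal F(U_n)_q$ is a $U_q\mathfrak{su}_{n,1}$-module algebra with: for $k\ne n$: $K_kz_k=qz_k$, $K_kz_{k+1}=q^{-1}z_{k+1}$, $K_kz_i=z_i$ otherwise; $F_kz_k=q^{1/2}z_{k+1}$, $F_kz_i=0$ otherwise; $E_kz_{k+1}=q^{-1/2}z_k$, $E_kz_i=0$ otherwise; $K_nz_n=q^2z_n$, $K_nz_i=qz_i$ ($i<n$); $F_nz_n=q^{1/2}$, $F_nz_i=0$ ($i<n$); $E_nz_i=-q^{1/2}z_nz_i$ for all $i$; $K_jf_0=f_0$ for all $j$, $E_kf_0=F_kf_0=0$ ($k\ne n$), $F_nf_0=-\frac{q^{1/2}}{q^{-2}-1}f_0z_n^*$, $E_nf_0=-\frac{q^{1/2}}{1-q^2}z_nf_0$. **Weighted scalar product.** Put $y_i=1-z_iz_i^*-\dots-z_nz_n^*$; in $H$, $y_j\mathbf z^{\underline m}e_0=q^{2(m_j+\dots+m_n)}\mathbf z^{\underline m}e_0$, so functions on $\mathfrak M=\{(q^{2k_1},\dots,q^{2k_n}):\underline k\in P(n)\}$ can be evaluated on $(y_1,\dots,y_n)$. Each $f\in\mathcal F(U_n)_q$ is uniquely a finite sum $\sum_{\underline i\times\underline j=\underline0}\mathbf z^{\underline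 i}f_{\underline i,\underline j}(y_1,\dots,y_n)\mathbf z^{*\underline j}$ with $f_{\underline i,\underline j}$ functions on $\mathfrak M$. $\int_{U_n}f\,dm_{\alpha,q}=(q^{2\alpha+2};q^2)_n\sum_{\underline k\in P(n)}f_{\underline 0,\underline 0}(q^{2k_1},\dots,q^{2k_n})q^{2k_1(\alpha+1)}q^{2k_2}\cdots q^{2k_n}$, $(f,g)_{\alpha,q}=\int_{U_n}g^*f\,dm_{\alpha,q}$. $L^2(dm_{\alpha,q})$ is the completion of $\mathcal D(U_n)_q$ in this scalar product (it contains $\mathcal F(U_n)_q$), and $P_{\alpha,q}$ is the orthogonal projection onto the closure of $\mathbb C[\mathbb C^n]_q$. **Twisted action.** $\mathbb C[\mathbb C^n]_{q,\alpha}$ is $\mathbb C[\mathbb C^n]_q$ with scalar product $(\cdot,\cdot)_{\alpha,q}$ and the $U_q\mathfrak{su}_{n,1}$-action $\pi_\alpha$: $\pi_\alpha(E_j)f=E_jf$, $\pi_\alpha(F_j)f=F_jf$, $\pi_\alpha(K_j^{\pm1})f=K_j^{\pm1}f$ for $j\ne n$; $\pi_\alpha(E_n)f=E_nf-q^{1/2}\frac{1-q^{2\alpha+2n+2}}{1-q^2}(K_nf)z_n$, $\pi_\alpha(F_n)f=q^{-\alpha-n-1}F_nf$, $\pi_\alpha(K_n^{\pm1})f=q^{\pm(\alpha+n+1)}K_n^{\pm1}f$. For a module $V$ over a Hopf algebra, $\mathrm{End}(V)$ is a module via $\xi(T)=\sum_j\xi'_jTS(\xi''_j)$, $\Delta(\xi)=\sum_j\xi'_j\otimes\xi''_j$;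 $\mathrm{End}(\mathbb C[\mathbb C^n]_{q,\alpha})$ has this structure for $\pi_\alpha$. **Toeplitz operators.** For $f\in\mathcal F(U_n)_q$, $T_f(\psi)=P_{\alpha,q}(f\psi)$, $\psi\in\mathbb C[\mathbb C^n]_{q,\alpha}$; $T_f$ maps $\mathbb C[\mathbb C^n]_{q,\alpha}$ to itself. *)

(* Defs.v *)
From HB Require Import structures.
From mathcomp Require Import all_boot all_order all_algebra.
From mathcomp Require Import complex.
From mathcomp Require Import all_classical all_reals topology normedtype.
From mathcomp Require Import sequences numfun esum exp.

Set Implicit Arguments.
Unset Strict Implicit.
Unset Printing Implicit Defensive.

Import Order.TTheory GRing.Theory Num.Theory.
Import numFieldNormedType.Exports.

Local Open Scope classical_set_scope.
Local Open Scope ring_scope.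
Local Open Scope complex_scope.

Inductive term (K X : Type) : Type :=
  | TGen of X
  | TCst of K
  | TAdd of term K X & term K X
  | TMul of term K X & term K X.
Arguments TGen {K X}.
Arguments TCst {K X}.

HB.instance Definition _ K X := gen_eqMixin (term K X).
HB.instance Definition _ K X := gen_choiceMixin (term K X).

Declare Scope pterm_scope.
Delimit Scope pterm_scope with PT.
Bind Scope pterm_scope with term.
Notation "s + t" := (TAdd s t) : pterm_scope.
Notation "s * t" := (TMul s t) : pterm_scope.
Notation "s - t" := (TAdd s (TMul (TCst (-1)) t)) : pterm_scope.
Notation "c %:T" := (TCst c) : pterm_scope.

Section Evaluation.
Variables (K : nzRingType) (X : Type) (A : algType K) (g : X -> A).

Fixpoint teval (t : term K X) : A :=
  match t with
  | TGen x => g x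
  | TCst c => c%:A
  | TAdd s t => teval s + teval t
  | TMul s t => teval s * teval t
  end.

End Evaluation.

(* The character of a presentation witnesses that the presented algebra is not
   zero, which [algType] requires. *)
Record presentation (K : fieldType) := Presentation {
  pgen : Type;
  prel : term K pgen -> term K pgen -> Prop;
  pchar : pgen -> K;
  pchar_rel : forall s t, prel s t ->
    teval (pchar : pgen -> K^o) s = teval (pchar : pgen -> K^o) t }.

Inductive pcong (K : fieldType) (X : Type) (rel : term K X -> term K X -> Prop) :
    term K X -> term K X -> Prop :=
  | pc_rel s t : rel s t -> pcong rel s t
  | pc_refl s : pcong rel s s
  | pc_sym s t : pcong rel s t -> pcong rel t s
  | pc_trans s t u : pcong rel s t -> pcong rel t u -> pcong rel s u
  | pc_add s s' t t' : pcong rel s s' -> pcong rel t t' ->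
      pcong rel (s + t)%PT (s' + t')%PT
  | pc_mul s s' t t' : pcong rel s s' -> pcong rel t t' ->
      pcong rel (s * t)%PT (s' * t')%PT
  | pc_addA s t u : pcong rel (s + (t + u))%PT (s + t + u)%PT
  | pc_addC s t : pcong rel (s + t)%PT (t + s)%PT
  | pc_add0 s : pcong rel (0%:T + s)%PT s
  | pc_addN s : pcong rel ((-1)%:T * s + s)%PT 0%:T%PT
  | pc_mulA s t u : pcong rel (s * (t * u))%PT (s * t * u)%PT
  | pc_mul1 s : pcong rel (1%:T * s)%PT s
  | pc_mulDl s t u : pcong rel ((s + t) * u)%PT (s * u + t * u)%PT
  | pc_mulDr s t u : pcong rel (s * (t + u))%PT (s * t + s * u)%PT
  | pc_cstD a b : pcong rel (a + b)%R%:T%PT (a%:T + b%:T)%PT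
  | pc_cstM a b : pcong rel (a * b)%R%:T%PT (a%:T * b%:T)%PT
  | pc_cstC a s : pcong rel (a%:T * s)%PT (s * a%:T)%PT.

Section PresentedAlgebra.
Variables (K : fieldType) (P : presentation K).
Local Notation tm := (term K (pgen P)).
Local Notation "s ~ t" := (pcong (@prel K P) s t) (at level 70).

Definition pcongb (s t : tm) : bool := `[< s ~ t >].

Lemma pcongb_refl : reflexive pcongb.
Proof. by move=> s; apply/asboolP; exact: pc_refl. Qed.

Lemma pcongb_sym : symmetric pcongb.
Proof. by move=> s t; apply/asboolP/asboolP; exact: pc_sym. Qed.

Lemma pcongb_trans : transitive pcongb.
Proof.
by move=> t s u /asboolP st /asboolP tu; apply/asboolP; exact: pc_trans st tu.
Qed.

Canonical pcongb_equiv := EquivRel pcongb pcongb_refl pcongb_sym pcongb_trans.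

Definition palg : Type := {eq_quot pcongb}%qT.
HB.instance Definition _ := Choice.on palg.
HB.instance Definition _ := Quotient.on palg.

Definition pclass (t : tm) : palg := \pi_palg%qT t.
Definition prepr (x : palg) : tm := repr x.
Definition pg (x : pgen P) : palg := pclass (TGen x).

Lemma preprK : cancel prepr pclass.
Proof. exact: reprK. Qed.

Lemma pclass_eq s t : s ~ t -> pclass s = pclass t.
Proof. by move=> st; apply/eqmodP; apply/asboolP. Qed.

Lemma pclass_inj s t : pclass s = pclass t -> s ~ t.
Proof. by move=> /eqmodP/asboolP. Qed.

Lemma prepr_class t : prepr (pclass t) ~ t.
Proof. by apply: pclass_inj; rewrite preprK. Qed.

Definition padd (x y : palg) : palg := pclass (prepr x + prepr y)%PT.
Definition pmul (x y : palg) : palg := pclass (prepr x * prepr y)%PT.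
Definition popp (x : palg) : palg := pclass ((-1)%:T * prepr x)%PT.
Definition pscale (a : K) (x : palg) : palg := pclass (a%:T * prepr x)%PT.

Lemma pclassD s t : pclass (s + t)%PT = padd (pclass s) (pclass t).
Proof.
by apply: pclass_eq; apply: pc_add; apply: pc_sym; exact: prepr_class.
Qed.

Lemma pclassM s t : pclass (s * t)%PT = pmul (pclass s) (pclass t).
Proof.
by apply: pclass_eq; apply: pc_mul; apply: pc_sym; exact: prepr_class.
Qed.

Lemma pclassN t : pclass ((-1)%:T * t)%PT = popp (pclass t).
Proof.
apply: pclass_eq; apply: pc_mul; [exact: pc_refl|].
by apply: pc_sym; exact: prepr_class.
Qed.

Lemma pclassZ a t : pclass (a%:T * t)%PT = pscale a (pclass t).
Proof.
apply: pclass_eq; apply: pc_mul; [exact: pc_refl|].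
by apply: pc_sym; exact: prepr_class.
Qed.

Lemma palg_ind (Q : palg -> Prop) : (forall t, Q (pclass t)) -> forall x, Q x.
Proof. by move=> Qt x; rewrite -(preprK x). Qed.

Lemma paddA : associative padd.
Proof.
elim/palg_ind=> s; elim/palg_ind=> t; elim/palg_ind=> u.
by rewrite -!pclassD; apply: pclass_eq; exact: pc_addA.
Qed.

Lemma paddC : commutative padd.
Proof.
elim/palg_ind=> s; elim/palg_ind=> t.
by rewrite -!pclassD; apply: pclass_eq; exact: pc_addC.
Qed.

Lemma padd0 : left_id (pclass 0%:T%PT) padd.
Proof.
by elim/palg_ind=> s; rewrite -pclassD; apply: pclass_eq; exact: pc_add0.
Qed.

Lemma paddN : left_inverse (pclass 0%:T%PT) popp padd.
Proof.
elim/palg_ind=> s; rewrite -pclassN -pclassD.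
by apply: pclass_eq; exact: pc_addN.
Qed.

HB.instance Definition _ := GRing.isZmodule.Build palg paddA paddC padd0 paddN.

Lemma pmulA : associative pmul.
Proof.
elim/palg_ind=> s; elim/palg_ind=> t; elim/palg_ind=> u.
by rewrite -!pclassM; apply: pclass_eq; exact: pc_mulA.
Qed.

Lemma pmul1 : left_id (pclass 1%:T%PT) pmul.
Proof.
by elim/palg_ind=> s; rewrite -pclassM; apply: pclass_eq; exact: pc_mul1.
Qed.

Lemma pmulr1 : right_id (pclass 1%:T%PT) pmul.
Proof.
elim/palg_ind=> s; rewrite -pclassM; apply: pclass_eq.
by apply: pc_trans (pc_mul1 _ _); apply: pc_sym; exact: pc_cstC.
Qed.

Lemma pmulDl : left_distributive pmul padd.
Proof.
elim/palg_ind=> s; elim/palg_ind=> t; elim/palg_ind=> u.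
by rewrite -!(pclassM, pclassD); apply: pclass_eq; exact: pc_mulDl.
Qed.

Lemma pmulDr : right_distributive pmul padd.
Proof.
elim/palg_ind=> s; elim/palg_ind=> t; elim/palg_ind=> u.
by rewrite -!(pclassM, pclassD); apply: pclass_eq; exact: pc_mulDr.
Qed.

Lemma pcong_char s t : s ~ t ->
  teval (@pchar K P : pgen P -> K^o) s = teval (@pchar K P : pgen P -> K^o) t.
Proof.
elim=> {s t} /= [s t||s t _ ->|s t u _ -> _ ->|s s' t t' _ -> _ ->
  |s s' t t' _ -> _ ->|||||||||||] //.
- exact: pchar_rel.
- by move=> s t u; rewrite addrA.
- by move=> s t; rewrite addrC.
- by move=> s; rewrite scale0r add0r.
- by move=> s; rewrite scaleN1r mulN1r addNr scale0r.
- by move=> s t u; rewrite mulrA.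
- by move=> s; rewrite scale1r mul1r.
- by move=> s t u; rewrite mulrDl.
- by move=> s t u; rewrite mulrDr.
- by move=> a b; rewrite scalerDl.
- by move=> a b; rewrite -scalerAl mul1r scalerA.
- by move=> a s; rewrite mulrC.
Qed.

Lemma p1_neq0 : pclass 1%:T%PT != 0.
Proof.
apply/eqP => /pclass_inj/pcong_char /=.
by rewrite scale1r scale0r => /eqP; rewrite oner_eq0.
Qed.

HB.instance Definition _ := GRing.Zmodule_isNzRing.Build palg
  pmulA pmul1 pmulr1 pmulDl pmulDr p1_neq0.

Lemma pscaleA a b x : pscale a (pscale b x) = pscale (a * b) x.
Proof.
elim/palg_ind: x => t; rewrite -!pclassZ; apply: pclass_eq.
apply: pc_trans (pc_mulA _ _ _ _) _.
by apply: pc_mul; [apply: pc_sym; exact: pc_cstM|exact: pc_refl].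
Qed.

Lemma pscale1 : left_id 1 pscale.
Proof.
by elim/palg_ind=> s; rewrite -pclassZ; apply: pclass_eq; exact: pc_mul1.
Qed.

Lemma pscaleDr : right_distributive pscale +%R.
Proof.
move=> a; elim/palg_ind=> s; elim/palg_ind=> t.
rewrite -[_ + _]pclassD -!pclassZ -[RHS]pclassD; apply: pclass_eq.
exact: pc_mulDr.
Qed.

Lemma pscaleDl x : {morph pscale^~ x : a b / a + b}.
Proof.
move=> a b; elim/palg_ind: x => t.
rewrite -!pclassZ -[RHS]pclassD; apply: pclass_eq.
apply: pc_trans (pc_mulDl _ _ _ _).
by apply: pc_mul; [exact: pc_cstD|exact: pc_refl].
Qed.

HB.instance Definition _ := GRing.Zmodule_isLmodule.Build K palg
  pscaleA pscale1 pscaleDr pscaleDl.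

Lemma pscaleAl (a : K) (x y : palg) : a *: (x * y) = a *: x * y.
Proof.
elim/palg_ind: x => s; elim/palg_ind: y => t.
rewrite -[_ * _]pclassM -[_ *: _]pclassZ -[_ *: pclass s]pclassZ.
rewrite -[RHS]pclassM; apply: pclass_eq; exact: pc_mulA.
Qed.

HB.instance Definition _ := GRing.Lmodule_isLalgebra.Build K palg pscaleAl.

Lemma pscaleAr (a : K) (x y : palg) : a *: (x * y) = x * (a *: y).
Proof.
elim/palg_ind: x => s; elim/palg_ind: y => t.
rewrite -[_ * _]pclassM -[_ *: _]pclassZ -[_ *: pclass t]pclassZ.
rewrite -[RHS]pclassM; apply: pclass_eq.
apply: pc_trans (pc_mulA _ _ _ _) _; apply: pc_trans (pc_sym (pc_mulA _ _ _ _)).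
by apply: pc_mul; [exact: pc_cstC|exact: pc_refl].
Qed.

HB.instance Definition _ := GRing.Lalgebra_isAlgebra.Build K palg pscaleAr.

Lemma pclass_add s t : pclass (s + t)%PT = pclass s + pclass t.
Proof. exact: pclassD. Qed.

Lemma pclass_mul s t : pclass (s * t)%PT = pclass s * pclass t.
Proof. exact: pclassM. Qed.

Lemma pclass_cst a : pclass a%:T%PT = a%:A.
Proof.
rewrite -[_ *: _]pclassZ; apply: pclass_eq.
by rewrite -[a in X in X ~ _]mulr1; exact: pc_cstM.
Qed.

End PresentedAlgebra.

Definition is_algebra_action (K : fieldType) (A : algType K) (V : lmodType K)
    (rho : A -> V -> V) : Prop :=
  [/\ forall a, linear (rho a),
      forall v, linear (rho^~ v),
      forall v, rho 1 v = v
    & forall a b v, rho (a * b) v = rho a (rho b v)].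

(* A finite list of pairs stands for the sum of the simple tensors of its
   entries; two lists are the same element of the tensor product when no
   bilinear map distinguishes them. *)
Definition tensor_eq (K : fieldType) (A : lmodType K) (s t : seq (A * A)) : Prop :=
  forall (W : lmodType K) (B : A -> A -> W),
    (forall a, linear (B a)) -> (forall b, linear (B^~ b)) ->
    \sum_(p <- s) B p.1 p.2 = \sum_(p <- t) B p.1 p.2.

(* [antipode1] and [antipodeM] hold in every Hopf algebra; they are listed because
   the antipode is given below by its values on generators. *)
Record hopf_star_algebra (C : numClosedFieldType) (A : algType C) := HopfStarAlgebra {
  Delta : A -> seq (A * A);
  counit : A -> C;
  antipode : A -> A;
  hstar : A -> A;
  Delta_linear : forall c a b, tensor_eq (Delta (c *: a + b))
    ([seq (c *: p.1, p.2) | p <- Delta a] ++ Delta b);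
  Delta1 : tensor_eq (Delta 1) [:: (1, 1)];
  DeltaM : forall a b, tensor_eq (Delta (a * b))
    [seq (p.1 * r.1, p.2 * r.2) | p <- Delta a, r <- Delta b];
  coassoc : forall a (W : lmodType C) (B : A -> A -> A -> W),
    (forall x y, linear (B x y)) -> (forall x z, linear (fun y => B x y z)) ->
    (forall y z, linear (fun x => B x y z)) ->
    \sum_(p <- Delta a) \sum_(r <- Delta p.1) B r.1 r.2 p.2
    = \sum_(p <- Delta a) \sum_(r <- Delta p.2) B p.1 r.1 r.2;
  counit_linear : scalar counit;
  counit1 : counit 1 = 1;
  counitM : forall a b, counit (a * b) = counit a * counit b;
  counitl : forall a, \sum_(p <- Delta a) counit p.1 *: p.2 = a;
  counitr : forall a, \sum_(p <- Delta a) counit p.2 *: p.1 = a;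
  antipode_linear : linear antipode;
  antipode1 : antipode 1 = 1;
  antipodeM : forall a b, antipode (a * b) = antipode b * antipode a;
  antipodel : forall a, \sum_(p <- Delta a) antipode p.1 * p.2 = (counit a)%:A;
  antipoder : forall a, \sum_(p <- Delta a) p.1 * antipode p.2 = (counit a)%:A;
  hstar_antilinear : forall c a b, hstar (c *: a + b) = Num.conj c *: hstar a + hstar b;
  hstarM : forall a b, hstar (a * b) = hstar b * hstar a;
  hstarK : involutive hstar;
  Delta_hstar : forall a, tensor_eq (Delta (hstar a))
    [seq (hstar p.1, hstar p.2) | p <- Delta a];
  counit_hstar : forall a, counit (hstar a) = Num.conj (counit a) }.

Section ModuleAlgebra.
Variables (C : numClosedFieldType) (A : algType C) (H : hopf_star_algebra A).

Definition is_module_star_algebra (F : algType C) (star : F -> F)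
    (act : A -> F -> F) : Prop :=
  [/\ is_algebra_action act,
      forall xi f g, act xi (f * g)
        = \sum_(p <- Delta H xi) act p.1 f * act p.2 g,
      forall xi, act xi 1 = (counit H xi)%:A
    & forall xi f, star (act xi f) = act (hstar H (antipode H xi)) (star f)].

Definition end_action (V : lmodType C) (rho : A -> V -> V) (xi : A)
    (T : V -> V) : V -> V :=
  fun v => \sum_(p <- Delta H xi) rho p.1 (T (rho (antipode H p.2) v)).

End ModuleAlgebra.

Section QuantumGroup.
Variables (R : realType) (n : nat) (q : R).
Local Notation C := R[i].

(* Indices run over 0, ..., n - 1, so the distinguished index n is the last one, and the
   successor of [k] is the [i : 'I_n] with [i = k.+1 :> nat]. *)
Definition is_last (k : 'I_n) : bool := k.+1 == n.

Definition cartan (i j : 'I_n) : int :=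
  if i == j then 2
  else if (i.+1 == j) || (j.+1 == i) then -1 else 0.

Inductive Uq_gen := UE of 'I_n | UF of 'I_n | UK of 'I_n | UKV of 'I_n.

Local Notation E i := (TGen (UE i) : term C Uq_gen).
Local Notation F i := (TGen (UF i) : term C Uq_gen).
Local Notation K i := (TGen (UK i) : term C Uq_gen).
Local Notation KV i := (TGen (UKV i) : term C Uq_gen).
Local Notation cst x := (TCst (x%R)%:C : term C Uq_gen).

Inductive Uq_rel : term C Uq_gen -> term C Uq_gen -> Prop :=
  | Uq_KKV i : Uq_rel (K i * KV i) (cst 1)
  | Uq_KVK i : Uq_rel (KV i * K i) (cst 1)
  | Uq_KK i j : Uq_rel (K i * K j) (K j * K i)
  | Uq_KE i j : Uq_rel (K i * E j) (cst (q ^ cartan i j) * E j * K i)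
  | Uq_KF i j : Uq_rel (K i * F j) (cst (q ^ (- cartan i j)) * F j * K i)
  | Uq_EF i j : Uq_rel (E i * F j - F j * E i)
      (cst ((i == j)%:R / (q - q^-1)) * (K i - KV i))
  | Uq_EEE i j : cartan i j = -1 ->
      Uq_rel (E i * E i * E j - cst (q + q^-1) * E i * E j * E i + E j * E i * E i)
             (cst 0)
  | Uq_FFF i j : cartan i j = -1 ->
      Uq_rel (F i * F i * F j - cst (q + q^-1) * F i * F j * F i + F j * F i * F i)
             (cst 0)
  | Uq_EE i j : cartan i j <> -1 -> Uq_rel (E i * E j - E j * E i) (cst 0)
  | Uq_FF i j : cartan i j <> -1 -> Uq_rel (F i * F j - F j * F i) (cst 0).

Definition Uq_char (x : Uq_gen) : C :=
  match x with UE _ | UF _ => 0 | UK _ | UKV _ => 1 end.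

Lemma Uq_char_rel s t : Uq_rel s t ->
  teval (Uq_char : Uq_gen -> C^o) s = teval (Uq_char : Uq_gen -> C^o) t.
Proof.
case=> {s t} /= *;
  by rewrite ?(mulr0, mul0r, mulr1, scaleN1r, mulN1r, subrr, oppr0, addr0,
               scale1r, scale0r).
Qed.

Definition Uq_presentation : presentation C := Presentation Uq_char_rel.

Definition Uq : Type := palg Uq_presentation.
HB.instance Definition _ := GRing.Algebra.on Uq.

Definition Uq_E (i : 'I_n) : Uq := @pg _ Uq_presentation (UE i).
Definition Uq_F (i : 'I_n) : Uq := @pg _ Uq_presentation (UF i).
Definition Uq_K (i : 'I_n) : Uq := @pg _ Uq_presentation (UK i).
Definition Uq_KV (i : 'I_n) : Uq := @pg _ Uq_presentation (UKV i).

Record is_Uq_su (H : hopf_star_algebra Uq) : Prop := {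
  Delta_E : forall i, tensor_eq (Delta H (Uq_E i)) [:: (Uq_E i, 1); (Uq_K i, Uq_E i)];
  Delta_F : forall i, tensor_eq (Delta H (Uq_F i)) [:: (Uq_F i, Uq_KV i); (1, Uq_F i)];
  Delta_K : forall i, tensor_eq (Delta H (Uq_K i)) [:: (Uq_K i, Uq_K i)];
  antipode_E : forall i, antipode H (Uq_E i) = - (Uq_KV i * Uq_E i);
  antipode_F : forall i, antipode H (Uq_F i) = - (Uq_F i * Uq_K i);
  antipode_K : forall i, antipode H (Uq_K i) = Uq_KV i;
  counit_E : forall i, counit H (Uq_E i) = 0;
  counit_F : forall i, counit H (Uq_F i) = 0;
  counit_K : forall i, counit H (Uq_K i) = 1;
  hstar_E : forall i, hstar H (Uq_E i)
    = if is_last i then - (Uq_K i * Uq_F i) else Uq_K i * Uq_F i;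
  hstar_F : forall i, hstar H (Uq_F i)
    = if is_last i then - (Uq_E i * Uq_KV i) else Uq_E i * Uq_KV i;
  hstar_K : forall i, hstar H (Uq_K i) = Uq_K i;
  hstar_KV : forall i, hstar H (Uq_KV i) = Uq_KV i }.

End QuantumGroup.

Section FunctionAlgebra.
Variables (R : realType) (n : nat) (q : R).
Local Notation C := R[i].

Inductive FU_gen := Fz of 'I_n | Fzs of 'I_n | Ff0.

Local Notation z i := (TGen (Fz i) : term C FU_gen).
Local Notation zs i := (TGen (Fzs i) : term C FU_gen).
Local Notation f0 := (TGen Ff0 : term C FU_gen).
Local Notation cst x := (TCst (x%R)%:C : term C FU_gen).

(* The algebra underlying a *-algebra presented by *-generators is generated by
   these and their adjoints, subject to the relations and their adjoints; of the
   given relations only the first needs its adjoint to be added. *)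
Inductive FU_rel : term C FU_gen -> term C FU_gen -> Prop :=
  | FU_zz (i j : 'I_n) : (i < j)%N -> FU_rel (z i * z j) (cst q * z j * z i)
  | FU_zszs (i j : 'I_n) : (i < j)%N -> FU_rel (zs j * zs i) (cst q * zs i * zs j)
  | FU_zsz (i j : 'I_n) : i != j -> FU_rel (zs i * z j) (cst q * z j * zs i)
  | FU_zszj j : FU_rel (zs j * z j)
      (cst (q ^+ 2) * z j * zs j
       + cst (1 - q ^+ 2)
         * (cst 1 - \big[@TAdd C FU_gen/cst 0]_(k < n | (j < k)%N) (z k * zs k)%PT))
  | FU_f0f0 : FU_rel (f0 * f0) f0
  | FU_zsf0 i : FU_rel (zs i * f0) (cst 0)
  | FU_f0z i : FU_rel (f0 * z i) (cst 0).

Definition FU_char (x : FU_gen) : C :=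
  match x with Fz i | Fzs i => (is_last i)%:R | Ff0 => 0 end.

Lemma FU_char_rel s t : FU_rel s t ->
  teval (FU_char : FU_gen -> C^o) s = teval (FU_char : FU_gen -> C^o) t.
Proof.
have lastN (i j : 'I_n) : i != j -> is_last i -> is_last j = false.
  move=> ij; rewrite /is_last => /eqP in_; apply/negP => /eqP jn.
  by move/eqP: ij; apply; apply/val_inj/eqP; rewrite -eqSS in_ jn.
have ne0 (i j : 'I_n) : i != j -> (is_last i)%:R * (is_last j)%:R = 0 :> C.
  by move=> /lastN; case: is_last => [->//|]; rewrite ?mulr0 ?mul0r.
case=> {s t} /=.
- move=> i j ij; have /ne0 e : i != j by rewrite neq_ltn ij.
  by rewrite -mulrA [_ * (is_last i)%:R]mulrC e mulr0.
- move=> i j ij; have /ne0 e : i != j by rewrite neq_ltn ij.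
  by rewrite -mulrA [(is_last j)%:R * _]mulrC e mulr0.
- by move=> i j /ne0 e; rewrite -mulrA [(is_last j)%:R * _]mulrC e mulr0.
- move=> j.
  have -> : teval (FU_char : FU_gen -> C^o)
      (\big[@TAdd C FU_gen/cst 0]_(k < n | (j < k)%N) (z k * zs k)%PT)
    = (~~ is_last j)%:R.
    rewrite (big_morph (teval (FU_char : FU_gen -> C^o))
      (op1 := +%R) (id1 := 0)) //=; last by rewrite scale0r.
    have n1 : n.-1.+1 = n by rewrite prednK // (leq_ltn_trans _ (ltn_ord j)).
    have last_le (k : 'I_n) : (k <= n.-1)%N by rewrite -ltnS n1.
    case: (boolP (is_last j)) => [jn|jn] /=.
      rewrite big_pred0 // => k; rewrite ltnNge.
      by move: jn; rewrite /is_last -[X in _ == X]n1 eqSS => /eqP->; rewrite last_le.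
    have n0 : (n.-1 < n)%N by rewrite n1.
    have ln : is_last (Ordinal n0) by rewrite /is_last /= n1.
    rewrite (bigD1 (Ordinal n0)) /=; last first.
      by rewrite ltn_neqAle last_le andbT -eqSS n1.
    rewrite ln mulr1 big1 ?addr0 // => k /andP[_ kn].
    by rewrite (lastN (Ordinal n0)) ?mulr0 // eq_sym.
  rewrite -!mulrA !scale1r.
  case: (is_last j) => /=; rewrite ?(mulr0, mulr1, subr0, scaler0, addr0, add0r).
    by rewrite -rmorphD addrC subrK.
  by rewrite mul1r subrr mulr0.
- by rewrite mulr0.
- by move=> i; rewrite mulr0 scale0r.
- by move=> i; rewrite mul0r scale0r.
Qed.

Definition FU_presentation : presentation C := Presentation FU_char_rel.

Definition FU : Type := palg FU_presentation.
HB.instance Definition _ := GRing.Algebra.on FU.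

Definition FU_z (i : 'I_n) : FU := @pg _ FU_presentation (Fz i).
Definition FU_zs (i : 'I_n) : FU := @pg _ FU_presentation (Fzs i).
Definition FU_f0 : FU := @pg _ FU_presentation Ff0.

Definition FU_gen_star (x : FU_gen) : FU_gen :=
  match x with Fz i => Fzs i | Fzs i => Fz i | Ff0 => Ff0 end.

Fixpoint FU_term_star (t : term C FU_gen) : term C FU_gen :=
  match t with
  | TGen x => TGen (FU_gen_star x)
  | TCst c => TCst (Num.conj c)
  | TAdd s t => TAdd (FU_term_star s) (FU_term_star t)
  | TMul s t => TMul (FU_term_star t) (FU_term_star s)
  end.

Definition FU_star (x : FU) : FU :=
  @pclass _ FU_presentation (FU_term_star (@prepr _ FU_presentation x)).

Lemma FU_term_star_cong s t : pcong FU_rel s t ->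
  @pclass _ FU_presentation (FU_term_star s)
  = @pclass _ FU_presentation (FU_term_star t).
Proof.
have conjR (x : R) : Num.conj x%:C = x%:C :> C.
  by apply/conj_Creal/complex_realP; exists x.
have st_sum (g : term C FU_gen -> term C FU_gen) (j : 'I_n) :
    (forall u v, g (u + v)%PT = (g u + g v)%PT) -> g (cst 0) = cst 0 ->
    @pclass _ FU_presentation
      (g (\big[@TAdd C FU_gen/cst 0]_(k < n | (j < k)%N) (z k * zs k)%PT))
    = \sum_(k < n | (j < k)%N) @pclass _ FU_presentation (g (z k * zs k)%PT).
  move=> gD g0; rewrite (big_morph (fun t => @pclass _ FU_presentation (g t))
    (op1 := +%R) (id1 := 0)) //=.
  - by move=> s' t' /=; rewrite gD pclass_add.
  - by rewrite g0 pclass_cst scale0r.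
have cA (a : C) (x : FU) : a%:A * x = a *: x by rewrite -scalerAl mul1r.
have Ac (a : C) (x : FU) : x * a%:A = a *: x by rewrite -scalerAr mulr1.
have Al (a : C) (x y : FU) : (a *: x) * y = a *: (x * y) by rewrite scalerAl.
have Ar (a : C) (x y : FU) : x * (a *: y) = a *: (x * y) by rewrite scalerAr.
pose cE := (pclass_add, pclass_mul, pclass_cst, cA, Ac, Al, Ar, scalerA).
have pr u v : FU_rel u v ->
    @pclass _ FU_presentation u = @pclass _ FU_presentation v.
  by move=> uv; apply: pclass_eq; exact: pc_rel.
elim=> {s t} /=;
  try by move=> *; rewrite ?cE; congruence.
- move=> _ _ [].
  + by move=> i j /FU_zszs/pr; rewrite /= !cE ?conjR.
  + by move=> i j /FU_zz/pr; rewrite /= !cE ?conjR.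
  + by move=> i j; rewrite eq_sym => /FU_zsz/pr; rewrite /= !cE ?conjR.
  + move=> j; have := pr _ _ (FU_zszj j); rewrite /= !cE ?conjR.
    rewrite (st_sum id) // st_sum //=; last by rewrite conjR.
    by rewrite rmorphN1 => ->.
  + by have := pr _ _ FU_f0f0; rewrite /= !cE.
  + by move=> i; have := pr _ _ (FU_f0z i); rewrite /= !cE ?conjR.
  + by move=> i; have := pr _ _ (FU_zsf0 i); rewrite /= !cE ?conjR.
- by move=> s t u; rewrite !cE addrA.
- by move=> s t; rewrite !cE addrC.
- by move=> s; rewrite !cE rmorph0 scale0r add0r.
- by move=> s; rewrite !cE rmorphN1 rmorph0 scaleN1r addNr scale0r.
- by move=> s t u; rewrite !cE mulrA.
- by move=> s; rewrite !cE rmorph1 scale1r.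
- by move=> s t u; rewrite !cE mulrDr.
- by move=> s t u; rewrite !cE mulrDl.
- by move=> a b; rewrite !cE rmorphD scalerDl.
- by move=> a b; rewrite !cE rmorphM mulrC.
Qed.

Lemma FU_star_class t :
  FU_star (@pclass _ FU_presentation t) = @pclass _ FU_presentation (FU_term_star t).
Proof. by apply: FU_term_star_cong; exact: (@prepr_class _ FU_presentation). Qed.

Local Notation U := (Uq n q).
Local Notation c x := ((x%R)%:C : C).
Local Notation rq := (Num.sqrt q).

(* The action on the [FU_zs i] is determined by [is_module_star_algebra]. *)
Record is_FU_module (H : hopf_star_algebra U) (act : U -> FU -> FU) : Prop := {
  FU_module_star_algebra : is_module_star_algebra H FU_star act;
  act_K_z : forall k i, ~~ is_last k -> act (Uq_K q k) (FU_z i)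
    = c (if i == k then q else if i == k.+1 :> nat then q^-1 else 1) *: FU_z i;
  act_F_zk : forall k i : 'I_n, i = k.+1 :> nat ->
    act (Uq_F q k) (FU_z k) = c rq *: FU_z i;
  act_F_z : forall k i, ~~ is_last k -> i != k -> act (Uq_F q k) (FU_z i) = 0;
  act_E_zk : forall k i : 'I_n, i = k.+1 :> nat ->
    act (Uq_E q k) (FU_z i) = c rq^-1 *: FU_z k;
  act_E_z : forall k i : 'I_n, ~~ is_last k -> i != k.+1 :> nat ->
    act (Uq_E q k) (FU_z i) = 0;
  act_Kn_z : forall k i, is_last k -> act (Uq_K q k) (FU_z i)
    = c (if i == k then q ^+ 2 else q) *: FU_z i;
  act_Fn_z : forall k i, is_last k -> act (Uq_F q k) (FU_z i)
    = if i == k then (c rq)%:A else 0;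
  act_En_z : forall k i, is_last k -> act (Uq_E q k) (FU_z i)
    = - c rq *: (FU_z k * FU_z i);
  act_K_f0 : forall k, act (Uq_K q k) FU_f0 = FU_f0;
  act_E_f0 : forall k, ~~ is_last k -> act (Uq_E q k) FU_f0 = 0;
  act_F_f0 : forall k, ~~ is_last k -> act (Uq_F q k) FU_f0 = 0;
  act_Fn_f0 : forall k, is_last k -> act (Uq_F q k) FU_f0
    = - c (rq / (q ^- 2 - 1)) *: (FU_f0 * FU_zs k);
  act_En_f0 : forall k, is_last k -> act (Uq_E q k) FU_f0
    = - c (rq / (1 - q ^+ 2)) *: (FU_z k * FU_f0) }.

Definition multi : Type := {ffun 'I_n -> nat}.
HB.instance Definition _ := Choice.on multi.

Definition multi0 : multi := [ffun=> 0%N].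

Definition zpow (m : multi) : FU := \prod_(i <- rev (enum 'I_n)) FU_z i ^+ m i.
Definition zspow (m : multi) : FU := \prod_(i <- enum 'I_n) FU_zs i ^+ m i.

Definition holo : {pred FU} := fun f =>
  `[< forall S : {pred FU}, subalg_closed S -> (forall i, FU_z i \in S) -> f \in S >].

Lemma holo_submod_closed : submod_closed holo.
Proof.
split.
  apply/asboolP => S [S1 Slin _] _.
  by move: (Slin (-1) 1 1 S1 S1); rewrite scaleN1r addNr.
move=> a u v /asboolP uP /asboolP vP; apply/asboolP => S Salg Sz.
by case: (Salg) => _ + _; apply; [exact: uP|exact: vP].
Qed.

HB.instance Definition _ := GRing.isSubmodClosed.Build C FU holo holo_submod_closed.

Record Cz : Type := MkCz { Cz_val :> FU; _ : Cz_val \in holo }.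
HB.instance Definition _ := [isSub for Cz_val].
HB.instance Definition _ := [Choice of Cz by <:].
HB.instance Definition _ := [SubChoice_isSubLmodule of Cz by <:].

Definition finite_functions : set FU :=
  [set f | exists s : seq (FU * FU), f = \sum_(p <- s) p.1 * FU_f0 * p.2].

(* The conditions determine the space up to a unique isomorphism. *)
Record fock_space := FockSpace {
  fock_carrier :> lmodType C;
  fock_act : FU -> fock_carrier -> fock_carrier;
  vac : fock_carrier;
  fock_action : is_algebra_action fock_act;
  fock_zs_vac : forall i, fock_act (FU_zs i) vac = 0;
  fock_f0 : forall m, fock_act FU_f0 (fock_act (zpow m) vac)
    = if m == multi0 then vac else 0;
  fock_span : forall v, exists (s : seq multi) (a : multi -> C),
    v = \sum_(m <- s) a m *: fock_act (zpow m) vac;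
  fock_free : forall (s : seq multi) (a : multi -> C), uniq s ->
    \sum_(m <- s) a m *: fock_act (zpow m) vac = 0 ->
    forall m, m \in s -> a m = 0 }.

Section Integral.
Variables (H : fock_space) (alpha : R).
Local Notation op := (@fock_act H).

Definition FU_y (i : 'I_n) : FU := 1 - \sum_(k < n | (i <= k)%N) FU_z k * FU_zs k.

Definition is_partn (k : multi) : bool :=
  [forall i : 'I_n, forall j : 'I_n, (i <= j)%N ==> (k j <= k i)%N].

Definition partn : Type := {k : multi | is_partn k}.
HB.instance Definition _ := Choice.on partn.

Definition spec_point (k : partn) : 'rV[R]_n := \row_i q ^+ (2 * val k i).

Definition y_spec : set 'rV[R]_n := range spec_point.

(* [G] is the operator g(y_1, ..., y_n) on H, by joint functional calculus; only
   the values of [g] on [y_spec] matter. *)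
Definition fun_of_y (g : 'rV[R]_n -> C) (G : H -> H) : Prop :=
  linear G /\ forall v lam, y_spec lam ->
    (forall i, op (FU_y i) v = c (lam 0 i) *: v) -> G v = g lam *: v.

Definition decomposition (f : FU) (g : multi * multi -> 'rV[R]_n -> C) : Prop :=
  exists (s : seq (multi * multi)) (G : multi * multi -> H -> H),
  [/\ uniq s,
      forall p, p \in s -> forall i, (p.1 i * p.2 i)%N = 0%N,
      forall p, p \notin s -> forall lam, g p lam = 0,
      forall p, p \in s -> fun_of_y (g p) (G p)
    & forall v, op f v
        = \sum_(p <- s) op (zpow p.1) (G p (op (zspow p.2) v))].

(* The coefficient f_(0,0) of the decomposition; it is unique on [y_spec] and
   arbitrary elsewhere. *)
Definition coef00 (f : FU) : 'rV[R]_n -> C :=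
  xget (fun=> 0) [set h | exists2 g, decomposition f g & h = g (multi0, multi0)].

(* Sums of absolutely summable families; [csum] is only used on such. *)
Definition rsum (I : choiceType) (x : I -> R) : R :=
  fine (esum setT (EFin \o x)^\+ - esum setT (EFin \o x)^\-)%E.

Definition csum (I : choiceType) (x : I -> C) : C :=
  (rsum (fun i => complex.Re (x i))) +i* (rsum (fun i => complex.Im (x i))).

Definition qpoch (a b : R) (m : nat) : R := \prod_(j < m) (1 - a * b ^+ j).

Definition FU_weight (k : partn) : R :=
  \prod_(i < n) (if i == 0%N :> nat then q `^ (2 * (val k i)%:R * (alpha + 1))
                 else q ^+ (2 * val k i)).

Definition FU_integral (f : FU) : C :=
  c (qpoch (q `^ (2 * alpha + 2)) (q ^+ 2) n)
  * csum (fun k : partn => coef00 f (spec_point k) * c (FU_weight k)).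

Definition FU_inner (f g : FU) : C := FU_integral (FU_star g * f).

(* A completion of the finite functions, with the inclusion [L2_emb] of the whole
   of F(U_n)_q; it is unique up to a unique isometry. *)
Record L2_space := L2Space {
  L2_carrier :> completeNormedModType C;
  L2_dot : {dot L2_carrier for @Num.conj C};
  L2_norm : forall x, `|x| ^+ 2 = L2_dot x x;
  L2_emb : FU -> L2_carrier;
  L2_emb_linear : linear L2_emb;
  L2_emb_dot : forall f g, L2_dot (L2_emb f) (L2_emb g) = FU_inner f g;
  L2_dense : closure (L2_emb @` finite_functions) = setT }.

Section Toeplitz.
Variable L : L2_space.

Definition is_orth_proj (V : set L) (x p : L) : Prop :=
  V p /\ forall v, V v -> L2_dot L (x - p) v = 0.

Definition orth_proj (V : set L) (x : L) : L := xget 0 (is_orth_proj V x).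

Definition bergman_proj : L -> L :=
  orth_proj (closure [set L2_emb L (psi : FU) | psi in [set: Cz]]).

(* The projection of [f * psi] is a polynomial, and [L2_emb] is injective. *)
Definition toeplitz (f : FU) (psi : Cz) : Cz :=
  xget 0 [set phi : Cz |
    L2_emb L (phi : FU) = bergman_proj (L2_emb L (f * (psi : FU)))].

End Toeplitz.
End Integral.

Record is_twisted_action (act : U -> FU -> FU) (alpha : R)
    (pi : U -> Cz -> Cz) : Prop := {
  twisted_action : is_algebra_action pi;
  pi_E : forall j psi, ~~ is_last j ->
    pi (Uq_E q j) psi = act (Uq_E q j) psi :> FU;
  pi_F : forall j psi, ~~ is_last j ->
    pi (Uq_F q j) psi = act (Uq_F q j) psi :> FU;
  pi_K : forall j psi, ~~ is_last j ->
    pi (Uq_K q j) psi = act (Uq_K q j) psi :> FU;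
  pi_KV : forall j psi, ~~ is_last j ->
    pi (Uq_KV q j) psi = act (Uq_KV q j) psi :> FU;
  pi_En : forall j psi, is_last j -> pi (Uq_E q j) psi
    = act (Uq_E q j) psi
      - c (rq * ((1 - q `^ (2 * alpha + 2 * n%:R + 2)) / (1 - q ^+ 2)))
        *: (act (Uq_K q j) psi * FU_z j) :> FU;
  pi_Fn : forall j psi, is_last j -> pi (Uq_F q j) psi
    = c (q `^ (- (alpha + n%:R + 1))) *: act (Uq_F q j) psi :> FU;
  pi_Kn : forall j psi, is_last j -> pi (Uq_K q j) psi
    = c (q `^ (alpha + n%:R + 1)) *: act (Uq_K q j) psi :> FU;
  pi_KVn : forall j psi, is_last j -> pi (Uq_KV q j) psi
    = c (q `^ (- (alpha + n%:R + 1))) *: act (Uq_KV q j) psi :> FU }.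

End FunctionAlgebra.

(* Main.v *)
Require Import Defs.
From HB Require Import structures.
From mathcomp Require Import all_boot all_order all_algebra.
From mathcomp Require Import complex.
From mathcomp Require Import all_classical all_reals topology normedtype.
From mathcomp Require Import sequences numfun ereal fsbigop esum exp.
From mathcomp Require Import ring lra zify.
From mathcomp Require finmap.

(** Toeplitz operators are equivariant because the Bergman projection is, and the
    projection is equivariant because adjoints of generators are again given by the
    quantum group.

    The formulas of the twisted action make sense on all functions and not only on
    polynomials ([twE], [twF], [twK], [twKV]). With them the product of functions is
    equivariant ([twEM], [twFM], [twKM], [twKVM]), so for a generator [xi] the function
    [act xi f * psi] is a sum of terms [xi' (f * S(xi'') psi)] over the coproduct of
    [xi]. If the projection carries the extended action to the twisted action on
    polynomials, projecting this identity gives the theorem for [xi]. The projection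
    of a function is determined by its scalar products with polynomials, so what is
    needed is that each extended generator has its adjoint, up to a sign, in the
    extended action ([inner_twE_twF], [inner_twF], [inner_twK], [inner_twKV]). The case
    of [F] follows from that of [E] by Hermitian symmetry. Sums and products of
    elements are dealt with by [equivariant_lin] and [equivariant_mul].

    The adjoints are computed by writing the integral as a trace. In the basis of
    monomials of the Fock space the coefficient of [f] at (0, 0) is the diagonal of the
    matrix of [f] ([coef00_diag]), so the integral is the trace of [f] against a
    diagonal weight. Words in the generators span the algebra and act as shifts with
    coefficients between 0 and 1 ([word_fockb]); for them the trace is a series of
    nonnegative terms, and moving a letter from one end of a word to the other
    multiplies it by an explicit factor ([wsum_cycle_z], [wsum_cycle_zs]).

    For the last index [k], the action of [E k] is a twisted commutator with [z k]
    ([act_E_last]), and the factor from the cyclic property is the one that the twist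
    compensates ([inner_twE]). For the other indices no element of the algebra
    implements [E k], but after multiplication by [y l], with [l] the successor of [k],
    it becomes a twisted commutator with [z k * zs l] ([E_word]). The weight divided by
    the eigenvalue of [y l] is still summable and the two terms of the commutator have
    the same trace, so the integral of [E k f] vanishes ([integral_act_E]). *)

Set Implicit Arguments.
Unset Strict Implicit.
Unset Printing Implicit Defensive.

Import Order.TTheory GRing.Theory Num.Theory.

Local Open Scope classical_set_scope.
Local Open Scope ring_scope.
Local Open Scope complex_scope.

(** * Words span the function algebra *)

Section Words.
Variables (R : realType) (n : nat) (q : R).
Local Notation C := R[i].
Local Notation FU := (FU n q).
Local Notation gen := (FU_gen n).
Local Notation z := (@FU_z R n q).
Local Notation zs := (@FU_zs R n q).
Local Notation f0 := (@FU_f0 R n q).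
Local Notation FU_class := (@pclass _ (FU_presentation n q)).

Definition FU_letter (x : gen) : FU := @pg _ (FU_presentation n q) x.
Definition word (w : seq gen) : FU := \prod_(x <- w) FU_letter x.

Lemma word_nil : word [::] = 1. Proof. by rewrite /word big_nil. Qed.
Lemma word_cons x w : word (x :: w) = FU_letter x * word w.
Proof. by rewrite /word big_cons. Qed.
Lemma word_cat u w : word (u ++ w) = word u * word w.
Proof. by rewrite /word big_cat. Qed.

(** A product of linear combinations of words is one again, and this replaces any
    normal form of the presented algebra: everything linear is checked on words. *)
Lemma FU_linear_ind (P : FU -> Prop) : (forall w, P (word w)) ->
  (forall a f g, P f -> P g -> P (a *: f + g)) -> forall f, P f.
Proof.
move=> Pw Plin.
have P0 : P 0 by rewrite -(addNr (word [::])) -scaleN1r; exact: Plin.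
have PZ a f : P f -> P (a *: f) by rewrite -[_ *: _]addr0 => Pf; exact: Plin.
have PD f g : P f -> P g -> P (f + g).
  by move=> Pf Pg; rewrite -[f]scale1r; exact: Plin.
have span (f : FU) : exists s : seq (C * seq gen),
    f = \sum_(p <- s) p.1 *: word p.2.
  elim/palg_ind: f; elim=> [x|c|s [S eS] t [T eT]|s [S eS] t [T eT]].
  - by exists [:: (1, [:: x])]; rewrite big_seq1 /= /word big_seq1 scale1r.
  - by exists [:: (c, [::])]; rewrite big_seq1 /= word_nil; exact: pclass_cst.
  - by exists (S ++ T); rewrite big_cat -eS -eT; exact: pclass_add.
  - exists [seq (u.1 * v.1, u.2 ++ v.2) | u <- S, v <- T].
    rewrite [LHS]pclass_mul eS eT big_allpairs_dep mulr_suml; apply: eq_bigr => u _.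
    rewrite mulr_sumr; apply: eq_bigr => v _ /=.
    by rewrite word_cat -scalerAl -scalerAr scalerA.
move=> f; have [s ->] := span f.
by elim: s => [|p s IH]; rewrite ?big_nil ?big_cons //; apply: Plin.
Qed.

Lemma FU_presented s t : FU_rel q s t ->
  FU_class s = FU_class t.
Proof. by move=> st; apply: pclass_eq; exact: pc_rel. Qed.

Local Notation c x := ((x)%:C : C).

Lemma z_zE (i j : 'I_n) : (i < j)%N -> z i * z j = c q *: (z j * z i).
Proof.
move=> ij; have := FU_presented (FU_zz q ij).
by rewrite !(pclass_mul, pclass_cst) mulr_algl -scalerAl.
Qed.

Lemma zs_zsE (i j : 'I_n) : (i < j)%N -> zs j * zs i = c q *: (zs i * zs j).
Proof.
move=> ij; have := FU_presented (FU_zszs q ij).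
by rewrite !(pclass_mul, pclass_cst) mulr_algl -scalerAl.
Qed.

Lemma zs_zE (i j : 'I_n) : i != j -> zs i * z j = c q *: (z j * zs i).
Proof.
move=> ij; have := FU_presented (FU_zsz q ij).
by rewrite !(pclass_mul, pclass_cst) mulr_algl -scalerAl.
Qed.

Lemma zs_z_diag (j : 'I_n) : zs j * z j = c (q ^+ 2) *: (z j * zs j)
  + c (1 - q ^+ 2) *: (1 - \sum_(k < n | (j < k)%N) z k * zs k).
Proof.
have := FU_presented (FU_zszj q j).
rewrite !(pclass_mul, pclass_cst, pclass_add) !mulr_algl -scalerAl => ->.
rewrite (big_morph FU_class
  (op1 := +%R) (id1 := 0)) //=; last by move=> s t; exact: pclass_add.
rewrite scale1r scaleN1r; congr (_ + _ *: (_ - _)).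
by apply: eq_bigr => k _; rewrite pclass_mul.
Qed.

Lemma zs_f0E i : zs i * f0 = 0.
Proof.
by have := FU_presented (FU_zsf0 q i); rewrite !(pclass_mul, pclass_cst) scale0r.
Qed.

Lemma f0_zE i : f0 * z i = 0.
Proof.
by have := FU_presented (FU_f0z q i); rewrite !(pclass_mul, pclass_cst) scale0r.
Qed.

Local Notation star := (@FU_star R n q).

Lemma star_letter x : star (FU_letter x) = FU_letter (FU_gen_star x).
Proof. exact: FU_star_class. Qed.

Lemma starM f g : star (f * g) = star g * star f.
Proof.
elim/palg_ind: f => s; elim/palg_ind: g => t.
by rewrite -pclass_mul !FU_star_class /= pclass_mul.
Qed.

Lemma starA a : star a%:A = (Num.conj a)%:A.
Proof. by rewrite -pclass_cst FU_star_class /= pclass_cst. Qed.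

Lemma starZ a f : star (a *: f) = Num.conj a *: star f.
Proof. by rewrite -mulr_algl starM starA -scalerAr mulr1. Qed.

Lemma starZc (x : R) f : star (c x *: f) = c x *: star f.
Proof.
rewrite starZ; congr (_ *: _).
by apply/conj_Creal/complex_realP; exists x.
Qed.

Lemma star1 : star 1 = 1.
Proof. by rewrite -[1]scale1r starA rmorph1. Qed.

Lemma star0 : star 0 = 0.
Proof. by rewrite -(scale0r (1:FU)) starA rmorph0. Qed.

End Words.

(** * The Fock representation in its monomial basis *)

Section MultiIndices.
Variable n : nat.
Local Notation multi := (multi n).

Definition addm (m k : multi) : multi := [ffun i => (m i + k i)%N].
Definition subm (m k : multi) : multi := [ffun i => (m i - k i)%N].
Definition unitm (i : 'I_n) : multi := [ffun j => nat_of_bool (j == i)].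
Definition mle (m k : multi) : bool := [forall i, (m i <= k i)%N].

Definition msum_gt (i : 'I_n) (m : multi) : nat := \sum_(k < n | (i < k)%N) m k.
Definition msum_ge (i : 'I_n) (m : multi) : nat := \sum_(k < n | (i <= k)%N) m k.

Lemma msum_geE i m : msum_ge i m = (m i + msum_gt i m)%N.
Proof.
rewrite /msum_ge (bigD1 i) //=; congr addn; apply: eq_bigl => k.
by rewrite ltn_neqAle eq_sym andbC.
Qed.

Lemma addm0 m : addm m (multi0 n) = m.
Proof. by apply/ffunP => i; rewrite !ffunE addn0. Qed.

Lemma subm0 m : subm m (multi0 n) = m.
Proof. by apply/ffunP => i; rewrite !ffunE subn0. Qed.

Lemma addmK m k : subm (addm m k) k = m.
Proof. by apply/ffunP => i; rewrite !ffunE addnK. Qed.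

Lemma submK m k : mle k m -> addm (subm m k) k = m.
Proof. by move=> /forallP km; apply/ffunP => i; rewrite !ffunE subnK. Qed.

Lemma addIm k : injective (addm^~ k).
Proof. by move=> m l /(congr1 (subm^~ k)); rewrite !addmK. Qed.

Lemma mle_addl m k : mle k (addm m k).
Proof. by apply/forallP => i; rewrite ffunE leq_addl. Qed.

Lemma mle_unitm i m : mle (unitm i) m = (0 < m i)%N.
Proof.
apply/forallP/idP => [/(_ i)|m0 j]; rewrite ffunE ?eqxx //.
by case: eqP => // ->.
Qed.

End MultiIndices.
Arguments unitm {n}.

Section Fock.
Variables (R : realType) (n : nat) (q : R).
Hypotheses (q_gt0 : 0 < q) (q_lt1 : q < 1).
Local Notation C := R[i].
Local Notation FU := (FU n q).
Local Notation gen := (FU_gen n).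
Local Notation z := (@FU_z R n q).
Local Notation zs := (@FU_zs R n q).
Local Notation f0 := (@FU_f0 R n q).
Local Notation multi := (multi n).
Local Notation c x := ((x)%:C : C).
Local Notation word := (@word R n q).
Variable H : fock_space n q.
Local Notation op := (@fock_act R n q H).
Local Notation vac := (vac H).

Lemma zs_zX (i j : 'I_n) m : i != j -> zs i * z j ^+ m = c (q ^+ m) *: (z j ^+ m * zs i).
Proof.
move=> ij; elim: m => [|m IH]; first by rewrite mul1r mulr1 scale1r.
rewrite exprS mulrA zs_zE // -scalerAl -(mulrA (z j) (zs i)) IH -scalerAr scalerA mulrA.
by rewrite -rmorphM -(exprS q).
Qed.

Lemma z_zX (i j : 'I_n) m : (i < j)%N -> z i * z j ^+ m = c (q ^+ m) *: (z j ^+ m * z i).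
Proof.
move=> ij; elim: m => [|m IH]; first by rewrite mul1r mulr1 scale1r.
rewrite exprS mulrA z_zE // -scalerAl -(mulrA (z j) (z i)) IH -scalerAr scalerA mulrA.
by rewrite -rmorphM -(exprS q).
Qed.

(** [z i] moves to the right past the powers of the [z k] with [k > i], each
    exchange costing a factor [q], and joins the power of [z i]. *)
Lemma z_mul_prod (i : 'I_n) (s : seq 'I_n) (m : multi) : i \in s ->
  pairwise (fun j k : 'I_n => (k < j)%N) s ->
  z i * \prod_(k <- s) z k ^+ m k
  = c (q ^+ \sum_(k <- s | (i < k)%N) m k)
    *: \prod_(k <- s) z k ^+ addm m (unitm i) k.
Proof.
elim: s => [//|k s IH]; rewrite inE => i_ks; rewrite pairwise_cons => /andP[ks ps].
rewrite !big_cons; case: (eqVneq i k) i_ks => [ik _|ik /= i_s].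
  rewrite -ik ltnn (_ : (\sum_(j <- s | (i < j)%N) m j)%N = 0%N); last first.
    rewrite big1_seq // => j /andP[ij /(allP ks)]; rewrite -ik => ji.
    by move: (ltn_trans ij ji); rewrite ltnn.
  rewrite scale1r.
  rewrite !ffunE eqxx addn1 exprS mulrA; congr (_ * _).
  apply: eq_big_seq => j /(allP ks) jk; rewrite !ffunE (_ : j == i = false) ?addn0 //.
  by apply/negP => /eqP ji; move: jk; rewrite ji ik ltnn.
have ltik : (i < k)%N := allP ks _ i_s.
rewrite ltik !ffunE eq_sym (negPf ik) addn0 mulrA z_zX // -scalerAl -mulrA IH //.
by rewrite -scalerAr scalerA -rmorphM exprD.
Qed.

Lemma enum_rev_decreasing : pairwise (fun j k : 'I_n => (k < j)%N) (rev (enum 'I_n)).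
Proof.
rewrite -sorted_pairwise; last by move=> a b d ab bd; exact: ltn_trans bd ab.
rewrite rev_sorted -(sorted_map (e' := ltn) (f := val)).
by rewrite val_enum_ord; exact: iota_ltn_sorted.
Qed.

Lemma sum_enum_rev (i : 'I_n) (m : multi) :
  (\sum_(k <- rev (enum 'I_n) | (i < k)%N) m k = msum_gt i m)%N.
Proof. by rewrite (perm_big (enum 'I_n)) ?perm_rev //= big_enum_cond. Qed.

Lemma z_zpow i m :
  z i * zpow q m = c (q ^+ msum_gt i m) *: zpow q (addm m (unitm i)).
Proof.
rewrite /zpow z_mul_prod ?sum_enum_rev //; first by rewrite mem_rev mem_enum.
exact: enum_rev_decreasing.
Qed.

Lemma zpow0 : zpow q (multi0 n) = 1.
Proof. by rewrite /zpow big1 // => i _; rewrite ffunE. Qed.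

Lemma op_linearv f : linear (op f).
Proof. by case: (fock_action H). Qed.

HB.instance Definition _ f := GRing.isLinear.Build C H H _ (op f) (op_linearv f).

Lemma op_linear v : linear (op^~ v).
Proof. by case: (fock_action H). Qed.

Lemma op1 v : op 1 v = v.
Proof. by case: (fock_action H). Qed.

Lemma opM f g v : op (f * g) v = op f (op g v).
Proof. by case: (fock_action H). Qed.

Lemma opD f g v : op (f + g) v = op f v + op g v.
Proof. by have := op_linear v 1 f g; rewrite !scale1r. Qed.

Lemma op0 v : op 0 v = 0.
Proof. by apply: (addrI (op 0 v)); rewrite -opD !addr0. Qed.

Lemma opZ a f v : op (a *: f) v = a *: op f v.
Proof. exact: (scalable_linear (op_linear v)). Qed.

Lemma opN f v : op (- f) v = - op f v.
Proof. by rewrite -scaleN1r opZ scaleN1r. Qed.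

Lemma op_sum I (r : seq I) (P : pred I) (F : I -> FU) v :
  op (\sum_(i <- r | P i) F i) v = \sum_(i <- r | P i) op (F i) v.
Proof.
by rewrite (big_morph (op^~ v) (id1 := 0) (op1 := +%R)) ?op0 // => f g; exact: opD.
Qed.

Definition fockb (m : multi) : H := op (zpow q m) vac.
Local Notation Z := fockb.

Lemma z_fockb i m : op (z i) (Z m) = c (q ^+ msum_gt i m) *: Z (addm m (unitm i)).
Proof. by rewrite /Z -opM z_zpow opZ. Qed.

Lemma zs_prod_vac (i : 'I_n) (s : seq 'I_n) (m : multi) : i \notin s ->
  op (zs i * \prod_(k <- s) z k ^+ m k) vac = 0.
Proof.
elim: s => [_|k s IH]; first by rewrite big_nil mulr1 fock_zs_vac.
rewrite inE negb_or => /andP[ik i_s]; rewrite big_cons mulrA zs_zX //.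
by rewrite -scalerAl opZ -mulrA opM IH // linear0 scaler0.
Qed.

(** Once every [zs k] with [k >= i] kills [v], the pair [zs i], [z i] is a
    q-oscillator on [v]: the sum in the relation for [zs i * z i] contributes
    nothing. *)
Lemma zs_zX_vac (i : 'I_n) v m : (forall k : 'I_n, (i <= k)%N -> op (zs k) v = 0) ->
  op (zs i * z i ^+ m) v = c (1 - q ^+ (2 * m)) *: op (z i ^+ m.-1) v.
Proof.
move=> vac_v; elim: m => [|m IH].
  by rewrite mulr1 vac_v // muln0 expr0 subrr scale0r.
rewrite exprS mulrA zs_z_diag mulrDl opD -scalerAl opZ.
rewrite -(mulrA (z i) (zs i)) (opM (z i)) IH.
rewrite -scalerAl opZ mulrBl mul1r opD opN mulr_suml op_sum big1; last first.
  move=> k ik; rewrite -mulrA opM zs_zX; last by rewrite neq_ltn ik orbT.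
  by rewrite opZ opM vac_v ?linear0 ?scaler0 ?linear0 // ltnW.
rewrite subr0 linearZ /= scalerA -rmorphM -opM /=.
case: m IH => [|m] _ /=.
  by rewrite muln0 expr0 subrr mulr0 scale0r add0r muln1.
rewrite -exprS -scalerDl -rmorphD; congr (c _ *: _).
by rewrite (_ : 2 * m.+2 = 2 + 2 * m.+1)%N ?exprD; [ring|rewrite !mulnS].
Qed.

(** [zs i] moves past the higher powers as [z i] does, and then lowers the power of
    [z i], because it sees the product of the remaining lower powers as a vacuum. *)
Lemma zs_mul_prod (i : 'I_n) (s : seq 'I_n) (m : multi) : i \in s ->
  pairwise (fun j k : 'I_n => (k < j)%N) s ->
  op (zs i * \prod_(k <- s) z k ^+ m k) vac
  = c (q ^+ (\sum_(k <- s | (i < k)%N) m k) * (1 - q ^+ (2 * m i)))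
    *: op (\prod_(k <- s) z k ^+ subm m (unitm i) k) vac.
Proof.
elim: s => [//|k s IH]; rewrite inE => i_ks; rewrite pairwise_cons => /andP[ks ps].
rewrite !big_cons; case: (eqVneq i k) i_ks => [ik _|ik /= i_s].
  have lts j : j \in s -> (j < i)%N by move/(allP ks); rewrite ik.
  rewrite -ik ltnn (_ : (\sum_(j <- s | (i < j)%N) m j)%N = 0%N); last first.
    rewrite big1_seq // => j /andP[ij /lts ji].
    by move: (ltn_trans ij ji); rewrite ltnn.
  rewrite mul1r.
  rewrite !ffunE eqxx subn1 mulrA opM zs_zX_vac; last first.
    move=> j ij; rewrite -opM zs_prod_vac //.
    by apply/negP => /lts; rewrite ltnNge ij.
  rewrite opM; congr (_ *: op _ (op _ _)).
  apply: eq_big_seq => j /lts ji; rewrite !ffunE (_ : j == i = false) ?subn0 //.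
  by apply/negP => /eqP e; rewrite e ltnn in ji.
have ltik : (i < k)%N := allP ks _ i_s.
rewrite ltik !ffunE eq_sym (negPf ik) subn0 mulrA zs_zX //.
rewrite -scalerAl opZ -(mulrA _ (zs i)) !(opM (z k ^+ _)) IH // linearZ scalerA.
rewrite -rmorphM /=.
by rewrite exprD !mulrA.
Qed.

Lemma zs_fockb i m : op (zs i) (Z m)
  = c (q ^+ msum_gt i m * (1 - q ^+ (2 * m i))) *: Z (subm m (unitm i)).
Proof.
rewrite /Z -opM /zpow zs_mul_prod ?sum_enum_rev //; first by rewrite mem_rev mem_enum.
exact: enum_rev_decreasing.
Qed.

Lemma f0_fockb m : op f0 (Z m) = c (m == multi0 n)%:R *: Z m.
Proof.
rewrite /Z fock_f0; case: eqP => [->|_]; rewrite ?scale0r //.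
by rewrite scale1r zpow0 op1.
Qed.

(** * Words as weighted shifts of the basis *)

Definition gen_coef (x : gen) (m : multi) : R :=
  match x with
  | Fz i => q ^+ msum_gt i m
  | Fzs i => q ^+ msum_gt i m * (1 - q ^+ (2 * m i))
  | Ff0 => (m == multi0 n)%:R
  end.

(** The subtraction in the case of [Fzs] is truncated; it is harmless, as
    [gen_coef] vanishes when the exponent is already zero. *)
Definition gen_pos (x : gen) (m : multi) : multi :=
  match x with
  | Fz i => addm m (unitm i)
  | Fzs i => subm m (unitm i)
  | Ff0 => m
  end.

Fixpoint word_pos (w : seq gen) (m : multi) : multi :=
  if w is x :: w' then gen_pos x (word_pos w' m) else m.

Fixpoint word_coef (w : seq gen) (m : multi) : R :=
  if w is x :: w' then gen_coef x (word_pos w' m) * word_coef w' m else 1.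

Lemma gen_fockb x m : op (FU_letter q x) (Z m) = c (gen_coef x m) *: Z (gen_pos x m).
Proof. by case: x => [i|i|] /=; [exact: z_fockb|exact: zs_fockb|exact: f0_fockb]. Qed.

Lemma word_fockb w m : op (word w) (Z m) = c (word_coef w m) *: Z (word_pos w m).
Proof.
elim: w => [|x w IH] /=; first by rewrite word_nil op1 scale1r.
by rewrite word_cons opM IH linearZ /= gen_fockb scalerA -rmorphM mulrC.
Qed.

Lemma word_pos_cat u w m : word_pos (u ++ w) m = word_pos u (word_pos w m).
Proof. by elim: u => //= x u ->. Qed.

Lemma word_coef_cat u w m :
  word_coef (u ++ w) m = word_coef u (word_pos w m) * word_coef w m.
Proof.
by elim: u => [|x u IH] /=; rewrite ?mul1r // IH word_pos_cat mulrA.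
Qed.

Lemma exp_itv k : 0 <= q ^+ k <= 1.
Proof. by rewrite exprn_ge0 ?exprn_ile1 // ltW. Qed.

Lemma gen_coef_itv x m : 0 <= gen_coef x m <= 1.
Proof.
case: x => [i|i|] /=; first exact: exp_itv.
  have /andP[a0 a1] := exp_itv (msum_gt i m).
  have /andP[b0 b1] := exp_itv (2 * m i).
  by rewrite mulr_ge0 ?mulr_ile1 //; lra.
by case: eqP; rewrite /= ?lexx ler01.
Qed.

Lemma word_coef_itv w m : 0 <= word_coef w m <= 1.
Proof.
elim: w => [|x w /andP[w0 w1]] /=; first by rewrite ler01 lexx.
by have /andP[x0 x1] := gen_coef_itv x (word_pos w m); rewrite mulr_ge0 ?mulr_ile1.
Qed.

Lemma word_coef_ge0 w m : 0 <= word_coef w m.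
Proof. by case/andP: (word_coef_itv w m). Qed.

Definition is_z (i : 'I_n) (x : gen) : bool := if x is Fz j then j == i else false.
Definition is_zs (i : 'I_n) (x : gen) : bool := if x is Fzs j then j == i else false.

Definition word_up (w : seq gen) : multi := [ffun i => count (is_z i) w].
Definition word_down (w : seq gen) : multi := [ffun i => count (is_zs i) w].

Lemma gen_coef_zs_neq0 i m : gen_coef (Fzs i) m != 0 -> mle (unitm i) m.
Proof.
rewrite mle_unitm /= lt0n; apply: contra => /eqP ->.
by rewrite muln0 expr0 subrr mulr0.
Qed.

(** Unless a word kills the basis vector, it shifts the exponent by the number of
    its letters [z i] minus the number of its letters [zs i]. *)
Lemma word_balance w m : word_coef w m != 0 ->
  addm (word_pos w m) (word_down w) = addm m (word_up w).
Proof.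
(* [lia] would otherwise make the lemma depend on these hypotheses. *)
clear q_gt0 q_lt1; elim: w => [_|x w IH] /=; first by apply/ffunP => i; rewrite !ffunE.
rewrite mulf_eq0 negb_or => /andP[x0 /IH e].
apply/ffunP => i; move/ffunP/(_ i): e.
case: x x0 => [j _|j /gen_coef_zs_neq0|_] /=; rewrite !ffunE /=.
- by rewrite (eq_sym j); case: eqP => _ e; lia.
- by move=> /forallP/(_ i); rewrite ffunE (eq_sym j); case: eqP => _ ? ?; lia.
- by lia.
Qed.

Definition z_word (m : multi) : seq gen :=
  flatten [seq nseq (m i) (Fz i) | i <- rev (enum 'I_n)].
Definition zs_word (m : multi) : seq gen :=
  flatten [seq nseq (m i) (Fzs i) | i <- enum 'I_n].

Lemma word_nseq x k : word (nseq k x) = FU_letter q x ^+ k.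
Proof. by elim: k => [|k IH]; rewrite ?word_nil //= word_cons IH exprS. Qed.

Lemma word_flatten (ws : seq (seq gen)) : word (flatten ws) = \prod_(w <- ws) word w.
Proof.
elim: ws => [|w ws IH]; first by rewrite word_nil big_nil.
by rewrite /= word_cat IH big_cons.
Qed.

Lemma word_z m : word (z_word m) = zpow q m.
Proof.
rewrite word_flatten big_map; apply: eq_bigr => i _; exact: word_nseq.
Qed.

Lemma word_zs m : word (zs_word m) = zspow q m.
Proof.
rewrite word_flatten big_map; apply: eq_bigr => i _; exact: word_nseq.
Qed.

Lemma count_flatten_nseq (g : 'I_n -> gen) (a : pred gen) i (m : multi) (s : seq 'I_n) :
  uniq s -> (forall j, a (g j) = (j == i)) ->
  count a (flatten [seq nseq (m j) (g j) | j <- s]) = (m i * (i \in s))%N.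
Proof.
move=> us ag; rewrite -(count_uniq_mem _ us).
elim: s {us} => [|j s IH] /=; first by rewrite muln0.
rewrite count_cat IH count_nseq ag mulnDr; congr addn.
by case: eqP => [->|_]; rewrite ?mul1n ?muln1 ?mul0n ?muln0.
Qed.

Lemma count_flatten_nseq0 (g : 'I_n -> gen) (a : pred gen) (m : multi) (s : seq 'I_n) :
  (forall j, ~~ a (g j)) -> count a (flatten [seq nseq (m j) (g j) | j <- s]) = 0%N.
Proof.
move=> ag; elim: s => [//|j s IH] /=.
by rewrite count_cat IH count_nseq (negPf (ag j)).
Qed.

Lemma up_z m : word_up (z_word m) = m.
Proof.
apply/ffunP => i; rewrite ffunE (count_flatten_nseq (i := i)) ?rev_uniq ?enum_uniq //.
by rewrite mem_rev mem_enum muln1.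
Qed.

Lemma down_z m : word_down (z_word m) = multi0 n.
Proof. by apply/ffunP => i; rewrite !ffunE count_flatten_nseq0. Qed.

Lemma up_zs m : word_up (zs_word m) = multi0 n.
Proof. by apply/ffunP => i; rewrite !ffunE count_flatten_nseq0. Qed.

Lemma down_zs m : word_down (zs_word m) = m.
Proof.
apply/ffunP => i; rewrite ffunE (count_flatten_nseq (i := i)) ?enum_uniq //.
by rewrite mem_enum muln1.
Qed.

Lemma z_word_coef_gt0 p m : 0 < word_coef (z_word p) m.
Proof.
rewrite /z_word; elim: (rev _) => [|i s IH] //=.
rewrite word_coef_cat mulr_gt0 //; move: (word_pos _ m).
by elim: (p i) => [//|k IHk] m' /=; rewrite mulr_gt0 // exprn_gt0.
Qed.

Lemma z_word_pos p m : word_pos (z_word p) m = addm m p.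
Proof.
have := @word_balance (z_word p) m; rewrite gt_eqF ?z_word_coef_gt0 // => /(_ isT).
by rewrite up_z down_z addm0.
Qed.

Lemma gen_coef_zs_gt0 i (m : multi) : (0 < m i)%N -> 0 < gen_coef (Fzs i) m.
Proof.
move=> mi; rewrite /= mulr_gt0 ?exprn_gt0 // subr_gt0 exprn_ilt1 ?ltW //.
by rewrite muln_eq0 negb_or /= -lt0n.
Qed.

(** Reading the word from the right, each letter meets a positive exponent, since
    the exponents consumed so far are dominated by those of [m]. *)
Lemma zs_word_coef_gt0 p m : mle p m -> 0 < word_coef (zs_word p) m.
Proof.
rewrite -{1}(down_zs p).
have: all (fun x : gen => if x is Fzs _ then true else false) (zs_word p).
  rewrite /zs_word; elim: (enum _) => [//|i s IH] /=.
  by rewrite all_cat IH all_nseq orbT.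
elim: (zs_word p) => [//|[//|i|//] w IH] /= aw pm.
have uw : word_up w = multi0 n.
  apply/ffunP => j; rewrite !ffunE; elim: w aw {IH pm} => [//|[//|k|//] w IH] /=.
  by move=> /IH ->.
have wm : mle (word_down w) m.
  apply/forallP => j; apply: leq_trans (forallP pm j).
  by rewrite !ffunE /= leq_addl.
have w0 := IH aw wm; rewrite mulr_gt0 //.
apply: gen_coef_zs_gt0.
move/lt0r_neq0/word_balance/ffunP/(_ i): w0.
have := forallP pm i; rewrite uw !ffunE /= eqxx addn0 add1n => h e.
by move: h; rewrite -e -addn1 addnC leq_add2r.
Qed.

Lemma zs_word_coef_neq0 p m : word_coef (zs_word p) m != 0 ->
  addm (word_pos (zs_word p) m) p = m.
Proof. by move/word_balance; rewrite up_zs down_zs addm0. Qed.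

Lemma zs_word_pos p m : mle p m -> word_pos (zs_word p) m = subm m p.
Proof. by move=> /zs_word_coef_gt0/lt0r_neq0/zs_word_coef_neq0 {2}<-; rewrite addmK. Qed.

End Fock.

(** * Matrix entries and the coefficient at zero *)

Section Coordinates.
Variables (R : realType) (n : nat) (q : R).
Hypotheses (q_gt0 : 0 < q) (q_lt1 : q < 1).
Local Notation C := R[i].
Local Notation FU := (FU n q).
Local Notation gen := (FU_gen n).
Local Notation z := (@FU_z R n q).
Local Notation zs := (@FU_zs R n q).
Local Notation multi := (multi n).
Local Notation c x := ((x)%:C : C).
Local Notation word := (@word R n q).
Variable H : fock_space n q.
Local Notation op := (@fock_act R n q H).
Local Notation Z := (@fockb R n q H).

Lemma big_if_mem (V : zmodType) (I : eqType) (t s : seq I) (F : I -> V) :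
  uniq t -> uniq s -> {subset s <= t} ->
  \sum_(i <- t) (if i \in s then F i else 0) = \sum_(i <- s) F i.
Proof.
move=> ut us st; rewrite -big_mkcond /= -big_filter; apply: perm_big.
apply: uniq_perm; rewrite ?filter_uniq // => i; rewrite mem_filter.
by apply/andP/idP => [[]//|is_]; split=> //; exact: st.
Qed.

Lemma sum_undup (V : lmodType C) (I : eqType) (s : seq I) (a : I -> C) (F : I -> V) :
  exists b : I -> C,
    \sum_(i <- s) a i *: F i = \sum_(i <- undup s) b i *: F i.
Proof.
exists (fun i => a i *+ count_mem i s).
rewrite -(big_undup_iterop_count _ _ xpredT); apply: eq_bigr => i _.
rewrite -scalerMnl.
by case: (count_mem i s) => [|k]; rewrite ?mulr0n // /iterop -Monoid.iteropE.
Qed.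

Lemma fock_repr (v : H) : exists p : seq multi * (multi -> C),
  uniq p.1 /\ v = \sum_(m <- p.1) p.2 m *: Z m.
Proof.
have [s [a ->]] := fock_span v.
have [b ->] := sum_undup s a Z.
by exists (undup s, b); rewrite undup_uniq.
Qed.

(** A choice of a finite expansion over the basis; [fcoord] depends only on the
    vector by [coord_unique]. *)
Definition supp (v : H) : seq multi := (sval (cid (fock_repr v))).1.
Definition fcoord (m : multi) (v : H) : C :=
  if m \in supp v then (sval (cid (fock_repr v))).2 m else 0.

Lemma supp_uniq v : uniq (supp v).
Proof. by rewrite /supp; case: cid => p []. Qed.

Lemma coord_span v : v = \sum_(m <- supp v) fcoord m v *: Z m.
Proof.
rewrite /fcoord /supp; case: cid => p [/= up {1}->].
by apply: eq_big_seq => m ->.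
Qed.

(** Two expansions agree after extension by zero to the union of their supports,
    where freeness of the basis applies. *)
Lemma coord_unique s (a : multi -> C) v : uniq s -> v = \sum_(m <- s) a m *: Z m ->
  forall m, fcoord m v = if m \in s then a m else 0.
Proof.
move=> us ve m; set t := undup (s ++ supp v).
have ts : {subset s <= t} by move=> k ks; rewrite mem_undup mem_cat ks.
have tv : {subset supp v <= t} by move=> k kv; rewrite mem_undup mem_cat kv orbT.
pose d k := (if k \in supp v then fcoord k v else 0) - (if k \in s then a k else 0).
have d0 : \sum_(k <- t) d k *: Z k = 0.
  rewrite -[RHS](subrr v) {2}ve {1}(coord_span v).
  rewrite -(big_if_mem _ (undup_uniq _) us ts).
  rewrite -(big_if_mem _ (undup_uniq _) (supp_uniq v) tv) -sumrB.
  by apply: eq_bigr => k _; rewrite /d scalerBl; congr (_ - _);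
    case: ifP; rewrite ?scale0r.
have coordN : m \notin supp v -> fcoord m v = 0 by rewrite /fcoord => /negPf->.
have [mt|] := boolP (m \in t).
  have /eqP := fock_free (undup_uniq _) d0 mt; rewrite subr_eq0 => /eqP <-.
  by case: ifPn.
rewrite mem_undup mem_cat negb_or => /andP[/negPf -> ms].
by rewrite coordN.
Qed.

Lemma coord_linear m : linear_for *%R (fcoord m).
Proof.
move=> a u v; set t := undup (supp u ++ supp v).
have tu : {subset supp u <= t} by move=> k ks; rewrite mem_undup mem_cat ks.
have tv : {subset supp v <= t} by move=> k kv; rewrite mem_undup mem_cat kv orbT.
have ext w : {subset supp w <= t} -> w = \sum_(k <- t) fcoord k w *: Z k.
  move=> tw; rewrite {1}(coord_span w) -(big_if_mem _ (undup_uniq _) (supp_uniq w) tw).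
  by apply: eq_bigr => k _; rewrite /fcoord; case: ifP => kw; rewrite ?kw ?scale0r.
rewrite (@coord_unique t (fun k => a * fcoord k u + fcoord k v)) ?undup_uniq //.
  case: ifPn => //; rewrite mem_undup mem_cat negb_or => /andP[/negPf mu /negPf mv].
  by rewrite /fcoord mu mv mulr0 addr0.
rewrite [in LHS](ext _ tu) [in LHS](ext _ tv) scaler_sumr -big_split /=.
by apply: eq_bigr => k _; rewrite scalerDl scalerA.
Qed.

HB.instance Definition _ m := GRing.isLinear.Build C H C *%R (fcoord m) (coord_linear m).

Lemma coordZ m k : fcoord m (Z k) = (m == k)%:R.
Proof.
rewrite (@coord_unique [:: k] (fun=> 1)) ?inE ?big_seq1 ?scale1r //.
by case: eqP.
Qed.

Lemma coord_ext u v : (forall m, fcoord m u = fcoord m v) -> u = v.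
Proof.
move=> uv; apply/eqP; rewrite -subr_eq0; apply/eqP.
rewrite (coord_span (u - v)) big1 // => m _.
by rewrite linearB /= uv subrr scale0r.
Qed.

Lemma fock_linear_eq (V : lmodType C) (S T : H -> V) : linear S -> linear T ->
  (forall m, S (Z m) = T (Z m)) -> S =1 T.
Proof.
move=> Sl Tl ST v.
pose S' : {linear H -> V} := HB.pack S (GRing.isLinear.Build _ _ _ _ S Sl).
pose T' : {linear H -> V} := HB.pack T (GRing.isLinear.Build _ _ _ _ T Tl).
rewrite -[S v]/(S' v) -[T v]/(T' v) (coord_span v) !linear_sum.
by apply: eq_bigr => m _; rewrite !linearZ; congr (_ *: _); exact: ST.
Qed.

Definition diagop (g : multi -> C) (v : H) : H :=
  \sum_(m <- supp v) (g m * fcoord m v) *: Z m.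

Lemma coord_diagop g m v : fcoord m (diagop g v) = g m * fcoord m v.
Proof.
rewrite (@coord_unique (supp v) (fun m => g m * fcoord m v)) ?supp_uniq //.
by case: ifPn => // /negPf mv; rewrite /fcoord mv mulr0.
Qed.

Lemma diagop_linear g : linear (diagop g).
Proof.
move=> a u v; apply: coord_ext => m.
by rewrite linearP /= !coord_diagop linearP mulrDr mulrCA.
Qed.

HB.instance Definition _ g := GRing.isLinear.Build C H H _ (diagop g) (diagop_linear g).

Lemma diagopZ g m : diagop g (Z m) = g m *: Z m.
Proof.
apply: coord_ext => k; rewrite coord_diagop linearZ /= coordZ.
by case: eqP => [->//|_]; rewrite !mulr0.
Qed.

Lemma msum_gt_submK i (m : multi) : msum_gt i (subm m (unitm i)) = msum_gt i m.
Proof.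
apply: eq_bigr => k ik; rewrite !ffunE (_ : k == i = false) ?subn0 //.
by apply/negP => /eqP e; rewrite e ltnn in ik.
Qed.

Lemma z_zs_fockb k m : op (z k) (op (zs k) (Z m))
  = c (q ^+ (2 * msum_gt k m) - q ^+ (2 * msum_ge k m)) *: Z m.
Proof.
rewrite zs_fockb // linearZ /= z_fockb // scalerA -rmorphM msum_gt_submK.
have -> : q ^+ msum_gt k m * (1 - q ^+ (2 * m k)) * q ^+ msum_gt k m
    = q ^+ (2 * msum_gt k m) - q ^+ (2 * msum_ge k m).
  by rewrite msum_geE !mul2n -!addnn !exprD; ring.
have [m0|m0] := posnP (m k).
  by rewrite msum_geE m0 add0n subrr !scale0r.
by rewrite submK // mle_unitm.
Qed.

(** The summand [z k * zs k] has the eigenvalue [S k.+1 - S k] for [S] a power of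
    [q] with the partial sums of [m] as exponents, so that the sum telescopes. *)
Lemma y_fockb i m : op (FU_y q i) (Z m) = c (q ^+ (2 * msum_ge i m)) *: Z m.
Proof.
rewrite /FU_y opD opN op1 op_sum.
pose S j := q ^+ (2 * \sum_(k < n | (j <= k)%N) m k).
transitivity (Z m - c (\sum_(k < n | (i <= k)%N) (S k.+1 - S k)) *: Z m).
  congr (_ - _); rewrite rmorph_sum scaler_suml; apply: eq_bigr => k ik.
  by rewrite opM z_zs_fockb.
rewrite -(big_geq_mkord i n xpredT (fun k => S k.+1 - S k)) telescope_sumr; last first.
  exact: ltnW.
rewrite -[X in X - _]scale1r -scalerBl -(rmorphB (real_complex R) 1); congr (c _ *: _).
rewrite {1}/S big_pred0 ?muln0 ?expr0; first by rewrite opprB addrC subrK.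
by move=> k; rewrite leqNgt ltn_ord.
Qed.

(** The exponent [m] is the sequence of differences of the partition
    [msum_ge i m], which labels the joint spectrum of the [y_i]. *)
Definition partn_of (m : multi) : multi := [ffun i => msum_ge i m].

Lemma partn_of_is_partn m : is_partn (partn_of m).
Proof.
apply/forallP => i; apply/forallP => j; apply/implyP => ij; rewrite !ffunE.
rewrite /msum_ge [leqLHS]big_mkcond [leqRHS]big_mkcond leq_sum //= => k _.
by case: ifP => // jk; rewrite (leq_trans ij jk).
Qed.

Definition to_partn (m : multi) : Defs.partn n :=
  exist _ (partn_of m) (partn_of_is_partn m).

Lemma msum_gtE i (m k : multi) : (forall j, msum_ge j m = msum_ge j k) ->
  msum_gt i m = msum_gt i k.
Proof.
move=> mk; have [ni|ni] := leqP n i.+1.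
  by rewrite /msum_gt !big_pred0 // => j; rewrite ltnNge -ltnS (leq_trans _ ni).
exact: mk (Ordinal ni).
Qed.

Lemma to_partn_inj : injective to_partn.
Proof.
move=> m k /(congr1 val)/ffunP mk.
have {}mk j : msum_ge j m = msum_ge j k by have := mk j; rewrite !ffunE.
apply/ffunP => i; apply: (@addIn (msum_gt i m)).
by rewrite {2}(msum_gtE i mk) -!msum_geE.
Qed.

Lemma to_partn_surj p : exists m, to_partn m = p.
Proof.
pose k' j := if insub j is Some i then val p i else 0%N.
have k'E (i : 'I_n) : k' i = val p i by rewrite /k' valK.
have k'n j : (n <= j)%N -> k' j = 0%N by move=> nj; rewrite /k' insubF // ltnNge nj.
have k'le j : (k' j.+1 <= k' j)%N.
  have [nj|jn] := leqP n j.+1; first by rewrite k'n.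
  have /forallP/(_ (Ordinal (ltnW jn)))/forallP/(_ (Ordinal jn)) := valP p.
  by rewrite /= leqnSn -!k'E.
pose m : multi := [ffun i : 'I_n => (k' i - k' i.+1)%N].
exists m; apply/val_inj/ffunP => i; rewrite ffunE /= -k'E.
rewrite /msum_ge.
under eq_bigr do rewrite ffunE.
rewrite -(big_geq_mkord i n xpredT (fun k => k' k - k' k.+1)%N).
elim: {i} (n - i)%N {-2}(i : nat) (subnKC (ltnW (ltn_ord i))) => [|d IH] j jn.
  by rewrite big_geq -?{1}jn ?addn0 // k'n // -jn addn0.
rewrite big_ltn; last by rewrite -jn -addSnnS leq_addr.
by rewrite /= IH ?addSnnS // subnK.
Qed.

Lemma spec_point_inj : injective (fun m => spec_point q (to_partn m)).
Proof.
move=> m k /rowP mk; apply/to_partn_inj/val_inj/ffunP => i.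
have q_neq1 : q != 1 by rewrite lt_eqF.
have := mk i; rewrite !mxE => /(ieexprIn q_gt0 q_neq1)/eqP.
by rewrite eqn_pmul2l // => /eqP.
Qed.

(** Recovers the exponent from a point of the spectrum; the value off the spectrum
    is arbitrary. *)
Definition index_of (lam : 'rV[R]_n) : multi :=
  xget (multi0 n) [set m | spec_point q (to_partn m) = lam].

Lemma index_ofK m : index_of (spec_point q (to_partn m)) = m.
Proof.
apply: spec_point_inj.
exact: (@xgetI _ _ (fun k => spec_point q (to_partn k) = spec_point q (to_partn m)) m).
Qed.

(** A joint eigenvector only involves basis vectors with its own eigenvalues, and
    these determine the basis vector. *)
Lemma fun_of_y_diagop (g : 'rV[R]_n -> C) :
  @fun_of_y R n q H g (diagop (fun m => g (spec_point q (to_partn m)))).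
Proof.
split; first exact: diagop_linear.
move=> v lam [p _ <-] lamv; apply: coord_ext => m.
rewrite coord_diagop linearZ /=.
have [->|cv0] := eqVneq (fcoord m v) 0; first by rewrite !mulr0.
congr (g _ * _); apply/rowP => i; rewrite !mxE ffunE.
pose Y k : C := c (q ^+ (2 * msum_ge i k)).
have /(congr1 (fcoord m)) : diagop Y v = c (spec_point q p 0 i) *: v.
  rewrite -lamv; suff: diagop Y =1 op (FU_y q i) by apply.
  apply: fock_linear_eq => [||k]; first exact: diagop_linear.
    exact: op_linearv.
  by rewrite y_fockb diagopZ.
rewrite coord_diagop linearZ /= => /(mulIf cv0).
by rewrite /Y mxE => /complexI.
Qed.

Lemma fun_of_y_lin a (g h : 'rV[R]_n -> C) G K :
  @fun_of_y R n q H g G -> fun_of_y h K ->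
  fun_of_y (fun l => a * g l + h l) (fun v => a *: G v + K v).
Proof.
move=> [Gl Ge] [Kl Ke]; split.
  move=> b u v; rewrite Gl Kl !scalerDr !scalerA mulrC -!scalerA.
  by rewrite addrACA.
by move=> v lam sl lv; rewrite (Ge v lam) // (Ke v lam) // scalerA -scalerDl.
Qed.

Lemma fun_of_y0 : @fun_of_y R n q H (fun=> 0) (fun=> 0).
Proof.
by split=> [b u v|v lam _ _]; rewrite ?scaler0 ?addr0 ?scale0r.
Qed.

Lemma balance_sub (x d m u : nat) : (x + d = m + u)%N ->
  ((d - u <= m) /\ x = (m - (d - u)) + (u - d))%N.
Proof. by lia. Qed.

(** The shift by [word_up w - word_down w] is the difference of its positive part
    [p1] and its negative part [p2], which have disjoint supports. Hence the word is
    [zpow p1], times a diagonal operator, times [zspow p2]; the diagonal entries are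
    quotients by the coefficients of the two monomials. *)
Lemma decomposition_word w : exists g, @decomposition R n q H (word w) g.
Proof.
pose p1 := subm (word_up w) (word_down w).
pose p2 := subm (word_down w) (word_up w).
pose a k := word_coef q (z_word p1) k.
pose b k := word_coef q (zs_word p2) (addm k p2).
pose g' k : C := c (word_coef q w (addm k p2) / (a k * b k)).
pose g (p : multi * multi) lam : C := if p == (p1, p2) then g' (index_of lam) else 0.
exists g, [:: (p1, p2)], (fun p => diagop (fun m => g p (spec_point q (to_partn m)))).
split=> //.
- move=> p; rewrite inE => /eqP -> i; rewrite /= !ffunE.
  by apply/eqP; rewrite muln_eq0 !subn_eq0 leq_total.
- by move=> p; rewrite inE /g => /negPf ->.
- by move=> p _; exact: fun_of_y_diagop.
move=> v; rewrite big_seq1 /=.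
move: v; apply: fock_linear_eq => [||m]; first exact: op_linearv.
  by move=> x u v; rewrite !linearP.
rewrite -word_zs -word_z !word_fockb // linearZ /= diagopZ /g eqxx index_ofK.
rewrite !linearZ /= word_fockb // !scalerA.
have balance : word_coef q w m != 0 ->
    mle p2 m /\ word_pos w m = addm (subm m p2) p1.
  move=> /word_balance/ffunP e.
  have {}e i := balance_sub (etrans (esym (ffunE _ _)) (etrans (e i) (ffunE _ _))).
  by split; [apply/forallP|apply/ffunP] => i; rewrite /p1 /p2 ffunE; have [] := e i;
    rewrite !ffunE.
have [m2|m2] := boolP (mle p2 m); last first.
  have -> : word_coef q w m = 0.
    by apply/eqP; apply: contraNT m2 => /balance[].
  have -> : word_coef q (zs_word p2) m = 0.
    apply/eqP; apply: contraNT m2 => /zs_word_coef_neq0 <-; exact: mle_addl.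
  by rewrite !mul0r !scale0r.
rewrite (zs_word_pos q_gt0 q_lt1) // (z_word_pos q_gt0) // /g' /a /b submK //.
have a0 := lt0r_neq0 (z_word_coef_gt0 q_gt0 p1 (subm m p2)).
have b0 := lt0r_neq0 (zs_word_coef_gt0 q_gt0 q_lt1 m2).
have [->|/balance[_ ->]] := eqVneq (word_coef q w m) 0.
  by rewrite mul0r mulr0 mul0r !scale0r.
by rewrite -!rmorphM; congr (c _ *: _); field; apply/andP.
Qed.

Lemma decomposition_lin a f h g1 g2 :
  @decomposition R n q H f g1 -> decomposition H h g2 ->
  decomposition H (a *: f + h) (fun p lam => a * g1 p lam + g2 p lam).
Proof.
move=> [s1 [G1 [u1 d1 n1 y1 e1]]] [s2 [G2 [u2 d2 n2 y2 e2]]].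
pose G1' p v := if p \in s1 then G1 p v else 0.
pose G2' p v := if p \in s2 then G2 p v else 0.
exists (undup (s1 ++ s2)), (fun p v => a *: G1' p v + G2' p v).
split; first exact: undup_uniq.
- by move=> p; rewrite mem_undup mem_cat => /orP[/d1|/d2].
- move=> p; rewrite mem_undup mem_cat negb_or => /andP[p1 p2] lam.
  by rewrite n1 // n2 // mulr0 addr0.
- move=> p _; apply: fun_of_y_lin; rewrite /G1' /G2'.
    have [ps|ps] := boolP (p \in s1); first exact: y1.
    by rewrite (_ : g1 p = fun=> 0); [exact: fun_of_y0|apply/funext/n1].
  have [ps|ps] := boolP (p \in s2); first exact: y2.
  by rewrite (_ : g2 p = fun=> 0); [exact: fun_of_y0|apply/funext/n2].
move=> v; rewrite opD opZ e1 e2.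
have s1t : {subset s1 <= undup (s1 ++ s2)}.
  by move=> p ps; rewrite mem_undup mem_cat ps.
have s2t : {subset s2 <= undup (s1 ++ s2)}.
  by move=> p ps; rewrite mem_undup mem_cat ps orbT.
rewrite -(big_if_mem _ (undup_uniq _) u1 s1t) -(big_if_mem _ (undup_uniq _) u2 s2t).
rewrite scaler_sumr -big_split; apply: eq_bigr => p _ /=.
by rewrite linearP /= /G1' /G2'; do 2!case: ifP => _; rewrite ?linear0.
Qed.

Lemma decomposition_exists f : exists g, @decomposition R n q H f g.
Proof.
elim/FU_linear_ind: f => [w|a f h [g1 d1] [g2 d2]]; first exact: decomposition_word.
by eexists; exact: decomposition_lin d1 d2.
Qed.

Definition diag (f : FU) (m : multi) : C := fcoord m (op f (Z m)).

(** Since [p.1] and [p.2] have disjoint supports, the summand of [p] shifts every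
    basis vector unless both vanish, so only the coefficient at zero contributes to
    the diagonal. *)
Lemma decomposition_diag f g m : @decomposition R n q H f g ->
  g (multi0 n, multi0 n) (spec_point q (to_partn m)) = diag f m.
Proof.
move=> [s [G [us ds ns ys e]]]; rewrite /diag e linear_sum /=.
have GZ p k : p \in s -> G p (Z k) = g p (spec_point q (to_partn k)) *: Z k.
  move=> /ys[_]; apply; first by exists (to_partn k).
  by move=> i; rewrite y_fockb mxE ffunE.
have GZZ p a v : p \in s -> G p (a *: v) = a *: G p v.
  move=> /ys[Gl _]; have := Gl a v 0.
  have G0 : G p 0 = 0.
    apply: (addrI (G p 0)); rewrite addr0.
    by have := Gl 1 0 0; rewrite !scale1r !addr0 => <-.
  by rewrite G0 !addr0.
have term p : p \in s -> fcoord m (op (zpow q p.1) (G p (op (zspow q p.2) (Z m))))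
    = if p == (multi0 n, multi0 n) then g p (spec_point q (to_partn m)) else 0.
  case: eqP => [-> ps|p0 ps] /=.
    have -> : zspow q (multi0 n) = 1 by rewrite /zspow big1 // => i _; rewrite ffunE.
    rewrite zpow0 !op1 GZ // linearZ /= coordZ eqxx mulr1 //.
  rewrite -word_zs -word_z word_fockb // GZZ // GZ // !linearZ /= word_fockb //.
  rewrite linearZ /= coordZ (z_word_pos q_gt0) //.
  have [->|/zs_word_coef_neq0 e2] := eqVneq (word_coef q (zs_word p.2) m) 0.
    by rewrite mul0r.
  case: eqP => [e1|_]; last by rewrite !mulr0.
  case: p0; move: ps => /ds p12; case: p e1 e2 p12 => [p1 p2] /= e1 e2 p12.
  have e0 i : p1 i = 0%N /\ p2 i = 0%N.
    have /eqP := p12 i; rewrite muln_eq0.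
    move/ffunP/(_ i): e1; move/ffunP/(_ i): e2; rewrite !ffunE => e2 e1.
    by move=> /orP[/eqP p0|/eqP p0]; lia.
  by congr pair; apply/ffunP => i; rewrite ffunE; case: (e0 i).
rewrite (eq_big_seq _ term) -big_mkcond /=.
have [s0|s0] := boolP ((multi0 n, multi0 n) \in s); last first.
  rewrite ns // big1_seq // => p /andP[/eqP -> ps].
  by rewrite ps in s0.
rewrite -big_filter (perm_big [:: (multi0 n, multi0 n)]) ?big_seq1 //.
apply: uniq_perm; rewrite ?filter_uniq // => p; rewrite mem_filter inE.
by case: eqP => [->|].
Qed.

Lemma coef00_diag f m : coef00 H f (spec_point q (to_partn m)) = diag f m.
Proof.
rewrite /coef00; case: xgetP => [h _ [g fg ->]|no]; first exact: decomposition_diag.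
have [g fg] := decomposition_exists f.
by case: (no (g (multi0 n, multi0 n))); exists g.
Qed.

Definition wdiag (w : seq gen) (m : multi) : R :=
  word_coef q w m * (word_pos w m == m)%:R.

Lemma diag_word w m : diag (word w) m = c (wdiag w m).
Proof.
rewrite /diag word_fockb // linearZ /= coordZ eq_sym /wdiag rmorphM.
by rewrite rmorph_nat.
Qed.

End Coordinates.

(** * Absolutely summable families *)

Section Sums.
Variable R : realType.

Lemma rsum_ge0 (I : choiceType) (x : I -> R) : (forall i, 0 <= x i) ->
  rsum x = fine (esum setT (EFin \o x)).
Proof.
move=> x0; rewrite /rsum; congr fine.
have x0' i : [set: I] i -> (0 <= (EFin \o x) i)%E by rewrite lee_fin.
rewrite (@eq_esum _ _ setT _ (EFin \o x)); last first.
  by move=> i _; rewrite (ge0_funeposE x0') ?inE.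
rewrite [X in (_ - X)%E]esum1 ?sube0 // => i _.
by rewrite (ge0_funenegE x0') ?inE.
Qed.

Lemma eq_rsum (I : choiceType) (x y : I -> R) : x =1 y -> rsum x = rsum y.
Proof. by move=> /funext ->. Qed.

Lemma rsum0 (I : choiceType) : rsum (fun _ : I => 0 : R) = 0.
Proof. by rewrite rsum_ge0 // esum1. Qed.

(** Finiteness is essential: [rsum] is a difference of two sums, and takes
    the value zero by convention when one of them is infinite. *)
Lemma rsum_sub0 (I : choiceType) (a b : I -> R) :
  (forall i, 0 <= a i) -> (forall i, 0 <= b i) ->
  esum setT (EFin \o a) = esum setT (EFin \o b) ->
  (esum setT (EFin \o a) < +oo)%E -> rsum (fun i => a i - b i) = 0.
Proof.
move=> a0 b0 ab afin.
have absE (x : I -> R) : (forall i, 0 <= x i) ->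
    (\esum_(i in setT) `|(EFin \o x) i| = esum setT (EFin \o x))%E.
  by move=> x0; apply: eq_esum => i _; rewrite gee0_abs // lee_fin.
rewrite /rsum (_ : EFin \o _ = (EFin \o a) \- (EFin \o b))%E; last by apply/funext.
have af : esum setT (EFin \o a) \is a fin_num.
  rewrite fin_numElt afin andbT (lt_le_trans (ltNyr 0)) //.
  by apply: esum_ge0 => i _; rewrite lee_fin.
rewrite esumB; first by rewrite -ab subee.
- by rewrite /summable absE.
- by rewrite /summable absE // -ab.
- by move=> i _; rewrite lee_fin.
- by move=> i _; rewrite lee_fin.
Qed.

Lemma rsum_gt0 (I : choiceType) (x : I -> R) i : (forall i, 0 <= x i) ->
  0 < x i -> (esum setT (EFin \o x) < +oo)%E -> 0 < rsum x.
Proof.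
move=> x0 xi xfin; rewrite rsum_ge0 // fine_gt0 // xfin andbT.
apply: (@lt_le_trans _ _ (x i)%:E); first by rewrite lte_fin.
apply: esum_ge; exists [set i].
  by split; [exact: finite_set1|].
by rewrite fsbig_set1.
Qed.

Lemma reindex_rsum (I J : choiceType) (e : I -> J) (x : J -> R) :
  set_bij setT setT e -> rsum x = rsum (x \o e).
Proof.
move=> be; rewrite /rsum (reindex_esum _ _ _ _ be).
rewrite [X in (_ - X)%E](reindex_esum _ _ _ _ be).
by congr (fine (_ - _)); apply: eq_esum => i _; rewrite ?(funeposE, funenegE).
Qed.

Lemma esumZl (I : choiceType) (k : R) (x : I -> R) : 0 < k -> (forall i, 0 <= x i) ->
  esum setT (fun i => (k * x i)%:E) = (k%:E * esum setT (fun i => (x i)%:E))%E.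
Proof.
have le (l : R) (y : I -> R) : 0 < l -> (forall i, 0 <= y i) ->
    (esum setT (fun i => (l * y i)%:E) <= l%:E * esum setT (fun i => (y i)%:E))%E.
  move=> l0 y0; apply: ge_ereal_sup => _ [X [finX _] <-].
  under eq_fsbigr do rewrite EFinM.
  rewrite -ge0_mule_fsumr; last by move=> i; rewrite lee_fin.
  apply: lee_wpmul2l; first by rewrite lee_fin ltW.
  apply: ereal_sup_ubound.
  by exists X.
move=> k0 x0; apply/eqP; rewrite eq_le le //= .
have kx0 i : 0 <= k * x i by rewrite mulr_ge0 // ltW.
have ki0 : 0 < k^-1 by rewrite invr_gt0.
rewrite -lee_pdivlMl // (le_trans _ (le _ _ ki0 kx0)) //.
by apply: le_esum => i _; rewrite mulKf ?gt_eqF.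
Qed.

Lemma sum_geom_le (t : R) N : 0 < t < 1 -> \sum_(j < N) t ^+ j <= (1 - t)^-1.
Proof.
move=> /andP[t0 t1]; have t1' : 0 < 1 - t by rewrite subr_gt0.
rewrite -[leRHS]mul1r ler_pdivlMr // mulrC -opprB mulNr -subrX1 opprB.
by rewrite gerBl exprn_ge0 // ltW.
Qed.

(** A finite set of exponents lies in a box, and the sum over the box is a product
    of partial sums of geometric series. *)
Lemma esum_monomial_fin (n : nat) (t : 'I_n -> R) : (forall i, 0 < t i < 1) ->
  (esum setT (fun m : multi n => (\prod_i t i ^+ m i)%:E) < +oo)%E.
Proof.
move=> t01; apply: (@le_lt_trans _ _ (\prod_i (1 - t i)^-1)%:E); last exact: ltry.
have t0 i : 0 <= t i by case/andP: (t01 i) => /ltW.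
apply: ge_ereal_sup => _ [X [finX _] <-]; rewrite fsbig_finite //= sumEFin lee_fin.
set s := (X in \sum_(_ <- X) _); have us : uniq s by exact: finmap.fset_uniq.
pose N := (\max_(m <- s) \max_i m i)%N.
have sN m i : m \in s -> (m i < N.+1)%N.
  move=> ms; rewrite ltnS /N (big_rem m) //= leq_max.
  by rewrite (bigD1 i) //= leq_maxl.
pose phi (m : multi n) : {ffun 'I_n -> 'I_N.+1} := [ffun i => inord (m i)].
have phi_inj : {in s &, injective phi}.
  move=> m k ms ks /ffunP e; apply/ffunP => i; have := congr1 val (e i).
  by rewrite !ffunE /= !inordK ?sN.
pose a (g : {ffun 'I_n -> 'I_N.+1}) := \prod_i t i ^+ g i.
have a0 g : 0 <= a g by apply: prodr_ge0 => i _; rewrite exprn_ge0.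
rewrite (eq_big_seq (fun m => a (phi m))); last first.
  by move=> m ms; apply: eq_bigr => i _; rewrite ffunE inordK ?sN.
rewrite -(big_map phi xpredT a) big_uniq ?map_inj_in_uniq //=.
apply: (@le_trans _ _ (\sum_g a g)).
  by rewrite big_mkcond /= ler_sum // => g _; case: ifP.
(* Expanding the product over the coordinates of the sums over a side of the box. *)
rewrite -(bigA_distr_bigA (fun i (j : 'I_N.+1) => t i ^+ j)).
apply: ler_prod => i _; rewrite sum_geom_le // andbT.
by apply: sumr_ge0 => j _; rewrite exprn_ge0.
Qed.

End Sums.

(** * Weighted traces of words *)

Section Trace.
Variables (R : realType) (n : nat) (q alpha : R).
Hypotheses (q_gt0 : 0 < q) (q_lt1 : q < 1) (alpha_gt0 : 0 < alpha).
Local Notation C := R[i].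
Local Notation gen := (FU_gen n).
Local Notation multi := (multi n).
Local Notation c x := ((x)%:C : C).
Local Notation word := (@word R n q).
Implicit Types (w : seq gen) (m : multi) (i : 'I_n).

Definition torus (lam : 'I_n -> R) (m : multi) : R := \prod_i lam i ^+ m i.

Lemma torus_addm lam m i : torus lam (addm m (unitm i)) = lam i * torus lam m.
Proof.
rewrite /torus (eq_bigr (fun k => lam k ^+ unitm i k * lam k ^+ m k)); last first.
  by move=> k _; rewrite ffunE exprD mulrC.
rewrite big_split /=; congr (_ * _); rewrite (bigD1 i) //= ffunE eqxx expr1 big1 ?mulr1 //.
by move=> k /negPf ik; rewrite ffunE ik.
Qed.

Lemma torus_neq0 lam m : (forall i, lam i != 0) -> torus lam m != 0.
Proof. by move=> l0; apply/prodf_neq0 => i _; rewrite expf_neq0. Qed.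

(** Weights are parametrized by the factors [s i] attached to the coordinates of the
    partition, because dividing by an eigenvalue of some [y_l] then only changes the
    factor [s l]. In terms of the exponent the weight is geometric, with the ratios
    [wrate s k]. *)
Definition wgt (s : 'I_n -> R) (m : multi) : R := \prod_i s i ^+ msum_ge i m.
Definition wrate (s : 'I_n -> R) (k : 'I_n) : R := \prod_(i < n | (i <= k)%N) s i.

Lemma wgtE s m : wgt s m = torus (wrate s) m.
Proof.
transitivity (\prod_(i < n) \prod_(k < n | (i <= k)%N) s i ^+ m k).
  by apply: eq_bigr => i _; rewrite -prodrXr /msum_ge.
rewrite (exchange_big_dep xpredT) //=; apply: eq_bigr => k _.
by rewrite /wrate -prodrXl.
Qed.

Lemma wgt_addm s m k : wgt s (addm m (unitm k)) = wrate s k * wgt s m.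
Proof. by rewrite !wgtE torus_addm. Qed.

(** A factor may be equal to [1] except the first one; as the first factor enters
    every ratio, all the ratios are still less than [1]. *)
Definition admissible (s : 'I_n -> R) : Prop :=
  forall i : 'I_n, 0 < s i /\ (if i == 0%N :> nat then s i < 1 else s i <= 1).

Lemma admissible_gt0 s i : admissible s -> 0 < s i.
Proof. by move=> /(_ i)[]. Qed.

Lemma wgt_gt0 s m : admissible s -> 0 < wgt s m.
Proof. by move=> ws; apply: prodr_gt0 => i _; rewrite exprn_gt0 // admissible_gt0. Qed.

Lemma wrate_gt0 s k : admissible s -> 0 < wrate s k.
Proof. by move=> ws; apply: prodr_gt0 => i _; exact: admissible_gt0. Qed.

Lemma wrate_lt1 s k : admissible s -> wrate s k < 1.
Proof.
move=> ws; have n0 : (0 < n)%N by exact: leq_trans (ltn_ord k).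
rewrite /wrate (bigD1 (Ordinal n0)) //=.
have [s0 s1] := ws (Ordinal n0); apply: le_lt_trans s1.
rewrite ger_pMr //; apply: prodr_ile1 => i _.
by have [si0 si1] := ws i; rewrite ltW //=; move: si1; case: ifP => // _ /ltW.
Qed.

(** The trace of the word against the diagonal weight. All terms are nonnegative, so
    it can be manipulated in the extended reals. *)
Definition wsum (s : 'I_n -> R) (w : seq gen) : \bar R :=
  esum setT (fun m => (wdiag q w m * wgt s m)%:E).

Lemma wdiag_ge0 w m : 0 <= wdiag q w m.
Proof. by rewrite mulr_ge0 // word_coef_ge0. Qed.

Lemma wdiag_wgt_ge0 s w m : admissible s -> 0 <= wdiag q w m * wgt s m.
Proof. by move=> /wgt_gt0 ws; rewrite mulr_ge0 ?wdiag_ge0 // ltW. Qed.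

Lemma wsum_fin s w : admissible s -> (wsum s w < +oo)%E.
Proof.
move=> ws; apply: le_lt_trans (esum_monomial_fin (t := wrate s) _); last first.
  by move=> i; rewrite wrate_gt0 // wrate_lt1.
apply: le_esum => m _; rewrite lee_fin -/(torus _ _) -wgtE ger_pMl ?wgt_gt0 //.
have /andP[c0 c1] := word_coef_itv q_gt0 q_lt1 w m.
by rewrite /wdiag; case: eqP; rewrite ?mulr1 ?mulr0.
Qed.

Lemma esum_shift i (a : multi -> R) : (forall m, m i = 0%N -> a m = 0) ->
  esum setT (fun m => (a m)%:E) = esum setT (fun m => (a (addm m (unitm i)))%:E).
Proof.
move=> a0.
have bij : set_bij setT [set m : multi | (0 < m i)%N]
    (fun m => addm m (unitm i)).
  split=> [m _|m k _ _|m /= mi]; first by rewrite /= !ffunE eqxx addn1.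
    exact: addIm.
  by exists (subm m (unitm i)) => //; rewrite submK // mle_unitm.
rewrite -(reindex_esum _ _ _ (fun m => (a m)%:E) bij) esum_mkcond.
apply: eq_esum => m _; case: ifPn => // /negP mi.
rewrite a0 //; apply/eqP; rewrite -leqn0 leqNgt; apply/negP => m0; apply: mi.
by rewrite inE.
Qed.

Lemma wdiag_cycle_z i w m :
  wdiag q (Fz i :: w) (addm m (unitm i)) = wdiag q (rcons w (Fz i)) m.
Proof.
rewrite /wdiag -cats1 word_coef_cat word_pos_cat /= mulr1.
rewrite (inj_eq (@addIm n (unitm i))); case: eqP => [->|]; last by rewrite !mulr0.
by congr (_ * _); rewrite mulrC.
Qed.

Lemma wdiag_cycle_zs i w m :
  wdiag q (rcons w (Fzs i)) (addm m (unitm i)) = wdiag q (Fzs i :: w) m.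
Proof.
rewrite /wdiag -cats1 word_coef_cat word_pos_cat -/(word_coef _ (Fzs i :: w) m).
rewrite [word_coef q [:: _] _]/= [word_pos [:: _] _]/= addmK mulr1.
rewrite [word_coef q (_ :: _) _]/= [word_pos (_ :: _) _]/=.
case: eqP => [->|ne]; first by rewrite addmK eqxx; congr (_ * _); rewrite mulrC.
rewrite mulr0; case: eqP => [e|_]; last by rewrite mulr0.
have [|/gen_coef_zs_neq0/submK e'] :=
    eqVneq (gen_coef q (Fzs i) (word_pos w m)) 0; first by move=> /= ->; rewrite !mul0r.
by case: ne; rewrite -e' e.
Qed.

Lemma wdiag_z0 i w (m : multi) : m i = 0%N -> wdiag q (Fz i :: w) m = 0.
Proof.
move=> m0; rewrite /wdiag; case: eqP => [e|_]; last by rewrite mulr0.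
by move: m0; rewrite -e /= !ffunE eqxx addn1.
Qed.

Lemma wdiag_zs0 i w (m : multi) : m i = 0%N -> wdiag q (rcons w (Fzs i)) m = 0.
Proof.
move=> m0; rewrite /wdiag -cats1 word_coef_cat /= m0.
by rewrite muln0 expr0 subrr mulr0 mul0r mulr0 mul0r.
Qed.

(** The cyclic property of the trace: the weight does not commute with the shift
    [z i] but is multiplied by its ratio. *)
Lemma wsum_cycle_z s i w : admissible s ->
  wsum s (Fz i :: w) = ((wrate s i)%:E * wsum s (rcons w (Fz i)))%E.
Proof.
move=> ws; rewrite /wsum (@esum_shift i); last first.
  by move=> m m0; rewrite wdiag_z0 // mul0r.
rewrite -esumZl ?wrate_gt0 // => [|m]; last exact: wdiag_wgt_ge0.
by apply: eq_esum => m _; rewrite wdiag_cycle_z wgt_addm mulrCA.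
Qed.

Lemma wsum_cycle_zs s i w : admissible s ->
  wsum s (rcons w (Fzs i)) = ((wrate s i)%:E * wsum s (Fzs i :: w))%E.
Proof.
move=> ws; rewrite /wsum (@esum_shift i); last first.
  by move=> m m0; rewrite wdiag_zs0 // mul0r.
rewrite -esumZl ?wrate_gt0 // => [|m]; last exact: wdiag_wgt_ge0.
by apply: eq_esum => m _; rewrite wdiag_cycle_zs wgt_addm mulrCA.
Qed.

(** The factor of a letter under the automorphism that multiplies each [z i] by
    [lam i]. *)
Definition gen_torus (lam : 'I_n -> R) (x : gen) : R :=
  match x with Fz i => lam i | Fzs i => (lam i)^-1 | Ff0 => 1 end.

Definition word_torus (lam : 'I_n -> R) (w : seq gen) : R :=
  \prod_(x <- w) gen_torus lam x.

Lemma word_torus_cons lam x w :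
  word_torus lam (x :: w) = gen_torus lam x * word_torus lam w.
Proof. exact: big_cons. Qed.

Lemma word_torus_cat lam u w :
  word_torus lam (u ++ w) = word_torus lam u * word_torus lam w.
Proof. exact: big_cat. Qed.

Lemma word_torusP lam w m : (forall i, lam i != 0) -> word_coef q w m != 0 ->
  torus lam (word_pos w m) = word_torus lam w * torus lam m.
Proof.
move=> lam0; elim: w => [_|x w IH] /=; first by rewrite /word_torus big_nil mul1r.
rewrite mulf_eq0 negb_or => /andP[x0 /IH e]; rewrite word_torus_cons -mulrA -e.
case: x x0 => [i _|i x0|_] /=; rewrite ?mul1r ?torus_addm //.
move/gen_coef_zs_neq0/submK: x0 => x0.
by rewrite -[in RHS]x0 torus_addm mulKf.
Qed.

Lemma word_torus_neq0 lam w : (forall i, lam i != 0) -> word_torus lam w != 0.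
Proof.
move=> l0; elim: w => [|x w IH]; first by rewrite /word_torus big_nil oner_neq0.
rewrite word_torus_cons mulf_neq0 //.
by case: x => [i|i|] /=; rewrite ?invr_eq0 ?oner_neq0.
Qed.

(** A word with a nonzero diagonal entry has degree zero, hence is fixed by the
    torus. *)
Lemma wdiag_torus lam w m : (forall i, lam i != 0) -> wdiag q w m != 0 ->
  word_torus lam w = 1.
Proof.
move=> l0; rewrite /wdiag mulf_eq0 negb_or => /andP[/(word_torusP l0) e].
case: (word_pos w m =P m) => [pm _|_]; last by rewrite eqxx.
by rewrite pm in e; apply: (mulIf (torus_neq0 m l0)); rewrite mul1r -e.
Qed.

Variable H : fock_space n q.
Local Notation I := (FU_integral H alpha).

Definition alpha_rate (i : 'I_n) : R :=
  if i == 0%N :> nat then q `^ (2 * (alpha + 1)) else q ^+ 2.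

Lemma FU_weightE m : FU_weight q alpha (to_partn m) = wgt alpha_rate m.
Proof.
apply: eq_bigr => i _; rewrite /alpha_rate /= ffunE; case: ifP => _.
  by rewrite -powR_mulrn ?powR_ge0 // -powRrM mulrAC.
by rewrite exprM.
Qed.

Definition mass : R := qpoch (q `^ (2 * alpha + 2)) (q ^+ 2) n.

(** By [coef00_diag] the integral is a weighted trace; the partitions are
    reindexed by exponents. *)
Lemma integral_real f (r : multi -> R) : (forall m, diag H f m = c (r m)) ->
  I f = c (mass * rsum (fun m => r m * wgt alpha_rate m)).
Proof.
move=> fr; rewrite /FU_integral rmorphM; congr (_ * _).
have bij : set_bij setT setT (@to_partn n).
  split=> [//|m k _ _ /to_partn_inj//|p _].
  by have [m mp] := to_partn_surj p; exists m.
rewrite /csum !(reindex_rsum _ bij) /comp.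
have term m : coef00 H f (spec_point q (to_partn m)) * c (FU_weight q alpha (to_partn m))
    = c (r m * wgt alpha_rate m).
  by rewrite coef00_diag // fr FU_weightE rmorphM.
apply/eqP; rewrite eq_complex /=; apply/andP; split; apply/eqP.
  by apply: eq_rsum => m; rewrite term.
by rewrite -[RHS](rsum0 R (Defs.multi n)); apply: eq_rsum => m; rewrite term.
Qed.

Lemma integral_word w :
  admissible alpha_rate -> I (word w) = c (mass * fine (wsum alpha_rate w)).
Proof.
move=> wa; rewrite (@integral_real _ (wdiag q w)); last by move=> m; rewrite diag_word.
by rewrite rsum_ge0 // => m; exact: wdiag_wgt_ge0.
Qed.

End Trace.

(** * The action on the generators *)

Section ModuleAction.
Variables (R : realType) (n : nat) (q : R).
Hypotheses (q_gt0 : 0 < q) (q_lt1 : q < 1).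
Local Notation C := R[i].
Local Notation FU := (FU n q).
Local Notation U := (Uq n q).
Local Notation gen := (FU_gen n).
Local Notation multi := (multi n).
Local Notation c x := ((x)%:C : C).
Local Notation word := (@word R n q).
Local Notation z := (@FU_z R n q).
Local Notation zs := (@FU_zs R n q).
Local Notation f0 := (@FU_f0 R n q).
Local Notation star := (@FU_star R n q).
Local Notation E := (@Uq_E R n q).
Local Notation F := (@Uq_F R n q).
Local Notation K := (@Uq_K R n q).
Local Notation KV := (@Uq_KV R n q).
Local Notation rq := (Num.sqrt q).
Implicit Types (w : seq gen) (m : multi) (i j k l : 'I_n).
Variables (Hopf : hopf_star_algebra U) (Uq_su : is_Uq_su Hopf).

Local Notation Uq_class := (@pclass _ (Uq_presentation n q)).

Lemma Uq_presented s t : Uq_rel q s t -> Uq_class s = Uq_class t.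
Proof. by move=> st; apply: pclass_eq; exact: pc_rel. Qed.

Lemma K_KV k : K k * KV k = 1.
Proof.
have := Uq_presented (Uq_KKV q k); rewrite pclass_mul pclass_cst scale1r; exact.
Qed.

Lemma KV_K k : KV k * K k = 1.
Proof.
have := Uq_presented (Uq_KVK q k); rewrite pclass_mul pclass_cst scale1r; exact.
Qed.

Lemma K_E k : K k * E k = c (q ^+ 2) *: (E k * K k).
Proof.
have := Uq_presented (Uq_KE q k k); rewrite !(pclass_mul, pclass_cst) /cartan eqxx.
by rewrite -scalerAl mul1r -scalerAl.
Qed.

Lemma hstarN x : hstar Hopf (- x) = - hstar Hopf x.
Proof.
have h0 : hstar Hopf 0 = 0.
  apply: (addrI (hstar Hopf 0)); rewrite addr0.
  by have := hstar_antilinear Hopf 1 0 0; rewrite rmorph1 !scale1r !addr0 => <-.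
have := hstar_antilinear Hopf (-1) x 0.
by rewrite rmorphN1 !scaleN1r h0 !addr0.
Qed.

Lemma antipode_KV k : antipode Hopf (KV k) = K k.
Proof.
have := antipodeM Hopf (K k) (KV k); rewrite K_KV antipode1 (antipode_K Uq_su).
move=> /(congr1 (fun x => x * K k)); rewrite -mulrA KV_K mulr1 mul1r => ->.
by [].
Qed.

(** [Delta] is multiplicative and [K k] is group-like, so its inverse is: the
    bilinear map is tested on [Delta (KV k * K k)] after a translation by
    [KV k]. *)
Lemma Delta_KV k : tensor_eq (Delta Hopf (KV k)) [:: (KV k, KV k)].
Proof.
move=> W B Bl Br.
pose B' a b := B (a * KV k) (b * KV k).
have B'l a : linear (B' a) by move=> x u v; rewrite /B' mulrDl -scalerAl Bl.
have B'r b : linear (B'^~ b) by move=> x u v; rewrite /B' mulrDl -scalerAl Br.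
have := DeltaM Hopf (KV k) (K k) B'l B'r; rewrite KV_K (Delta1 Hopf B'l B'r).
rewrite big_seq1 big_allpairs_dep /= {1}/B' !mul1r big_seq1 /= => ->.
apply: eq_bigr => p _.
have Dl a : linear (fun b => B' (p.1 * a) (p.2 * b)).
  by move=> x u v; rewrite mulrDr -scalerAr B'l.
have Dr b : linear (fun a => B' (p.1 * a) (p.2 * b)).
  by move=> x u v; rewrite mulrDr -scalerAr B'r.
rewrite (Delta_K Uq_su k Dl Dr) big_seq1 /= /B' -!mulrA K_KV !mulr1.
by [].
Qed.

Variables (act : U -> FU -> FU) (act_module : is_FU_module Hopf act).

Lemma act_algebra_action : is_algebra_action act.
Proof. by case: (FU_module_star_algebra act_module). Qed.

Lemma act_linear xi : linear (act xi).
Proof. by case: act_algebra_action. Qed.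

HB.instance Definition _ xi := GRing.isLinear.Build C FU FU _ (act xi) (act_linear xi).

Lemma act_linearl f : linear (act^~ f).
Proof. by case: act_algebra_action. Qed.

Lemma act_mul xi eta f : act (xi * eta) f = act xi (act eta f).
Proof. by case: act_algebra_action. Qed.

Lemma act_one f : act 1 f = f.
Proof. by case: act_algebra_action. Qed.

Lemma actZl a xi f : act (a *: xi) f = a *: act xi f.
Proof. exact: (scalable_linear (act_linearl f)). Qed.

Lemma actNl xi f : act (- xi) f = - act xi f.
Proof. by rewrite -scaleN1r actZl scaleN1r. Qed.

Lemma act_star xi f : star (act xi f) = act (hstar Hopf (antipode Hopf xi)) (star f).
Proof. by case: (FU_module_star_algebra act_module). Qed.

Lemma act_tensor xi (t : seq (U * U)) f g : tensor_eq (Delta Hopf xi) t ->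
  act xi (f * g) = \sum_(p <- t) act p.1 f * act p.2 g.
Proof.
case: (FU_module_star_algebra act_module) => _ -> _ _ tens.
apply: (tens _ (fun a b => act a f * act b g)).
  by move=> a x u v; rewrite act_linearl mulrDr scalerAr.
by move=> b x u v; rewrite act_linearl mulrDl scalerAl.
Qed.

Lemma act_EM k f g : act (E k) (f * g) = act (E k) f * g + act (K k) f * act (E k) g.
Proof. by rewrite (act_tensor _ _ (Delta_E Uq_su k)) big_cons big_seq1 /= act_one. Qed.

Lemma act_FM k f g : act (F k) (f * g) = act (F k) f * act (KV k) g + f * act (F k) g.
Proof. by rewrite (act_tensor _ _ (Delta_F Uq_su k)) big_cons big_seq1 /= act_one. Qed.

Lemma act_KM k f g : act (K k) (f * g) = act (K k) f * act (K k) g.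
Proof. by rewrite (act_tensor _ _ (Delta_K Uq_su k)) big_seq1. Qed.

Lemma act_K_KV k f : act (K k) (act (KV k) f) = f.
Proof. by rewrite -act_mul K_KV act_one. Qed.

Lemma act_KV_K k f : act (KV k) (act (K k) f) = f.
Proof. by rewrite -act_mul KV_K act_one. Qed.

Lemma act_KVM k f g : act (KV k) (f * g) = act (KV k) f * act (KV k) g.
Proof. by apply: (can_inj (act_KV_K k)); rewrite act_KM !act_K_KV. Qed.

Lemma act_K1 k : act (K k) 1 = 1.
Proof.
case: (FU_module_star_algebra act_module) => _ _ -> _.
by rewrite (counit_K Uq_su) scale1r.
Qed.

Lemma act_E1 k : act (E k) 1 = 0.
Proof.
case: (FU_module_star_algebra act_module) => _ _ -> _.
by rewrite (counit_E Uq_su) scale0r.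
Qed.

Lemma star_act_K k f : star (act (K k) f) = act (KV k) (star f).
Proof. by rewrite act_star (antipode_K Uq_su) (hstar_KV Uq_su). Qed.

(** The sign that distinguishes the involution of the noncompact form: the adjoint
    of [E k] is [sgn_last k] times [K k * F k]. *)
Definition sgn_last k : R := if is_last k then -1 else 1.

Lemma star_act_F k f :
  star (act (F k) f) = - (c (sgn_last k * q ^+ 2) *: act (E k) (star f)).
Proof.
rewrite act_star (antipode_F Uq_su) hstarN hstarM (hstar_K Uq_su) (hstar_F Uq_su).
rewrite actNl; congr (- _); rewrite /sgn_last.
have KEKV : K k * (E k * KV k) = c (q ^+ 2) *: E k.
  by rewrite mulrA K_E -scalerAl -mulrA K_KV mulr1.
by case: ifP => _; rewrite ?mulrN KEKV ?actNl actZl ?mul1r // mulN1r rmorphN scaleNr.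
Qed.

Definition K_weight k (i : 'I_n) : R :=
  if is_last k then (if i == k then q ^+ 2 else q)
  else if i == k then q else if i == k.+1 :> nat then q^-1 else 1.

Lemma K_weight_gt0 k i : 0 < K_weight k i.
Proof. by rewrite /K_weight; do 3?case: ifP => _; rewrite ?invr_gt0 ?exprn_gt0. Qed.

Lemma act_K_zE k i : act (K k) (z i) = c (K_weight k i) *: z i.
Proof.
rewrite /K_weight; case: ifP => kl; first by rewrite (act_Kn_z act_module).
by rewrite (act_K_z act_module) ?kl.
Qed.

Lemma act_K_zsE k i : act (K k) (zs i) = c (K_weight k i)^-1 *: zs i.
Proof.
have := star_act_K k (z i); rewrite act_K_zE starZc star_letter /= => e.
rewrite -[RHS](act_K_KV k) linearZ /= -e scalerA -rmorphM mulVf ?scale1r //.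
by rewrite gt_eqF // K_weight_gt0.
Qed.

Lemma act_K_letter k x :
  act (K k) (FU_letter q x) = c (gen_torus (K_weight k) x) *: FU_letter q x.
Proof.
case: x => [i|i|] /=; [exact: act_K_zE|exact: act_K_zsE|].
by rewrite scale1r; exact: (act_K_f0 act_module).
Qed.

Lemma act_K_word k w : act (K k) (word w) = c (word_torus (K_weight k) w) *: word w.
Proof.
elim: w => [|x w IH].
  by rewrite word_nil act_K1 /word_torus big_nil scale1r.
rewrite word_cons act_KM IH act_K_letter word_torus_cons -scalerAl -scalerAr scalerA.
by rewrite -rmorphM.
Qed.

(** The compatibility of the action with the involution turns the values of [F k]
    on the [z i] into those of [E k] on the [zs i]. *)
Lemma act_E_zs k i : act (E k) (zs i) =
  - (c (sgn_last k * q ^- 2) *: star (act (F k) (z i))).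
Proof.
rewrite star_act_F scalerN opprK scalerA -rmorphM star_letter /=.
suff -> : sgn_last k * q ^- 2 * (sgn_last k * q ^+ 2) = 1 by rewrite scale1r.
rewrite mulrACA mulVf ?expf_neq0 ?gt_eqF // mulr1 /sgn_last.
by case: ifP; rewrite ?mulr1 ?mulrNN ?mulr1.
Qed.

Definition Ecoef_last : R := rq / (1 - q ^+ 2).

Lemma one_sub_q2_neq0 : 1 - q ^+ 2 != 0 :> R.
Proof. by rewrite subr_eq0 eq_sym lt_eqF // exprn_ilt1 // ltW. Qed.

(** Both sides are twisted derivations: they satisfy
    [D (f g) = D f * g + K f * D g], so it suffices to compare them on letters. *)
Lemma act_E_last k f : is_last k ->
  act (E k) f = - (c Ecoef_last *: (z k * f - act (K k) f * z k)).
Proof.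
move=> kl.
have k_max i : i != k -> (i < k)%N.
  by move=> ik; rewrite ltn_neqAle ik /= -ltnS (eqP kl).
have q0 : q != 0 by rewrite gt_eqF.
have letter x : act (E k) (FU_letter q x)
    = - (c Ecoef_last *: (z k * FU_letter q x - act (K k) (FU_letter q x) * z k)).
  rewrite act_K_letter -scalerAl; case: x => [i|i|] /=.
  - rewrite -[FU_letter q (Fz i)]/(z i) (act_En_z act_module) // /K_weight kl.
    rewrite scaleNr; congr (- _); case: eqP => [->|/eqP /k_max ik].
      rewrite -[X in X - _]scale1r -scalerBl scalerA -(rmorphB (real_complex R) 1) -rmorphM.
      by rewrite /Ecoef_last divfK // one_sub_q2_neq0.
    rewrite (z_zE q ik) scalerA -rmorphM -expr2.
    rewrite -[X in X - _]scale1r -scalerBl scalerA -(rmorphB (real_complex R) 1) -rmorphM.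
    by rewrite /Ecoef_last divfK // one_sub_q2_neq0.
  - rewrite -[FU_letter q (Fzs i)]/(zs i) act_E_zs (act_Fn_z act_module) // /K_weight kl.
    rewrite /sgn_last kl; case: eqP => [->|/eqP ik].
      have -> : zs k * z k = c (q ^+ 2) *: (z k * zs k) + c (1 - q ^+ 2) *: 1.
        rewrite zs_z_diag big_pred0 ?subr0 // => j.
        by rewrite ltnNge -ltnS (eqP kl) ltn_ord.
      rewrite [X in _ - X]scalerDr !scalerA -!rmorphM mulVf ?expf_neq0 // scale1r.
      rewrite opprD addrA subrr sub0r scalerN starZc star1 !scalerA -!rmorphM opprK -scaleNr.
      rewrite -rmorphN; congr (c _ *: _).
      by rewrite /Ecoef_last; field; rewrite q0 one_sub_q2_neq0.
    rewrite star0 scaler0 oppr0 zs_zE // scalerA -rmorphM mulVf // scale1r subrr.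
    by rewrite scaler0 oppr0.
  - rewrite -[FU_letter q (Ff0 n)]/f0 scale1r f0_zE subr0 (act_En_f0 act_module) //.
    by rewrite scaleNr.
move: f; apply: FU_linear_ind => [w|a f g Ef Eg].
  elim: w => [|x w IH].
    by rewrite word_nil act_E1 act_K1 mulr1 mul1r subrr scaler0 oppr0.
  rewrite word_cons act_EM act_KM letter IH mulNr mulrN -scalerAl -scalerAr.
  rewrite -opprD -scalerDr mulrBl mulrBr !mulrA; congr (- (_ *: _)).
  by rewrite addrA subrK.
rewrite !linearP /= Ef Eg mulrDr mulrDl -scalerAr -scalerAl scalerN -opprD.
congr (- _); rewrite scalerA mulrC -scalerA -scalerDr; congr (_ *: _).
by rewrite scalerBr opprD addrACA.
Qed.

End ModuleAction.

(** * The generators of the unitary part as twisted commutators *)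

Section Invariance.
Variables (R : realType) (n : nat) (q : R).
Hypotheses (q_gt0 : 0 < q) (q_lt1 : q < 1).
Local Notation C := R[i].
Local Notation FU := (FU n q).
Local Notation U := (Uq n q).
Local Notation gen := (FU_gen n).
Local Notation multi := (multi n).
Local Notation c x := ((x)%:C : C).
Local Notation word := (@word R n q).
Local Notation z := (@FU_z R n q).
Local Notation zs := (@FU_zs R n q).
Local Notation f0 := (@FU_f0 R n q).
Local Notation y := (@FU_y R n q).
Local Notation E := (@Uq_E R n q).
Local Notation K := (@Uq_K R n q).
Local Notation rq := (Num.sqrt q).
Implicit Types (w : seq gen) (m : multi) (i j k l : 'I_n).
Variables (Hopf : hopf_star_algebra U) (Uq_su : is_Uq_su Hopf).
Variables (act : U -> FU -> FU) (act_module : is_FU_module Hopf act).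
HB.instance Definition _ xi :=
  GRing.isLinear.Build C FU FU _ (act xi) (act_linear act_module xi).
Variable H : fock_space n q.
Local Notation op := (@fock_act R n q H).

(** The torus element by which [y l] acts on the Fock space. *)
Definition y_weight l (i : 'I_n) : R := if (l <= i)%N then q ^+ 2 else 1.

Lemma y_weight_gt0 l i : 0 < y_weight l i.
Proof. by rewrite /y_weight; case: ifP; rewrite ?exprn_gt0. Qed.

Lemma torus_y_weight l m : torus (y_weight l) m = q ^+ (2 * msum_ge l m).
Proof.
rewrite /torus exprM /msum_ge -prodrXr [RHS]big_mkcond; apply: eq_bigr => i _.
by rewrite /y_weight; case: ifP; rewrite ?expr1n.
Qed.

Lemma y_word l w v :
  op (y l) (op (word w) v) = c (word_torus (y_weight l) w) *: op (word w) (op (y l) v).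
Proof.
move: v; apply: fock_linear_eq => [a u v|a u v|m]; first by rewrite !linearP.
  by rewrite !(linearP (op _)) /= scalerDr !scalerA mulrC.
rewrite word_fockb // y_fockb // !linearZ /= word_fockb // y_fockb // !scalerA.
have [->|c0] := eqVneq (word_coef q w m) 0; first by rewrite !(mul0r, mulr0, scale0r).
rewrite -!torus_y_weight (word_torusP _ c0); last by move=> i; rewrite gt_eqF ?y_weight_gt0.
by rewrite -!rmorphM; congr (c _ *: _); ring.
Qed.

Section Successor.
Variables (k l : 'I_n) (lk : l = k.+1 :> nat).

Lemma k_nlast : is_last k = false.
Proof. by rewrite /is_last -lk ltn_eqF. Qed.

Lemma l_neqk : l != k.
Proof. by apply/eqP => e; move: lk; rewrite e => /eqP; rewrite ltn_eqF. Qed.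

Lemma k_ltl : (k < l)%N. Proof. by rewrite lk. Qed.

Lemma y_split : y l = (1 - \sum_(j < n | (l < j)%N) z j * zs j) - z l * zs l.
Proof.
rewrite /FU_y (bigD1 l) //= opprD addrA addrAC; congr (1 - _ - _).
by apply: eq_bigl => j; rewrite ltn_neqAle eq_sym andbC.
Qed.

(** The relation for [zs l * z l] only involves the [y] of the next index;
    subtracting [z l * zs l] brings back [y l]. *)
Lemma zs_z_commutator : zs l * z l - z l * zs l = c (1 - q ^+ 2) *: y l.
Proof.
rewrite zs_z_diag y_split; move: (1 - \sum_(_ < _ | _) _) => S.
rewrite scalerBr addrAC addrC; congr (_ + _).
by rewrite rmorphB scalerBl scale1r opprB.
Qed.

Lemma zs_z_pred : zs k * z k = c (q ^+ 2) *: (z k * zs k) + c (1 - q ^+ 2) *: y l.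
Proof.
rewrite zs_z_diag; congr (_ + _ *: (1 - _)).
by apply: eq_bigl => j; rewrite lk.
Qed.

Definition Ecoef_nlast : R := q * rq / (1 - q ^+ 2).

Let q0 : q != 0. Proof. by rewrite gt_eqF. Qed.
Let q20 : 1 - q ^+ 2 != 0. Proof. exact: one_sub_q2_neq0. Qed.
Let rq0 : rq != 0. Proof. by rewrite gt_eqF ?sqrtr_gt0. Qed.
Let rqq : q = rq ^+ 2. Proof. by rewrite sqr_sqrtr // ltW. Qed.

Let rqV : rq^-1 = rq / q.
Proof. by apply: (mulIf q0); rewrite divfK // {2}rqq expr2 mulKf. Qed.

(** On the Fock space [E k] is implemented by [z k * zs l] times the inverse of
    [y l], an unbounded operator outside the algebra. Multiplying by [y l]
    clears the denominator: [E k] times [y l] is a twisted commutator with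
    [z k * zs l], where the torus factors record the passage of [y l] and of [K k]
    across the letter. *)
Lemma E_letter x v :
  op (act (E k) (FU_letter q x)) (op (y l) v)
  = c Ecoef_nlast *: (c (gen_torus (y_weight l) x)^-1 *: op (z k * zs l * FU_letter q x) v
              - c (gen_torus (K_weight q k) x) *: op (FU_letter q x * (z k * zs l)) v).
Proof.
have zero (X Y : FU) a b : act (E k) (FU_letter q x) = 0 -> a *: X = b *: Y ->
    op (act (E k) (FU_letter q x)) (op (y l) v)
    = c Ecoef_nlast *: (a *: op X v - b *: op Y v).
  by move=> -> XY; rewrite op0 -!opZ XY subrr scaler0.
have kn := k_nlast.
case: x zero => [i|i|] zero.
- have [il|il] := eqVneq i l.
    rewrite {zero}il -[FU_letter q (Fz l)]/(z l) (act_E_zk act_module lk).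
    rewrite /= /y_weight leqnn /K_weight kn (negPf l_neqk) lk eqxx.
    have zlk : z l * z k = c q^-1 *: (z k * z l).
      by rewrite (z_zE q k_ltl) scalerA -rmorphM mulVf // scale1r.
    rewrite (mulrA (z l)) zlk -scalerAl !opZ scalerA -rmorphM.
    rewrite (_ : q^-1 * q^-1 = (q ^+ 2)^-1); last by rewrite -invfM expr2.
    rewrite -scalerBr -opN -opD -!mulrA -mulrBr zs_z_commutator -scalerAr opZ.
    rewrite !scalerA -!rmorphM opM; congr (c _ *: _).
    by rewrite /Ecoef_nlast rqV; field; rewrite q0 q20.
  have iln : (i == l :> nat) = false by apply/negbTE.
  apply: zero; first by rewrite (act_E_z act_module) ?kn // -lk iln.
  rewrite -[FU_letter q (Fz i)]/(z i) /= -mulrA (@zs_zE R n q l i) 1?eq_sym //.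
  rewrite -scalerAr scalerA !mulrA /K_weight kn /y_weight -lk.
  have [ik|ki|/val_inj ->] := ltngtP i k.
  - rewrite (z_zE q ik) -scalerAl scalerA -!rmorphM; congr (c _ *: _).
    rewrite leqNgt (ltn_trans ik k_ltl) (_ : i == k = false); last first.
      by apply/negP => /eqP e; rewrite e ltnn in ik.
    by rewrite iln invr1 mulrC.
  - rewrite (z_zE q ki) -scalerAl scalerA -!rmorphM; congr (c _ *: _).
    rewrite {1}lk ki (_ : i == k = false); last first.
      by apply/negP => /eqP e; rewrite e ltnn in ki.
    by rewrite iln; field.
  rewrite eqxx leqNgt k_ltl -rmorphM; congr (c _ *: _).
  by rewrite invr1 mul1r.
- have [ik|ik] := eqVneq i k.
    rewrite {zero}ik /= -[FU_letter q (Fzs k)]/(zs k) (act_E_zs q_gt0 Uq_su act_module).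
    rewrite (act_F_zk act_module lk).
    rewrite starZc star_letter /= -[FU_letter q (Fzs l)]/(zs l).
    rewrite /y_weight leqNgt k_ltl /K_weight kn eqxx !invr1 scale1r.
    rewrite -(mulrA (z k) (zs l)) (zs_zsE q k_ltl) -scalerAr !mulrA zs_z_pred mulrDl.
    rewrite -!scalerAl [op (_ *: _ + _) _]opD !opZ [X in _ - X]scalerDr.
    rewrite 2!(scalerA (c q^-1)) -!rmorphM.
    rewrite (_ : q^-1 * q ^+ 2 = q); last by field.
    rewrite opprD addrA subrr sub0r opM -/(FU_letter q (Fzs l)).
    have := y_word l [:: Fzs l] v.
    rewrite /word big_seq1 /word_torus big_seq1 /= /y_weight leqnn => ->.
    rewrite scaleN1r scalerN !scalerA -!rmorphM; congr (- (c _ *: _)).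
    by rewrite /sgn_last kn /Ecoef_nlast; field; rewrite q0 q20.
  apply: zero.
    rewrite (act_E_zs q_gt0 Uq_su act_module) (act_F_z act_module) ?kn //.
    by rewrite star0 scaler0 oppr0.
  rewrite -[FU_letter q (Fzs i)]/(zs i) /= [in RHS]mulrA (zs_zE q ik).
  rewrite -scalerAl scalerA -!mulrA /K_weight kn (negPf ik) -lk /y_weight.
  have [il|li|/val_inj ->] := ltngtP i l.
  - rewrite (zs_zsE q il) -scalerAr scalerA -!rmorphM; congr (c _ *: _).
    by rewrite !invr1.
  - rewrite (zs_zsE q li) -scalerAr scalerA -!rmorphM; congr (c _ *: _).
    by rewrite invrK invr1 mul1r expr2.
  rewrite -rmorphM; congr (c _ *: _).
  by rewrite !invrK expr2.
- rewrite -[FU_letter q (Ff0 n)]/f0 (act_E_f0 act_module) ?kn //.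
  by rewrite -mulrA zs_f0E mulr0 mulrA f0_zE mul0r !op0 !scaler0 subrr scaler0.
Qed.

(** Both sides are twisted derivations, so the case of letters extends to words. *)
Lemma E_word w v :
  op (act (E k) (word w)) (op (y l) v)
  = c Ecoef_nlast *: (c (word_torus (y_weight l) w)^-1 *: op (z k * zs l * word w) v
              - c (word_torus (K_weight q k) w) *: op (word w * (z k * zs l)) v).
Proof.
elim: w => [|x w IH].
  rewrite word_nil (act_E1 Uq_su act_module) op0 mulr1 mul1r /word_torus !big_nil.
  by rewrite invr1 subrr scaler0.
have t0 : word_torus (y_weight l) w != 0.
  by apply: word_torus_neq0 => i; rewrite gt_eqF ?y_weight_gt0.
have yW : op (word w) (op (y l) v)
    = c (word_torus (y_weight l) w)^-1 *: op (y l) (op (word w) v).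
  by rewrite y_word scalerA -rmorphM mulVf // scale1r.
rewrite word_cons (act_EM Uq_su act_module) (act_K_letter q_gt0 Uq_su act_module).
rewrite -scalerAl opD opZ !opM yW IH !linearZ /= E_letter !word_torus_cons.
have key (a b b' d a' d' : R) (X Y W : H) : b = b' -> a = a' -> d = d' ->
    c a *: X - c b *: Y + (c b' *: Y - c d *: W) = c a' *: X - c d' *: W.
  by move=> -> -> ->; rewrite addrA subrK.
rewrite ?opM [op (FU_letter q x) (_ + _)]linearD /= !linearZ linearN /= ?opM.
rewrite !(scalerDr, scalerN, scalerA) -!rmorphM.
by apply: key; rewrite ?invfM; ring.
Qed.

End Successor.
End Invariance.

(** * Invariance of the integral *)

Section IntegralInvariance.
Variables (R : realType) (n : nat) (q alpha : R).
Hypotheses (q_gt0 : 0 < q) (q_lt1 : q < 1) (alpha_gt0 : 0 < alpha).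
Local Notation C := R[i].
Local Notation FU := (FU n q).
Local Notation U := (Uq n q).
Local Notation gen := (FU_gen n).
Local Notation multi := (multi n).
Local Notation c x := ((x)%:C : C).
Local Notation word := (@word R n q).
Local Notation z := (@FU_z R n q).
Local Notation zs := (@FU_zs R n q).
Local Notation E := (@Uq_E R n q).
Local Notation K := (@Uq_K R n q).
Implicit Types (w : seq gen) (m : multi) (i j k l : 'I_n).
Variables (Hopf : hopf_star_algebra U) (Uq_su : is_Uq_su Hopf).
Variables (act : U -> FU -> FU) (act_module : is_FU_module Hopf act).
HB.instance Definition _ xi :=
  GRing.isLinear.Build C FU FU _ (act xi) (act_linear act_module xi).
Variables (H : fock_space n q) (L : L2_space H alpha).
Local Notation I := (FU_integral H alpha).
Local Notation inner := (FU_inner H alpha).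
Local Notation dot := (L2_dot L).
Local Notation emb := (L2_emb L).

Lemma powR_lt1 x : 0 < x -> q `^ x < 1.
Proof.
move=> x0; have -> : 1 = 1 `^ x :> R by rewrite powR1.
by rewrite gt0_ltr_powR ?nnegrE ?ltW.
Qed.

Lemma alpha_rate_admissible : admissible (@alpha_rate R n q alpha).
Proof.
move=> i; rewrite /alpha_rate; case: ifP => _.
  by rewrite powR_gt0 // powR_lt1 // mulr_gt0 // addr_gt0.
by rewrite exprn_gt0 // exprn_ile1 // ltW.
Qed.

Lemma mass_gt0 : 0 < mass n q alpha.
Proof.
apply: prodr_gt0 => j _; rewrite subr_gt0; apply: (@le_lt_trans _ _ (q `^ (2 * alpha + 2))).
  by rewrite ger_pMr ?powR_gt0 // exprn_ile1 // ?exprn_ge0 ?exprn_ile1 // ltW.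
by rewrite powR_lt1 // addr_gt0 // mulr_gt0.
Qed.

HB.instance Definition _ := GRing.isLinear.Build C FU L _ emb (L2_emb_linear L).

Lemma innerE f g : inner f g = dot (emb f) (emb g).
Proof. by rewrite L2_emb_dot. Qed.

(** Linearity and symmetry of the scalar product, and linearity of the integral,
    are inherited from the scalar product of the completion, which extends it. *)
Lemma inner_linear g : linear_for *%R (inner^~ g).
Proof. by move=> a u v; rewrite !innerE linearP linearPl. Qed.

Lemma inner_conj f g : inner f g = Num.conj (inner g f).
Proof. by rewrite !innerE hermC mul1r. Qed.

Lemma innerZl a f g : inner (a *: f) g = a * inner f g.
Proof. by rewrite !innerE linearZ linearZl_LR. Qed.

Lemma innerZr a f g : inner f (a *: g) = Num.conj a * inner f g.
Proof. by rewrite inner_conj innerZl rmorphM (inner_conj f g). Qed.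

Lemma conj_cst (x : R) : Num.conj (c x) = c x.
Proof. by apply/conj_Creal/complex_realP; exists x. Qed.

Lemma conjZ (x : R) (y : C) : Num.conj (c x * y) = c x * Num.conj y.
Proof. by rewrite rmorphM; congr (_ * _); exact: conj_cst. Qed.

Lemma innerZcr (x : R) f g : inner f (c x *: g) = c x * inner f g.
Proof. by rewrite innerZr conj_cst. Qed.

Lemma innerBl f g h : inner (f - g) h = inner f h - inner g h.
Proof. by rewrite !innerE linearB linearBl. Qed.

Lemma inner_sumZl (T : Type) (s : seq T) (a : T -> C) (f : T -> FU) g :
  inner (\sum_(t <- s) a t *: f t) g = \sum_(t <- s) a t * inner (f t) g.
Proof.
elim: s => [|t s IH]; last by rewrite !big_cons inner_linear IH.
by rewrite !big_nil -(scale0r (0 : FU)) innerZl mul0r.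
Qed.

Lemma inner_sumZr (T : Type) (s : seq T) (a : T -> C) (f : T -> FU) g :
  inner g (\sum_(t <- s) a t *: f t) = \sum_(t <- s) Num.conj (a t) * inner g (f t).
Proof.
rewrite inner_conj inner_sumZl rmorph_sum; apply: eq_bigr => t _ /=.
by rewrite rmorphM [in RHS]inner_conj.
Qed.

Lemma integral_linear : linear_for *%R I.
Proof.
move=> a u v; have := inner_linear 1 a u v.
by rewrite /FU_inner star1 !mul1r.
Qed.

Lemma integral0 : I 0 = 0.
Proof. by have := innerZl 0 0 1; rewrite scale0r mul0r /FU_inner star1 mul1r. Qed.

Lemma integralZ a f : I (a *: f) = a * I f.
Proof. by have := integral_linear a f 0; rewrite integral0 !addr0. Qed.

Lemma integralD f g : I (f + g) = I f + I g.
Proof. by have := integral_linear 1 f g; rewrite scale1r mul1r. Qed.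

Lemma integralN f : I (- f) = - I f.
Proof. by rewrite -scaleN1r integralZ mulN1r. Qed.

Local Notation a_ := (@alpha_rate R n q alpha).

Lemma wsum_eq0 s w : (forall m, wdiag q w m = 0) -> wsum q s w = 0%E.
Proof. by move=> w0; rewrite /wsum esum1 // => m _; rewrite w0 mul0r. Qed.

(** [K k] multiplies a word by a torus factor, which is [1] as soon as the word has
    a nonzero trace. *)
Lemma integral_act_K k f : I (act (K k) f) = I f.
Proof.
move: f; apply: FU_linear_ind => [w|a f g If Ig]; last first.
  by rewrite linearP !integral_linear If Ig.
rewrite (act_K_word q_gt0 Uq_su act_module) integralZ /=.
have [[m wm]|w0] := pselect (exists m, wdiag q w m != 0).
  rewrite (wdiag_torus _ wm) ?mul1r // => i.
  by rewrite gt_eqF // K_weight_gt0.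
have w0' m : wdiag q w m = 0 by apply/eqP/negP => /negP wm; apply: w0; exists m.
rewrite integral_word //; last exact: alpha_rate_admissible.
by rewrite wsum_eq0 //= mulr0 mulr0.
Qed.

Lemma integral_cycle l f : I (z l * f) = c (wrate a_ l) * I (f * z l).
Proof.
move: f; apply: FU_linear_ind => [w|a f g If Ig].
  rewrite -[z l]/(FU_letter q (Fz l)) -word_cons.
  have -> : word w * FU_letter q (Fz l) = word (rcons w (Fz l)).
    by rewrite -cats1 word_cat word_cons word_nil mulr1.
  have wa := alpha_rate_admissible.
  rewrite !integral_word // wsum_cycle_z // fineM ?fin_numE //.
    by rewrite -rmorphM mulrCA.
  have := wsum_fin q_gt0 q_lt1 (rcons w (Fz l)) wa; rewrite ltey => ->.
  rewrite andbT -ltNye (lt_le_trans (ltNyr 0)) //; apply: esum_ge0 => m _.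
  by rewrite lee_fin wdiag_wgt_ge0.
by rewrite mulrDr mulrDl -scalerAr -scalerAl !integral_linear If Ig mulrDr mulrCA.
Qed.

(** This is the identity for which the coefficient of the twist is designed. *)
Lemma wrate_last k : is_last k -> wrate a_ k * q ^+ 2 = q `^ (2 * alpha + 2 * n%:R + 2).
Proof.
move=> kl; have n0 : (0 < n)%N by exact: leq_trans (ltn_ord k).
rewrite /wrate (eq_bigl xpredT); last by move=> i; rewrite -ltnS (eqP kl) ltn_ord.
rewrite (bigD1 (Ordinal n0)) //= {1}/alpha_rate /=.
rewrite (eq_bigr (fun=> q ^+ 2)); last first.
  move=> i i0; rewrite /alpha_rate -[0%N]/(val (Ordinal n0)).
  by rewrite (inj_eq val_inj) (negPf i0).
rewrite prodr_const cardC1 card_ord -mulrA -exprSr prednK // -exprM.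
rewrite -(powR_mulrn _ (ltW q_gt0)) natrM -powRD; last by rewrite (gt_eqF q_gt0) implybT.
by congr (_ `^ _); ring.
Qed.

(** By [E_word] the trace of [E k w] against the weight is, up to a factor, the
    difference of the traces of [z k * zs l * w] and of [w * (z k * zs l)] against
    the weight divided by the eigenvalue of [y l]. For that weight [z k] and
    [zs l] have inverse ratios, so the cyclic property makes the two traces equal. *)
Lemma integral_act_E k f : ~~ is_last k -> I (act (E k) f) = 0.
Proof.
move=> kn; have kn' : (k.+1 < n)%N by rewrite ltn_neqAle kn ltn_ord.
pose l := Ordinal kn'; have lk : l = k.+1 :> nat by [].
move: f; apply: FU_linear_ind => [w|a f g If Ig]; last first.
  by rewrite linearP integral_linear If Ig mulr0 addr0.
pose A := Fz k :: Fzs l :: w; pose B := rcons (rcons w (Fz k)) (Fzs l).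
pose ka := Ecoef_nlast q * q ^- 2.
have q0 : q != 0 by rewrite gt_eqF.
have ka0 : 0 < ka.
  rewrite /ka /Ecoef_nlast mulr_gt0 ?invr_gt0 ?exprn_gt0 // divr_gt0 ?mulr_gt0 ?sqrtr_gt0 //.
  by rewrite subr_gt0 exprn_ilt1 // ltW.
have ll : (l == k) = false by apply/negbTE; exact: l_neqk lk.
have yl0 i : y_weight q l i != 0 by rewrite gt_eqF // y_weight_gt0.
have Kl0 i : K_weight q k i != 0 by rewrite gt_eqF // K_weight_gt0.
(* A nonzero diagonal entry of [A] or [B] determines the degree of [w], so both torus
   factors of [w] can be replaced by the same power of [q]. *)
have sA m : (word_torus (y_weight q l) w)^-1 * wdiag q A m = q ^- 2 * wdiag q A m.
  have [->|/(wdiag_torus yl0)] := eqVneq (wdiag q A m) 0; first by rewrite !mulr0.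
  rewrite !word_torus_cons /= /y_weight leqnn leqNgt ltnSn mul1r => e.
  congr (_^-1 * _); apply: (mulfI (_ : q ^- 2 != 0)).
    by rewrite invr_eq0 expf_neq0.
  by rewrite e mulVf // expf_neq0.
have sB m : word_torus (K_weight q k) w * wdiag q B m = q ^- 2 * wdiag q B m.
  have [->|/(wdiag_torus Kl0)] := eqVneq (wdiag q B m) 0; first by rewrite !mulr0.
  rewrite /B -!cats1 !word_torus_cat !word_torus_cons /word_torus big_nil /= !mulr1.
  rewrite /K_weight (negPf kn) !eqxx ll invrK => e.
  congr (_ * _); apply: (mulIf q0); apply: (mulIf q0).
  by rewrite e -mulrA -expr2 mulVf // expf_neq0.
have dE m : diag H (act (E k) (word w)) m
    = c (ka * (torus (y_weight q l) m)^-1 * (wdiag q A m - wdiag q B m)).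
  have t0 := torus_neq0 m yl0.
  have := E_word q_gt0 q_lt1 Uq_su act_module lk w (fockb H m).
  rewrite y_fockb // -torus_y_weight linearZ /= => /(congr1 (fcoord m)).
  rewrite !(linearZ, linearB) /= -/(diag H _ m).
  have -> : z k * zs l * word w = word A by rewrite !word_cons mulrA.
  have -> : word w * (z k * zs l) = word B.
    by rewrite /B -!cats1 !word_cat !word_cons word_nil !mulr1 mulrA.
  rewrite -!/(diag H _ m) !diag_word // => e.
  have ct0 : c (torus (y_weight q l) m) != 0 by rewrite fmorph_eq0.
  apply: (mulfI ct0); rewrite e scalerN /GRing.scale /= -!rmorphM -rmorphB -rmorphM.
  congr (c _).
  by rewrite sA sB /ka; field; rewrite t0 q0.
rewrite (@integral_real _ _ _ alpha q_gt0 q_lt1 H _ _ dE).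
(* The weight divided by the eigenvalue of [y l]. *)
pose s i := if i == l then 1 else a_ i.
have ws : admissible s.
  move=> i; rewrite /s; case: eqP => [->|_]; last exact: alpha_rate_admissible.
  by rewrite ltr01 lexx.
have sE m : (torus (y_weight q l) m)^-1 * wgt a_ m = wgt s m.
  have t0 := torus_neq0 m yl0.
  apply: (mulfI t0); rewrite mulVKf // torus_y_weight /wgt.
  rewrite (bigD1 l) // [in RHS](bigD1 l) //= /s eqxx expr1n mul1r /alpha_rate /=.
  rewrite exprM; congr (_ * _); apply: eq_bigr => i /negPf ->.
  by [].
rewrite (eq_rsum (y := fun m =>
  ka * (wdiag q A m * wgt s m) - ka * (wdiag q B m * wgt s m))).
  rewrite rsum_sub0 ?mulr0 //.
  - by move=> m; rewrite mulr_ge0 ?wdiag_wgt_ge0 // ltW.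
  - by move=> m; rewrite mulr_ge0 ?wdiag_wgt_ge0 // ltW.
  - rewrite /comp !esumZl //; do 2?by move=> m; exact: wdiag_wgt_ge0.
    congr (_ * _)%E; rewrite -!/(wsum q s _) /A /B.
    rewrite wsum_cycle_z // wsum_cycle_zs //; congr (_%:E * _)%E.
    have sl : s l = 1 by rewrite /s eqxx.
    rewrite /wrate [RHS](bigD1 l) //= sl mul1r; apply: eq_bigl => i.
    rewrite -[i == l]/(i == k.+1 :> nat) [in RHS]leq_eqVlt ltnS.
    by case: eqP => [->|_]; rewrite ?ltnn ?andbT.
  - rewrite /comp esumZl //; last by move=> m; exact: wdiag_wgt_ge0.
    by rewrite lte_mul_pinfty ?lee_fin ?ltW // wsum_fin.
by move=> m; rewrite -sE; ring.
Qed.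

End IntegralInvariance.

(** * The twisted action on the whole function algebra *)

Section TwistedAction.
Variables (R : realType) (n : nat) (q alpha : R).
Hypotheses (q_gt0 : 0 < q) (q_lt1 : q < 1) (alpha_gt0 : 0 < alpha).
Local Notation C := R[i].
Local Notation FU := (FU n q).
Local Notation U := (Uq n q).
Local Notation c x := ((x)%:C : C).
Local Notation z := (@FU_z R n q).
Local Notation star := (@FU_star R n q).
Local Notation E := (@Uq_E R n q).
Local Notation F := (@Uq_F R n q).
Local Notation K := (@Uq_K R n q).
Local Notation KV := (@Uq_KV R n q).
Local Notation rq := (Num.sqrt q).
Implicit Types (i j k l : 'I_n).
Variables (Hopf : hopf_star_algebra U) (Uq_su : is_Uq_su Hopf).
Variables (act : U -> FU -> FU) (act_module : is_FU_module Hopf act).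
HB.instance Definition _ xi :=
  GRing.isLinear.Build C FU FU _ (act xi) (act_linear act_module xi).
Variables (H : fock_space n q) (L : L2_space H alpha).
Local Notation I := (FU_integral H alpha).
Local Notation inner := (FU_inner H alpha).
Let IZ := integralZ L.
Let IN := integralN L.
Let ID := integralD L.

Definition twist_scale k : R := if is_last k then q `^ (alpha + n%:R + 1) else 1.
Definition twist_coef k : R :=
  if is_last k then rq * ((1 - q `^ (2 * alpha + 2 * n%:R + 2)) / (1 - q ^+ 2)) else 0.

(** The formulas of the twisted action, on all functions. The common shape covers the
    generators of both kinds: away from the last index [twist_scale] is [1] and
    [twist_coef] is [0]. *)
Definition twE k f : FU := act (E k) f - c (twist_coef k) *: (act (K k) f * z k).
Definition twF k f : FU := c (twist_scale k)^-1 *: act (F k) f.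
Definition twK k f : FU := c (twist_scale k) *: act (K k) f.
Definition twKV k f : FU := c (twist_scale k)^-1 *: act (KV k) f.

Lemma twist_scale_neq0 k : twist_scale k != 0.
Proof. by rewrite /twist_scale; case: ifP; rewrite ?oner_neq0 // gt_eqF ?powR_gt0. Qed.

Lemma twK_twKV k f : twK k (twKV k f) = f.
Proof.
rewrite /twK /twKV linearZ /= (act_K_KV act_module) scalerA -rmorphM.
by rewrite mulfV ?twist_scale_neq0 // scale1r.
Qed.

Lemma twKV_twK k f : twKV k (twK k f) = f.
Proof.
rewrite /twK /twKV linearZ /= (act_KV_K act_module) scalerA -rmorphM.
by rewrite mulVf ?twist_scale_neq0 // scale1r.
Qed.

Lemma twK_twF k f : twK k (twF k f) = act (K k) (act (F k) f).
Proof.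
by rewrite /twK /twF linearZ /= scalerA -rmorphM mulfV ?twist_scale_neq0 // scale1r.
Qed.

Lemma twEM k f g : twE k (f * g) = act (E k) f * g + act (K k) f * twE k g.
Proof.
rewrite /twE (act_EM Uq_su act_module) (act_KM Uq_su act_module).
by rewrite mulrBr addrA -scalerAr mulrA.
Qed.

Lemma twFM k f g : twF k (f * g) = act (F k) f * twKV k g + f * twF k g.
Proof. by rewrite /twF /twKV (act_FM Uq_su act_module) -!scalerAr scalerDr. Qed.

Lemma twKM k f g : twK k (f * g) = act (K k) f * twK k g.
Proof. by rewrite /twK (act_KM Uq_su act_module) -scalerAr. Qed.

Lemma twKVM k f g : twKV k (f * g) = act (KV k) f * twKV k g.
Proof. by rewrite /twKV (act_KVM Uq_su act_module) -scalerAr. Qed.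

Lemma inner_act_K k f h : inner (act (K k) f) h = inner f (act (K k) h).
Proof.
rewrite /FU_inner (star_act_K Uq_su act_module).
rewrite -[RHS](integral_act_K q_gt0 q_lt1 alpha_gt0 Uq_su act_module L k).
by rewrite (act_KM Uq_su act_module) (act_K_KV act_module).
Qed.

Lemma star_act_KF k h : star (act (K k) (act (F k) h))
  = - (c (sgn_last R k) *: act (E k) (act (KV k) (star h))).
Proof.
rewrite (star_act_K Uq_su act_module) (star_act_F Uq_su act_module) linearN linearZ /=.
have -> : act (E k) (act (KV k) (star h)) = c (q ^+ 2) *: act (KV k) (act (E k) (star h)).
  rewrite -!(act_mul act_module) -(actZl act_module).
  rewrite -[E k * KV k]mul1r -(KV_K q k) -mulrA [K k * _]mulrA K_E.
  by rewrite -scalerAl -scalerAr -mulrA K_KV mulr1.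
by rewrite scalerA -rmorphM.
Qed.

(** Both sides are equal to minus the integral of [E k g * f], where [g] is
    [KV k] applied to [star h]. Away from the last index this is the invariance of
    the integral applied to [g * f]. At the last index [E k] is a twisted
    commutator with [z k]; the cyclic property moves [z k] to the front, and the
    resulting power of [q] cancels against the coefficient of the twist. *)
Lemma inner_twE k f h :
  inner (twE k f) h = c (sgn_last R k) * inner f (act (K k) (act (F k) h)).
Proof.
set g := act (KV k) (star h).
have Kg : act (K k) g = star h by rewrite (act_K_KV act_module).
have -> : c (sgn_last R k) * inner f (act (K k) (act (F k) h)) = - I (act (E k) g * f).
  rewrite /FU_inner star_act_KF mulNr -scalerAl IN IZ mulrN mulrA -rmorphM.
  have -> : sgn_last R k * sgn_last R k = 1.
    by rewrite /sgn_last; case: ifP; rewrite ?mulrNN mulr1.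
  by rewrite mul1r.
rewrite /FU_inner /twE /twist_coef; have [kl|kn] := boolP (is_last k); last first.
  have := integral_act_E q_gt0 q_lt1 alpha_gt0 Uq_su act_module L (g * f) kn.
  rewrite (act_EM Uq_su act_module) Kg ID /= scale0r subr0 addrC.
  by move/eqP; rewrite addr_eq0 => /eqP.
have Ek f' := act_E_last q_gt0 q_lt1 Uq_su act_module f' kl.
have zgf : I (z k * g * f) = c (q ^+ 2) * I (z k * (star h * act (K k) f)).
  rewrite -(integral_act_K q_gt0 q_lt1 alpha_gt0 Uq_su act_module L k).
  rewrite !(act_KM Uq_su act_module) Kg (act_K_zE act_module) /K_weight kl eqxx.
  by rewrite -!scalerAl IZ mulrA.
have cyc := integral_cycle q_gt0 q_lt1 alpha_gt0 L k (star h * act (K k) f).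
set Q := q `^ _; set X := z k * f; set Y := act (K k) f * z k.
have -> : act (E k) f - c (rq * ((1 - Q) / (1 - q ^+ 2))) *: Y
    = c (Ecoef_last q) *: (c Q *: Y - X).
  rewrite Ek (_ : rq * _ = Ecoef_last q * (1 - Q)); last by rewrite /Ecoef_last mulrA mulrAC.
  have -> : c (Ecoef_last q * (1 - Q)) *: Y = c (Ecoef_last q) *: (Y - c Q *: Y).
    by rewrite rmorphM -scalerA rmorphB scalerBl scale1r.
  by rewrite -opprD -scalerDr -scalerN opprD !opprB addrC addrA subrK.
rewrite Ek Kg mulNr IN opprK -!scalerAl -scalerAr !IZ; congr (_ * _).
rewrite mulrBl mulrBr !ID !IN -scalerAr IZ zgf cyc -(mulrA (star h)) -/Y.
rewrite (mulrA (star h)) -/X; congr (_ - _); last by rewrite mulrA.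
have -> : c Q = c (q ^+ 2) * c (wrate (alpha_rate q alpha) k).
  by rewrite -rmorphM mulrC wrate_last.
by rewrite -(mulrA (c (q ^+ 2))).
Qed.

Lemma inner_twK k f h : inner (twK k f) h = inner f (twK k h).
Proof. by rewrite /twK (innerZl L) (innerZcr L) inner_act_K. Qed.

Lemma inner_twKV k f h : inner (twKV k f) h = inner f (twKV k h).
Proof. by rewrite -{1}(twK_twKV k h) -inner_twK twK_twKV. Qed.

Lemma inner_twE_twF k f h :
  inner (twE k f) h = c (sgn_last R k) * inner f (twK k (twF k h)).
Proof. by rewrite inner_twE twK_twF. Qed.

(** The adjoint of [E k] determines that of [F k] by Hermitian symmetry. *)
Lemma inner_twF k f h : inner (twF k f) h = c (sgn_last R k) * inner f (twE k (twKV k h)).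
Proof.
rewrite -{1}(twKV_twK k (twF k f)) inner_twKV (inner_conj L).
rewrite [in RHS](inner_conj L) inner_twE_twF conjZ mulrA -rmorphM.
have -> : sgn_last R k * sgn_last R k = 1.
  by rewrite /sgn_last; case: ifP; rewrite ?mulrNN mulr1.
by rewrite mul1r.
Qed.

End TwistedAction.

(** * The Bergman projection *)

Section Projection.
Variables (R : realType) (n : nat) (q alpha : R).
Hypotheses (q_gt0 : 0 < q) (q_lt1 : q < 1) (alpha_gt0 : 0 < alpha).
Local Notation C := R[i].
Local Notation FU := (FU n q).
Local Notation Cz := (Cz n q).
Local Notation gen := (FU_gen n).
Local Notation multi := (multi n).
Local Notation c x := ((x)%:C : C).
Local Notation word := (@word R n q).
Local Notation z := (@FU_z R n q).
Local Notation star := (@FU_star R n q).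
Local Notation holo := (@holo R n q).
Local Notation zpow := (@zpow R n q).
Implicit Types (w : seq gen) (m p : multi) (i j : 'I_n).
Variables (H : fock_space n q) (L : L2_space H alpha).
Local Notation inner := (FU_inner H alpha).
Local Notation dot := (L2_dot L).
Local Notation emb := (L2_emb L).

Lemma star_zpow m : star (zpow m) = zspow q m.
Proof.
rewrite /Defs.zpow /zspow -[in RHS](revK (enum 'I_n)).
elim: (rev (enum 'I_n)) => [|i s IH]; first by rewrite !big_nil star1.
rewrite big_cons starM IH rev_cons big_rcons /=; congr (_ * _).
elim: (m i) => [|k IHk]; first by rewrite star1.
by rewrite exprS exprSr starM IHk star_letter.
Qed.

Lemma inner_word_zpow w m :
  inner (word w) (zpow m) = c (mass n q alpha * rsum (fun k =>
    wdiag q (zs_word m ++ w) k * wgt (@alpha_rate R n q alpha) k)).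
Proof.
rewrite /FU_inner star_zpow -word_zs -word_cat.
rewrite (@integral_real _ _ _ alpha q_gt0 q_lt1 H _ (wdiag q (zs_word m ++ w))) //.
by move=> k; rewrite diag_word.
Qed.

(** The only exponent at which a polynomial monomial can pair nontrivially with the
    word; it is truncated, so it is a multi-index even for words of mixed degree. *)
Definition word_degree w : multi := subm (word_up w) (word_down w).

Lemma inner_word_zpow0 w m : m != word_degree w -> inner (word w) (zpow m) = 0.
Proof.
move=> mw; rewrite inner_word_zpow (eq_rsum (y := fun=> 0)) ?rsum0 ?mulr0 // => k.
have [->|] := eqVneq (wdiag q (zs_word m ++ w) k) 0; first by rewrite mul0r.
rewrite /wdiag mulf_eq0 negb_or => /andP[/word_balance/ffunP e].
case: (word_pos _ k =P k) => [ek _|_]; last by rewrite eqxx.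
case/eqP: mw; apply/ffunP => i; have := e i; rewrite ek !ffunE.
have := congr1 (fun u : multi => u i) (up_zs m).
have := congr1 (fun u : multi => u i) (down_zs m).
by rewrite !ffunE !count_cat => -> ->; rewrite add0n => /addnI <-; rewrite addnK.
Qed.

Lemma zpow_norm_neq0 m : inner (zpow m) (zpow m) != 0.
Proof.
rewrite -{1}word_z inner_word_zpow fmorph_eq0 mulf_neq0 ?gt_eqF ?mass_gt0 //.
have wa := @alpha_rate_admissible R n q alpha q_gt0 q_lt1 alpha_gt0.
apply: (rsum_gt0 (i := multi0 n)) => [k||].
- exact: wdiag_wgt_ge0.
- rewrite mulr_gt0 ?wgt_gt0 // /wdiag word_coef_cat word_pos_cat.
  rewrite (z_word_pos q_gt0) (zs_word_pos q_gt0 q_lt1) ?mle_addl // addmK eqxx mulr1.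
  by rewrite mulr_gt0 ?z_word_coef_gt0 ?zs_word_coef_gt0 ?mle_addl.
- exact: wsum_fin.
Qed.

Lemma zpow_holo m : zpow m \in holo.
Proof.
apply/asboolP => S [S1 _ SM] Sz; rewrite /Defs.zpow.
elim: (rev _) => [|i s IH]; rewrite ?big_nil ?big_cons //.
by apply: (SM) => //; elim: (m i) => [//|k IHk]; rewrite exprS; apply: (SM).
Qed.

Lemma sum_pairs (s : seq (C * multi)) : exists (t : seq multi) (a : multi -> C),
  uniq t /\ \sum_(x <- s) x.1 *: zpow x.2 = \sum_(m <- t) a m *: zpow m.
Proof.
exists (undup (map snd s)), (fun m => \sum_(x <- s | x.2 == m) x.1).
split; first exact: undup_uniq.
under [RHS]eq_bigr do rewrite scaler_suml.
rewrite (exchange_big_dep xpredT) //=; apply: eq_big_seq => x xs.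
rewrite -big_filter (perm_big [:: x.2]) ?big_seq1 //.
apply: uniq_perm; rewrite ?filter_uniq ?undup_uniq // => m.
rewrite mem_filter mem_undup inE eq_sym; case: eqP => //= ->.
by apply/mapP; exists x.
Qed.

(** The span of the monomials is a subalgebra, because [z i] maps a monomial to
    a multiple of a monomial. *)
Lemma holo_span f : f \in holo -> exists (t : seq multi) (a : multi -> C),
  uniq t /\ f = \sum_(m <- t) a m *: zpow m.
Proof.
pose S : {pred FU} := fun f => `[< exists s : seq (C * multi),
  f = \sum_(x <- s) x.1 *: zpow x.2 >].
have Sz0 : 0 \in S by apply/asboolP; exists [::]; rewrite big_nil.
have Slin a u v : u \in S -> v \in S -> a *: u + v \in S.
  move=> /asboolP[s ->] /asboolP[t ->]; apply/asboolP.
  exists ([seq (a * x.1, x.2) | x <- s] ++ t).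
  rewrite big_cat big_map scaler_sumr; congr (_ + _).
  by apply: eq_bigr => x _; rewrite scalerA.
have SD u v : u \in S -> v \in S -> u + v \in S.
  by move=> us vs; rewrite -[u]scale1r Slin.
have SZ a u : u \in S -> a *: u \in S.
  by move=> us; rewrite -[_ *: _]addr0 Slin.
have Sm m : zpow m \in S.
  by apply/asboolP; exists [:: (1, m)]; rewrite big_seq1 scale1r.
have Ssum (s : seq (C * multi)) (g : multi -> FU) : (forall m, g m \in S) ->
    \sum_(x <- s) x.1 *: g x.2 \in S.
  move=> fS; elim: s => [|x s IH]; rewrite ?big_nil ?big_cons //.
  by rewrite SD // SZ.
have SzM i u : u \in S -> z i * u \in S.
  move=> /asboolP[s ->]; rewrite mulr_sumr.
  rewrite (eq_bigr (fun x => x.1 *: (z i * zpow x.2))); last first.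
    by move=> x _; rewrite scalerAr.
  by apply: (Ssum s (fun m => z i * zpow m)) => m; rewrite z_zpow SZ.
have SmM m u : u \in S -> zpow m * u \in S.
  rewrite /Defs.zpow; elim: (rev _) => [|i s IH] us; rewrite ?big_nil ?big_cons ?mul1r //.
  rewrite -mulrA; elim: (m i) => [|k IHk]; first by rewrite mul1r IH.
  by rewrite exprS -mulrA SzM.
have Salg : subalg_closed S.
  split=> [||u v].
  - by rewrite -(zpow0 n q) Sm.
  - by move=> a u v; exact: Slin.
  move=> /asboolP[s ->] vS; rewrite mulr_suml.
  rewrite (eq_bigr (fun x => x.1 *: (zpow x.2 * v))); last first.
    by move=> x _; rewrite scalerAl.
  by apply: (Ssum s (fun m => zpow m * v)) => m; exact: SmM.
move=> /asboolP/(_ S Salg).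
have Sz i : z i \in S by rewrite -[z i]mulr1 SzM // -(zpow0 n q) Sm.
move=> /(_ Sz)/asboolP[s ->]; exact: sum_pairs.
Qed.

Lemma Cz_valP a (u v : Cz) : Cz_val (a *: u + v) = a *: Cz_val u + Cz_val v.
Proof. exact: (linearP (\val : Cz -> FU)). Qed.

Definition Cz_zpow m : Cz := MkCz (zpow_holo m).

(** The monomials are orthogonal and of nonzero norm, so the scalar products with
    them determine the coefficients of a polynomial. *)
Lemma Cz_orth_uniq (u v : Cz) :
  (forall x : Cz, inner u x = inner v x) -> u = v.
Proof.
move=> uv; apply/val_inj/eqP; rewrite -subr_eq0 /=; apply/eqP.
have [t [a [ut e]]] : exists (t : seq multi) (a : multi -> C),
    uniq t /\ (u : FU) - (v : FU) = \sum_(m <- t) a m *: zpow m.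
  apply: holo_span; have -> : (u : FU) - (v : FU) = Cz_val (-1 *: v + u).
    by rewrite Cz_valP scaleN1r addrC.
  exact: valP.
have a0 m : m \in t -> a m = 0.
  move=> mt; have := uv (Cz_zpow m) => /eqP.
  rewrite -subr_eq0 -(innerBl L) e (inner_sumZl L) (big_rem m) //= big1_seq ?addr0.
    by rewrite mulf_eq0 (negPf (zpow_norm_neq0 m)) orbF => /eqP.
  move=> k /= kt; rewrite -word_z inner_word_zpow0 ?mulr0 //.
  rewrite /word_degree up_z down_z subm0; apply/eqP => mk.
  by move: kt; rewrite -mk mem_rem_uniqF.
by rewrite e big1_seq // => m /a0 ->; rewrite scale0r.
Qed.

(** A word is orthogonal to all monomials but one, so its projection is a multiple
    of that monomial. *)
Lemma proj_exists f : exists u : Cz, forall x : Cz, inner f x = inner u x.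
Proof.
move: f; apply: FU_linear_ind => [w|a f g [u fu] [v gv]]; last first.
  by exists (a *: u + v) => x; rewrite Cz_valP !(inner_linear L) fu gv.
pose m := word_degree w; pose N := inner (zpow m) (zpow m).
pose b : C := inner (word w) (zpow m) / N.
exists (b *: Cz_zpow m) => x.
have -> : Cz_val (b *: Cz_zpow m) = b *: zpow m.
  by have := Cz_valP b (Cz_zpow m) 0; rewrite !addr0.
have [t [a [_ ->]]] := holo_span (valP x).
rewrite !(inner_sumZr L); apply: eq_bigr => k _; congr (_ * _).
rewrite (innerZl L); have [->|km] := eqVneq k m.
  by rewrite /b divfK // zpow_norm_neq0.
rewrite inner_word_zpow0 // -word_z inner_word_zpow0 ?mulr0 //.
by rewrite /word_degree up_z down_z subm0.
Qed.

Lemma dot_CauchySchwarz (u v : L) : `|dot u v| ^+ 2 <= dot u u * dot v v.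
Proof.
have [->|u0] := eqVneq u 0; first by rewrite !linear0l normr0 expr0n mul0r.
have uu : 0 < dot u u by exact: neq0_dnorm_gt0.
have uv : dot v u = Num.conj (dot u v) by rewrite hermC mul1r.
(* A multiple of the component of [v] orthogonal to [u]. *)
pose x := dot u u *: v - dot v u *: u.
have xx : 0 <= dot x x.
  by have [->|/neq0_dnorm_gt0/ltW//] := eqVneq x 0; rewrite linear0l.
have xu : dot x u = 0.
  by rewrite linearBl !linearZl_LR mulrC subrr.
have : dot x x = dot u u * (dot u u * dot v v - `|dot u v| ^+ 2).
  rewrite -[LHS]/(dot x (dot u u *: v - dot v u *: u)) linearBr !linearZr_LR /= xu.
  rewrite mulr0 subr0 /x linearBl !linearZl_LR.
  rewrite uv normCK geC0_conj ?ltW //; congr (_ * (_ - _)).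
  by rewrite mulrC.
move=> e; move: xx; rewrite e pmulr_rge0 // subr_ge0.
exact.
Qed.

Lemma dot_closure0 (V : set L) u v :
  (forall x, V x -> dot u x = 0) -> closure V v -> dot u v = 0.
Proof.
move=> uV Vv; apply/eqP; apply/negPn/negP => d0.
set d := `|dot u v|; have d_gt0 : 0 < d by rewrite normr_gt0.
have N0 : 0 < `|u| + 1 by rewrite ltr_wpDl.
(* The summand [1] makes the denominator positive even if [u] vanishes. *)
have e0 : 0 < d / (`|u| + 1) by rewrite divr_gt0.
have [x [Vx]] := Vv _ (nbhsx_ballx v _ e0).
rewrite -ball_normE /= => vx.
have : d <= `|u| * `|v - x|.
  rewrite -ler_sqr; [|by rewrite nnegrE normr_ge0|by rewrite nnegrE mulr_ge0].
  rewrite exprMn !L2_norm.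
  have -> : d = `|dot u (v - x)| by rewrite linearBr /= (uV x Vx) subr0.
  exact: dot_CauchySchwarz.
apply/negP; rewrite -real_ltNge ?ger0_real ?mulr_ge0 ?(ltW d_gt0) //.
apply: (@le_lt_trans _ _ (`|u| * (d / (`|u| + 1)))).
  by rewrite ler_wpM2l // ltW.
by rewrite mulrA ltr_pdivrMr // mulrC ltr_pM2l // ltrDl.
Qed.

Local Notation V := (closure [set emb (psi : FU) | psi in [set: Cz]]).

Lemma bergman_projE f (u : Cz) : (forall x : Cz, inner f x = inner u x) ->
  bergman_proj (emb f) = emb u.
Proof.
move=> fu.
have Pu : is_orth_proj V (emb f) (emb u).
  split; first by apply: subset_closure; exists u.
  move=> v; apply: dot_closure0 => _ [x _ <-].
  by rewrite linearBl /= -!innerE fu subrr.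
rewrite /bergman_proj /orth_proj; apply: xget_unique => // p [Vp fp].
have [Vu fu'] := Pu.
apply/eqP; rewrite -subr_eq0; apply/negPn/negP => /(@neq0_dnorm_gt0 _ _ _ dot).
have pu v : V v -> dot (p - emb u) v = 0.
  move=> Vv; have := fu' v Vv; have := fp v Vv.
  rewrite !linearBl /= => /eqP; rewrite subr_eq0 => /eqP e1 /eqP.
  by rewrite e1 => /eqP.
by rewrite linearBr /= !pu // subrr ltxx.
Qed.

(** Toeplitz operators are only ever used through this characterization by scalar
    products with polynomials. *)
Lemma toeplitzE f (psi u : Cz) : (forall x : Cz, inner (f * (psi : FU)) x = inner u x) ->
  toeplitz L f psi = u.
Proof.
move=> fu; apply: xget_unique => /= [|v]; rewrite (bergman_projE fu) // => ev.
by apply: Cz_orth_uniq => x; rewrite !(innerE L) ev.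
Qed.

Lemma toeplitzP f (psi x : Cz) :
  inner (f * (psi : FU)) x = inner (toeplitz L f psi) x.
Proof.
have [u fu] := proj_exists (f * (psi : FU)).
by rewrite (toeplitzE fu).
Qed.

End Projection.

(** * Equivariance of the Toeplitz operators *)

Section Equivariance.
Variables (R : realType) (n : nat) (q alpha : R).
Hypotheses (q_gt0 : 0 < q) (q_lt1 : q < 1) (alpha_gt0 : 0 < alpha).
Local Notation C := R[i].
Local Notation FU := (FU n q).
Local Notation Cz := (Cz n q).
Local Notation U := (Uq n q).
Local Notation E := (@Uq_E R n q).
Local Notation F := (@Uq_F R n q).
Local Notation K := (@Uq_K R n q).
Local Notation KV := (@Uq_KV R n q).
Implicit Types (k : 'I_n) (f : FU) (psi : Cz).
Variables (Hopf : hopf_star_algebra U) (Uq_su : is_Uq_su Hopf).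
Variables (act : U -> FU -> FU) (act_module : is_FU_module Hopf act).
HB.instance Definition _ xi :=
  GRing.isLinear.Build C FU FU _ (act xi) (act_linear act_module xi).
Variables (H : fock_space n q) (L : L2_space H alpha).
Variables (pi : U -> Cz -> Cz) (pi_twisted : is_twisted_action act alpha pi).
Local Notation inner := (FU_inner H alpha).
Local Notation T := (toeplitz L).

Lemma toeplitz_linear f : linear (T f).
Proof.
move=> a u v; apply: (toeplitzE q_gt0 q_lt1 alpha_gt0) => x.
rewrite !Cz_valP mulrDr -scalerAr !(inner_linear L).
by rewrite !(toeplitzP q_gt0 q_lt1 alpha_gt0 L).
Qed.

Lemma toeplitz_linearl a f g psi : T (a *: f + g) psi = a *: T f psi + T g psi.
Proof.
apply: (toeplitzE q_gt0 q_lt1 alpha_gt0) => x.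
rewrite !Cz_valP mulrDl -scalerAl !(inner_linear L).
by rewrite !(toeplitzP q_gt0 q_lt1 alpha_gt0 L).
Qed.

HB.instance Definition _ f := GRing.isLinear.Build C Cz Cz _ (T f) (toeplitz_linear f).

Lemma pi_linear xi : linear (pi xi).
Proof. by case: (twisted_action pi_twisted). Qed.

HB.instance Definition _ xi := GRing.isLinear.Build C Cz Cz _ (pi xi) (pi_linear xi).

Lemma pi_linearl psi : linear (pi^~ psi).
Proof. by case: (twisted_action pi_twisted). Qed.

Lemma pi1 psi : pi 1 psi = psi.
Proof. by case: (twisted_action pi_twisted). Qed.

Lemma pi_mul xi eta psi : pi (xi * eta) psi = pi xi (pi eta psi).
Proof. by case: (twisted_action pi_twisted). Qed.

Lemma pi_scale a xi psi : pi (a *: xi) psi = a *: pi xi psi.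
Proof. exact: (scalable_linear (pi_linearl psi)). Qed.

Lemma pi_opp xi psi : pi (- xi) psi = - pi xi psi.
Proof. by rewrite -scaleN1r pi_scale scaleN1r. Qed.

Lemma pi_twE k psi : pi (E k) psi = twE alpha act k psi :> FU.
Proof.
rewrite /twE /twist_coef; have [kl|kn] := boolP (is_last k).
  by rewrite (pi_En pi_twisted).
by rewrite (pi_E pi_twisted) // scale0r subr0.
Qed.

Lemma pi_twF k psi : pi (F k) psi = twF alpha act k psi :> FU.
Proof.
rewrite /twF /twist_scale; have [kl|kn] := boolP (is_last k).
  by rewrite (pi_Fn pi_twisted) // powRN.
by rewrite (pi_F pi_twisted) // invr1 scale1r.
Qed.

Lemma pi_twK k psi : pi (K k) psi = twK alpha act k psi :> FU.
Proof.
rewrite /twK /twist_scale; have [kl|kn] := boolP (is_last k).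
  by rewrite (pi_Kn pi_twisted).
by rewrite (pi_K pi_twisted) // scale1r.
Qed.

Lemma pi_twKV k psi : pi (KV k) psi = twKV alpha act k psi :> FU.
Proof.
rewrite /twKV /twist_scale; have [kl|kn] := boolP (is_last k).
  by rewrite (pi_KVn pi_twisted) // powRN.
by rewrite (pi_KV pi_twisted) // invr1 scale1r.
Qed.

(** [psi] is the Bergman projection of [f], expressed without the completion. *)
Definition projects_to f psi : Prop := forall x : Cz, inner f x = inner psi x.

(** The adjoint of a generator maps polynomials to polynomials, so it can be moved
    onto the test polynomial and back. *)
Lemma projects_to_twE k f psi :
  projects_to f psi -> projects_to (twE alpha act k f) (pi (E k) psi).
Proof.
move=> fp x; rewrite pi_twE !(inner_twE_twF q_gt0 q_lt1 alpha_gt0 Uq_su act_module L).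
by rewrite -pi_twF -pi_twK fp.
Qed.

Lemma projects_to_twF k f psi :
  projects_to f psi -> projects_to (twF alpha act k f) (pi (F k) psi).
Proof.
move=> fp x; rewrite pi_twF !(inner_twF q_gt0 q_lt1 alpha_gt0 Uq_su act_module L).
by rewrite -pi_twKV -pi_twE fp.
Qed.

Lemma projects_to_twK k f psi :
  projects_to f psi -> projects_to (twK alpha act k f) (pi (K k) psi).
Proof.
move=> fp x; rewrite pi_twK !(inner_twK q_gt0 q_lt1 alpha_gt0 Uq_su act_module L).
by rewrite -pi_twK fp.
Qed.

Lemma projects_to_twKV k f psi :
  projects_to f psi -> projects_to (twKV alpha act k f) (pi (KV k) psi).
Proof.
move=> fp x; rewrite pi_twKV !(inner_twKV q_gt0 q_lt1 alpha_gt0 Uq_su act_module L).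
by rewrite -pi_twKV fp.
Qed.

Lemma projects_to_toeplitz f psi : projects_to (f * (psi : FU)) (T f psi).
Proof. by move=> x; rewrite (toeplitzP q_gt0 q_lt1 alpha_gt0 L). Qed.

Lemma projects_toB f g u v :
  projects_to f u -> projects_to g v -> projects_to (f - g) (u - v).
Proof.
move=> fu gv x; have -> : Cz_val (u - v) = Cz_val u - Cz_val v.
  by rewrite -[u - v]addrC -[- v]scaleN1r Cz_valP scaleN1r addrC.
by rewrite !(innerBl L) fu gv.
Qed.

Local Notation endact := (end_action Hopf pi).

Lemma endact_bilinear f psi : let B a b := pi a (T f (pi (antipode Hopf b) psi)) in
  (forall a, linear (B a)) /\ (forall b, linear (B^~ b)).
Proof.
split=> [a x u v|b x u v]; last by rewrite pi_linearl.
by rewrite antipode_linear pi_linearl !linearP.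
Qed.

Lemma endact_tensor xi t f psi : tensor_eq (Delta Hopf xi) t ->
  endact xi (T f) psi = \sum_(p <- t) pi p.1 (T f (pi (antipode Hopf p.2) psi)).
Proof.
move=> xt; have [Bl Br] := endact_bilinear f psi.
exact: (xt _ (fun a b => pi a (T f (pi (antipode Hopf b) psi))) Bl Br).
Qed.

Definition equivariant xi : Prop :=
  forall f psi, T (act xi f) psi = endact xi (T f) psi.

Lemma equivariant_K k : equivariant (K k).
Proof.
move=> f psi; rewrite (endact_tensor _ _ (Delta_K Uq_su k)) big_seq1 /=.
rewrite (antipode_K Uq_su); apply: (toeplitzE q_gt0 q_lt1 alpha_gt0).
rewrite -[Cz_val psi](twK_twKV alpha q_gt0 act_module k).
rewrite -(twKM alpha Uq_su act_module) -pi_twKV.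
exact/projects_to_twK/projects_to_toeplitz.
Qed.

Lemma equivariant_KV k : equivariant (KV k).
Proof.
move=> f psi; rewrite (endact_tensor _ _ (Delta_KV Uq_su k)) big_seq1 /=.
rewrite (antipode_KV Uq_su); apply: (toeplitzE q_gt0 q_lt1 alpha_gt0).
rewrite -[Cz_val psi](twKV_twK alpha q_gt0 act_module k).
rewrite -(twKVM alpha Uq_su act_module) -pi_twK.
exact/projects_to_twKV/projects_to_toeplitz.
Qed.

(** Solve the product rule of [twE] for [E k f * psi], and rewrite the remaining
    term as a value of [twK]: both terms then project as required. *)
Lemma equivariant_E k : equivariant (E k).
Proof.
move=> f psi; rewrite (endact_tensor _ _ (Delta_E Uq_su k)) big_cons big_seq1 /=.
rewrite antipode1 pi1 (antipode_E Uq_su) pi_opp pi_mul !linearN /=.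
apply: (toeplitzE q_gt0 q_lt1 alpha_gt0).
have -> : act (E k) f * Cz_val psi = twE alpha act k (f * Cz_val psi)
    - twK alpha act k (f * Cz_val (pi (KV k) (pi (E k) psi))).
  rewrite (twEM alpha Uq_su act_module) (twKM alpha Uq_su act_module).
  by rewrite pi_twKV pi_twE (twK_twKV alpha q_gt0 act_module) addrK.
by apply: projects_toB;
  [apply: projects_to_twE|apply: projects_to_twK]; exact: projects_to_toeplitz.
Qed.

Lemma equivariant_F k : equivariant (F k).
Proof.
move=> f psi; rewrite (endact_tensor _ _ (Delta_F Uq_su k)) big_cons big_seq1 /=.
rewrite pi1 (antipode_KV Uq_su) (antipode_F Uq_su) pi_opp pi_mul !linearN /=.
apply: (toeplitzE q_gt0 q_lt1 alpha_gt0).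
have -> : act (F k) f * Cz_val psi = twF alpha act k (f * Cz_val (pi (K k) psi))
    - f * Cz_val (pi (F k) (pi (K k) psi)).
  rewrite (twFM alpha Uq_su act_module) !(pi_twF, pi_twK).
  by rewrite (twKV_twK alpha q_gt0 act_module) addrK.
apply: projects_toB; last exact: projects_to_toeplitz.
by apply: projects_to_twF; exact: projects_to_toeplitz.
Qed.

Lemma endact_linear f psi : linear (fun xi => endact xi (T f) psi).
Proof.
move=> a xi eta; rewrite (endact_tensor _ _ (Delta_linear Hopf a xi eta)).
rewrite big_cat big_map scaler_sumr; congr (_ + _).
by apply: eq_bigr => p _ /=; rewrite pi_scale.
Qed.

(** [Delta] is multiplicative and the antipode antimultiplicative, so the formula for
    [xi], applied after the one for [eta], unfolds to the formula for [xi * eta]. *)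
Lemma equivariant_mul xi eta :
  equivariant xi -> equivariant eta -> equivariant (xi * eta).
Proof.
move=> Pxi Peta f psi; rewrite (endact_tensor _ _ (DeltaM Hopf xi eta)).
rewrite (act_mul act_module) Pxi /end_action big_allpairs_dep.
apply: eq_bigr => p _; rewrite Peta /end_action linear_sum; apply: eq_bigr => r _ /=.
by rewrite antipodeM !pi_mul.
Qed.

Lemma equivariant_lin a xi eta :
  equivariant xi -> equivariant eta -> equivariant (a *: xi + eta).
Proof.
move=> Pxi Peta f psi; rewrite endact_linear -Pxi -Peta -toeplitz_linearl.
by rewrite (act_linearl act_module).
Qed.

Lemma equivariant1 : equivariant 1.
Proof.
move=> f psi; rewrite (endact_tensor _ _ (Delta1 Hopf)) big_seq1 /= antipode1 !pi1.
by rewrite (act_one act_module).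
Qed.

Lemma equivariant_all xi : equivariant xi.
Proof.
have P0 : equivariant 0.
  by rewrite -(addNr 1) -scaleN1r; apply: equivariant_lin; exact: equivariant1.
elim/palg_ind: xi; elim=> [[k|k|k|k]|a|s IHs t IHt|s IHs t IHt].
- exact: equivariant_E.
- exact: equivariant_F.
- exact: equivariant_K.
- exact: equivariant_KV.
- rewrite pclass_cst -[_ *: _]addr0; apply: equivariant_lin => //; exact: equivariant1.
- by rewrite pclass_add -[pclass s]scale1r; exact: equivariant_lin.
- by rewrite pclass_mul; exact: equivariant_mul.
Qed.

End Equivariance.

Theorem proposition3p3 (R : realType) (n : nat) (q alpha : R)
    (n_ge1 : (1 <= n)%N) (q_gt0 : 0 < q) (q_lt1 : q < 1) (alpha_gt0 : 0 < alpha)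
    (Hopf : hopf_star_algebra (Uq n q)) (Uq_su : is_Uq_su Hopf)
    (act : Uq n q -> FU n q -> FU n q) (act_module : is_FU_module Hopf act)
    (H : fock_space n q) (L : L2_space H alpha)
    (pi_alpha : Uq n q -> Cz n q -> Cz n q)
    (pi_twisted : is_twisted_action act alpha pi_alpha) :
  [/\ forall f : FU n q, linear (toeplitz L f),
      forall (a : R[i]) (f g : FU n q) (psi : Cz n q),
        toeplitz L (a *: f + g) psi = a *: toeplitz L f psi + toeplitz L g psi
    & forall (xi : Uq n q) (f : FU n q) (psi : Cz n q),
        toeplitz L (act xi f) psi = end_action Hopf pi_alpha xi (toeplitz L f) psi].
Proof.
split=> [f|a f g psi|xi f psi].
- exact: (toeplitz_linear q_gt0 q_lt1 alpha_gt0).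
- exact: (toeplitz_linearl q_gt0 q_lt1 alpha_gt0).
exact: (equivariant_all q_gt0 q_lt1 alpha_gt0 Uq_su act_module L pi_twisted).
Qed.
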